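(* Let $1<p<q<\infty$ and $\alpha\in(0,1)$ such that $\frac{1}{q}=\frac{1}{p}-\alpha$. If $b\in CMO(\mathbb{R})$, then the commutator $[b,I_{\alpha}^{+}]$ is compact from $L^{p}(\mathbb{R})$ to $L^{q}(\mathbb{R})$.
   Context: $I_{\alpha}^{+}f(x)=\int_{x}^{\infty}\frac{f(y)}{(y-x)^{1-\alpha}}dy$ is the one-sided fractional integral. $[b,I_{\alpha}^{+}]f=bI_{\alpha}^{+}f-I_{\alpha}^{+}(bf)$. $CMO(\mathbb{R})$ is the closure of $C_{c}^{\infty}(\mathbb{R})$ in the $BMO$ norm. An operator is compact if the image of the unit ball is relatively compact. *)

(* Defs.v *)
From HB Require Import structures.
From mathcomp Require Import all_boot all_order all_algebra.
From mathcomp Require Import all_classical all_reals all_analysis.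
Set Implicit Arguments. Unset Strict Implicit. Unset Printing Implicit Defensive.
Import Order.TTheory GRing.Theory Num.Theory.
Import numFieldNormedType.Exports.
Local Open Scope classical_set_scope.
Local Open Scope ring_scope.

Section Defs.
Context {R : realType}.
Local Notation leb := (@lebesgue_measure R).

Definition inLp (p : R) (f : R -> R) : Prop := f \in Lfun leb p%:E.

Definition Lpnorm (p : R) (f : R -> R) : \bar R := 'N[leb]_p%:E[EFin \o f].

Definition frac_int_plus (alpha : R) (f : R -> R) (x : R) : R :=
  Rintegral leb `]x, +oo[ (fun y => f y * (y - x) `^ (alpha - 1)).

Definition comm_frac_int (b : R -> R) (alpha : R) (f : R -> R) (x : R) : R :=
  b x * frac_int_plus alpha f x - frac_int_plus alpha (fun y => b y * f y) x.

Definition locally_integrable (f : R -> R) : Prop :=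
  measurable_fun setT f /\
  forall a c : R, leb.-integrable `[a, c] (EFin \o f).

Definition interval_avg (f : R -> R) (a c : R) : R :=
  (c - a)^-1 * Rintegral leb `[a, c] f.

Definition mean_osc (f : R -> R) (a c : R) : R :=
  (c - a)^-1 * Rintegral leb `[a, c] (fun x => `|f x - interval_avg f a c|).

Definition bmo_norm (f : R -> R) : \bar R :=
  ereal_sup [set e | exists a c : R, a < c /\ e = (mean_osc f a c)%:E].

Definition inBMO (f : R -> R) : Prop :=
  locally_integrable f /\ (bmo_norm f < +oo)%E.

Definition smooth (f : R -> R) : Prop :=
  forall (n : nat) (x : R), derivable (derive1n n f) x 1.

Definition compact_support (f : R -> R) : Prop :=
  exists M : R, forall x, M < `|x| -> f x = 0.

Definition inCMO (b : R -> R) : Prop :=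
  inBMO b /\
  forall eps : R, 0 < eps -> exists phi : R -> R,
    smooth phi /\ compact_support phi /\
    (bmo_norm (fun x => (b x - phi x)%R) < eps%:E)%E.

(* Compactness of an operator T : L^p -> L^q: the image of the closed unit
   ball of L^p is relatively compact in L^q, expressed (L^q being a metric
   space) sequentially: every sequence in the unit ball has a subsequence
   whose image converges in L^q norm to an element of L^q. *)
Definition compact_op (p q : R) (T : (R -> R) -> (R -> R)) : Prop :=
  forall fs : nat -> (R -> R),
    (forall n, inLp p (fs n) /\ (Lpnorm p (fs n) <= 1%:E)%E) ->
    exists (phi : nat -> nat) (g : R -> R),
      {homo phi : m n / (m < n)%N} /\ inLp q g /\
      forall eps : R, 0 < eps -> exists N : nat, forall n, (N <= n)%N ->
        (Lpnorm q (fun x => (T (fs (phi n)) x - g x)%R) < eps%:E)%E.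

End Defs.

(* Main.v *)
(**
  The commutator with symbol [b] has kernel [(b x - b y) (y - x)^(alpha - 1)] on
  [x < y].  Two facts give compactness.

  The operator with the positive kernel [|b x - b y| (y - x)^(alpha - 1)] maps
  [L^p] to [L^q] with norm at most [C ||b||_BMO].  By the one-third trick it is
  dominated by sums over the halving trees of two intervals of
  [|Q|^(alpha - 1) (|b x - b_Q| int_Q f + int_Q |b - b_Q| f)].  Pairing with [g] in
  [L^q'] and using Hoelder and John-Nirenberg on each [Q], what is left is
  [sum_Q |Q|^(alpha + 1) <f>_Q <g>_Q], where [<f>_Q] and [<g>_Q] are averages of
  order [s > 1] close to [1].  Along a branch of the tree, [<g>_Q] is at most the
  dyadic maximal function of [g] and Hedberg's argument sums
  [|Q|^alpha <f>_Q] to a power of the dyadic maximal function of [f]; Doob's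
  inequality concludes.  John-Nirenberg and Doob are proved on finite trees of
  averages and transferred to integrals by Lebesgue differentiation and Fatou.

  If the symbol [phi] is smooth with compact support, the kernel is bounded by
  [C w x * w y] with [w t = (1 + |t|)^(alpha - 1)], which lies in [L^q] and [L^p'],
  and [x |-> K x] is continuous into [L^p'].  A sequence in the unit ball of [L^p]
  has a subsequence whose images converge at all rational points, hence everywhere
  by equicontinuity, hence in [L^q] by dominated convergence.

  Approximating [b] in BMO by such [phi_k], one diagonal subsequence serves all [k];
  along it the commutators form a Cauchy sequence in [L^q].
*)
Require Import Defs.
From mathcomp Require Import all_boot all_order all_algebra.
From mathcomp Require Import all_classical all_reals all_analysis.
From mathcomp Require Import measurable_realfun ring lra.
Set Implicit Arguments. Unset Strict Implicit. Unset Printing Implicit Defensive.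
Import Order.TTheory GRing.Theory Num.Theory.
Import numFieldNormedType.Exports.
Local Open Scope classical_set_scope.
Local Open Scope ring_scope.

(** * Sums over halving trees *)

Section Trees.
Context {R : realType}.
Implicit Types (phi psi v : R -> R -> R) (a c u w x : R).

(** The obstacle is that [b] is unbounded: the two halves of the commutator cannot be estimated
    separately, only their difference can. The given definition is a difference of two [Rintegral]s,
    and it agrees with the kernel form only where the positive operators with kernels built on [1]
    and on [|b x - b y|] are finite. Hence these operators take values in the extended reals and are
    bounded first; finiteness almost everywhere follows.

    The dyadic estimates are made on trees of finite depth, with constants independent of the depth
    and of the root, so that limits are taken only at the end. John-Nirenberg is applied for one
    power only, an integer [m] above both [p / (p - 1)] and [q]. Its conjugate exponent [s] then
    lies below [p] and below [q'], so that Doob's inequality is available for the exponents [p / s]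
    and [q' / s].

    The approximation in BMO enters through differences: for [f] and [g] in the unit ball, the
    images under the commutator of [b] differ by what they differ for the smooth symbol, up to an
    error governed by the BMO distance of the symbols. *)

Fixpoint node_sum (n : nat) phi a c : R :=
  phi a c + (if n is k.+1
             then node_sum k phi a ((a + c) / 2) + node_sum k phi ((a + c) / 2) c
             else 0).

Fixpoint leaf_sum (n : nat) phi a c : R :=
  if n is k.+1
  then leaf_sum k phi a ((a + c) / 2) + leaf_sum k phi ((a + c) / 2) c
  else phi a c.

Lemma mid_lt a c : a < c -> a < (a + c) / 2 /\ (a + c) / 2 < c.
Proof. by move=> ac; split; lra. Qed.

Lemma node_sumZ k phi n a c :
  node_sum n (fun u w => k * phi u w) a c = k * node_sum n phi a c.
Proof.
elim: n a c => [|n ih] a c /=; first by rewrite !addr0.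
by rewrite !ih !mulrDr.
Qed.

Lemma leaf_sum_le phi psi : (forall u w, u < w -> phi u w <= psi u w) ->
  forall n a c, a < c -> leaf_sum n phi a c <= leaf_sum n psi a c.
Proof.
move=> h; elim=> [|n ih] a c ac /=; first exact: h.
by have [am mc] := mid_lt ac; rewrite !lerD ?ih.
Qed.

Lemma leaf_sum_superadd phi :
  (forall u w, u < w -> phi u ((u + w) / 2) + phi ((u + w) / 2) w <= phi u w) ->
  forall n a c, a < c -> leaf_sum n phi a c <= phi a c.
Proof.
move=> h; elim=> [|n ih] a c ac //=.
have [am mc] := mid_lt ac.
by apply: le_trans (h _ _ ac); rewrite lerD ?ih.
Qed.

Lemma leaf_sum_subadd phi :
  (forall u w, u < w -> phi u w <= phi u ((u + w) / 2) + phi ((u + w) / 2) w) ->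
  forall n a c, a < c -> phi a c <= leaf_sum n phi a c.
Proof.
move=> h; elim=> [|n ih] a c ac //=.
have [am mc] := mid_lt ac.
by apply: le_trans (h _ _ ac) _; rewrite lerD ?ih.
Qed.

(** Young's inequality for [M ^ (r - 1)] and [z] with the exponents [r / (r - 1)] and [r]; in other
    words, the tangent of [t ^ r] at [M] lies below the graph. It gives both properties of
    [doob_potential]. *)
Lemma powR_young (r M z : R) : 1 < r -> 0 <= M -> 0 <= z ->
  r * (M `^ (r - 1) * z) <= (r - 1) * M `^ r + z `^ r.
Proof.
move=> r1 M0 z0.
have r0 : 0 < r by lra.
have r'0 : 0 < r / (r - 1) by rewrite divr_gt0 // subr_gt0.
have rn : r != 0 by rewrite gt_eqF.
have rn1 : r - 1 != 0 by rewrite gt_eqF // subr_gt0.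
have := @conjugate_powR R (M `^ (r - 1)) z (r / (r - 1)) r (powR_ge0 _ _) z0 r'0 r0.
have -> : (r / (r - 1))^-1 + r^-1 = 1 by field; rewrite rn rn1.
move=> /(_ erefl).
rewrite -powRrM.
have -> : (r - 1) * (r / (r - 1)) = r by field.
move=> h; apply: le_trans (ler_wpM2l (ltW r0) h) _.
by rewrite le_eqVlt; apply/orP; left; apply/eqP; field; rewrite rn rn1.
Qed.

(** The integral of [G] of the dyadic maximal function of the averages [v], cut at depth [n]. The
    argument [X] carries the maximum over the ancestors. *)
Fixpoint leaf_max (G : R -> R) (n : nat) v a c (X : R) : R :=
  if n is k.+1
  then leaf_max G k v a ((a + c) / 2) (Num.max X (v a c))
       + leaf_max G k v ((a + c) / 2) c (Num.max X (v a c))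
  else (c - a) * G (Num.max X (v a c)).

Definition doob_potential (r x M : R) :=
  r * (M `^ (r - 1) * (M - r / (r - 1) * x)).

Lemma doob_potential_ge (r x M : R) : 1 < r -> 0 <= x -> 0 <= M ->
  M `^ r <= (r / (r - 1)) `^ r * x `^ r + doob_potential r x M.
Proof.
move=> r1 x0 M0; rewrite /doob_potential.
have r0 : 0 < r by lra.
have k0 : 0 <= r / (r - 1) by rewrite divr_ge0 // ltW // subr_gt0.
have z0 : 0 <= r / (r - 1) * x by rewrite mulr_ge0.
have := powR_young r1 M0 z0.
have eM : M `^ (r - 1) * M = M `^ r by rewrite mulrC mulr_powRB1.
rewrite -powRM // [M `^ (r - 1) * (M - _)]mulrBr eM mulrBr.
by move: (M `^ (r - 1) * _) (M `^ r) => A B; rewrite mulrBl mul1r => y; lra.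
Qed.

(** For [M] below [x] the potential decreases in [M]. The difference of its values at [M] and at [x]
    is [r / (r - 1)] times the defect in Young's inequality. *)
Lemma doob_potential_max (r x M : R) : 1 < r -> 0 <= x -> 0 <= M ->
  doob_potential r x (Num.max M x) <= doob_potential r x M.
Proof.
move=> r1 x0 M0.
have [xM|Mx] := leP x M; first by [].
rewrite /doob_potential.
have r0 : 0 < r by lra.
have rn1 : r - 1 != 0 by rewrite gt_eqF // subr_gt0.
have y := powR_young r1 M0 x0.
have eM : M `^ (r - 1) * M = M `^ r by rewrite mulrC mulr_powRB1.
have ex : x `^ (r - 1) * x = x `^ r by rewrite mulrC mulr_powRB1.
rewrite !(mulrBr (_ `^ _)) eM ex ![_ `^ (r - 1) * (_ / _ * _)]mulrCA ex !mulrBr.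
have -> : r * x `^ r - r * (r / (r - 1) * x `^ r) = - (r / (r - 1)) * x `^ r by field.
have -> : r * M `^ r - r * (r / (r - 1) * (M `^ (r - 1) * x)) =
   r / (r - 1) * ((r - 1) * M `^ r - r * (M `^ (r - 1) * x)) by field.
rewrite mulNr -mulrN ler_wpM2l //; first by rewrite divr_ge0 ?subr_ge0 // ltW.
by move: y; move: (M `^ (r - 1) * x) => Y y; lra.
Qed.

(* Doob's inequality, by a Bellman function: [doob_potential r] dominates
   [M ^ r - r' ^ r * x ^ r], is affine in [x] and decreases along the tree. *)
Lemma leaf_max_doob (r : R) v : 1 < r ->
  (forall u w, u < w -> 0 <= v u w) ->
  (forall u w, u < w ->
     v u ((u + w) / 2) + v ((u + w) / 2) w = 2 * v u w) ->
  forall n a c X, a < c -> 0 <= X ->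
  leaf_max (fun t => t `^ r) n v a c X <=
    (r / (r - 1)) `^ r * leaf_sum n (fun u w => (w - u) * v u w `^ r) a c
    + (c - a) * doob_potential r (v a c) (Num.max X (v a c)).
Proof.
move=> r1 v0 vm; elim=> [|n ih] a c X ac X0 /=.
  rewrite mulrCA -mulrDr ler_wpM2l ?subr_ge0 ?(ltW ac) //.
  by rewrite doob_potential_ge ?le_max ?v0 ?X0.
have [am mc] := mid_lt ac.
set M := Num.max X (v a c); set m := (a + c) / 2.
have M0 : 0 <= M by rewrite le_max X0.
have h1 := ih a m M am M0; have h2 := ih m c M mc M0.
have ma : m - a = (c - a) / 2 by rewrite /m; lra.
have cm : c - m = (c - a) / 2 by rewrite /m; lra.
have g1 := doob_potential_max r1 (v0 _ _ am) M0.
have g2 := doob_potential_max r1 (v0 _ _ mc) M0.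
have ca2 : 0 <= (c - a) / 2 by lra.
apply: le_trans (lerD h1 h2) _.
rewrite ma cm addrACA -mulrDr lerD2l -mulrDr.
apply: le_trans (ler_wpM2l ca2 (lerD g1 g2)) _.
have := vm a c ac; rewrite -/m /doob_potential => e.
have e' : v m c = 2 * v a c - v a m by rewrite -e addrC addKr.
rewrite e'; move: (M `^ _) (r / (r - 1)) => A B.
by rewrite le_eqVlt; apply/orP; left; apply/eqP; field.
Qed.

(** At the root the running maximum equals the average, and there the potential is at most 0 because
    [1 <= r / (r - 1)]. What remains of Doob's inequality is a leaf sum, which the superadditive [F]
    majorises. *)
Lemma leaf_max_le (r : R) v (F : R -> R -> R) (n : nat) a c : 1 < r -> a < c ->
  (forall u w, u < w -> 0 <= v u w) ->
  (forall u w, u < w ->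
     v u ((u + w) / 2) + v ((u + w) / 2) w = 2 * v u w) ->
  (forall u w, u < w -> (w - u) * v u w `^ r <= F u w) ->
  (forall u w, u < w -> F u ((u + w) / 2) + F ((u + w) / 2) w <= F u w) ->
  leaf_max (fun t => t `^ r) n v a c 0 <= (r / (r - 1)) `^ r * F a c.
Proof.
move=> r1 ac v0 vm vF Fadd.
apply: le_trans (leaf_max_doob r1 v0 vm n ac (lexx _)) _.
rewrite (max_idPr (v0 _ _ ac)) -[leRHS]addr0 lerD //.
  rewrite ler_wpM2l ?powR_ge0 //.
  exact: le_trans (leaf_sum_le vF n ac) (leaf_sum_superadd Fadd n ac).
rewrite mulr_ge0_le0 ?subr_ge0 ?(ltW ac) // /doob_potential.
rewrite mulr_ge0_le0 //; first lra.
rewrite mulr_ge0_le0 ?powR_ge0 // subr_le0 ler_peMl ?v0 //.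
by rewrite ler_pdivlMr ?subr_gt0 // mul1r; lra.
Qed.

End Trees.

(** * Hedberg summation along a branch *)

Section ScaleSum.
Context {R : realType}.
Variables (al ip iq : R).
Hypotheses (al0 : 0 < al) (iq0 : 0 < iq) (ipE : ip = iq + al).
Implicit Types rho X Y : R.

(** Here [rho] is the length of the current interval, doubled from a node to its parent. [X] stands
    for the maximal function and [rho ^ (- ip)] for the Hoelder bound on the average of a function
    in the unit ball of [L^p], with [ip = 1 / p] and [iq = 1 / q]. *)
Fixpoint scale_sum (d : nat) rho X : R :=
  if d is k.+1
  then rho `^ al * Num.min X (rho `^ (- ip)) + scale_sum k (2 * rho) X
  else 0.

Let ip0 : 0 < ip. Proof. by rewrite ipE addr_gt0. Qed.

Lemma scale_sum_ge0 d rho X : 0 <= X -> 0 <= scale_sum d rho X.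
Proof.
move=> X0; elim: d rho => [|d ih] rho //=.
by rewrite addr_ge0 // mulr_ge0 ?powR_ge0 // le_min X0 powR_ge0.
Qed.

Lemma scale_sum_le d rho X Y : X <= Y -> scale_sum d rho X <= scale_sum d rho Y.
Proof.
move=> XY; elim: d rho => [|d ih] rho //=.
by rewrite lerD // ler_wpM2l ?powR_ge0 // le_min !ge_min XY lexx orbT.
Qed.

(** A geometric series rising with ratio [2 ^ al] sums to at most [1 + (2 ^ al - 1)^-1] times its
    last term, and one falling with ratio [2 ^ (- iq)] to at most [(1 - 2 ^ (- iq))^-1] times its
    first. *)
Definition scale_const : R :=
  1 + (2 `^ al - 1)^-1 + (1 - 2 `^ (- iq))^-1.

Let two_al : 0 < 2 `^ al - 1.
Proof.
rewrite subr_gt0 -[ltLHS](powRr0 2) /powR gt_eqF //.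
by rewrite mul0r ltr_expR mulr_gt0 // ln_gt0 // ltr1n.
Qed.

Let two_iq : 0 < 1 - 2 `^ (- iq).
Proof.
rewrite subr_gt0 powRN invf_lt1 ?powR_gt0 // /powR gt_eqF //.
by rewrite expR_gt1 mulr_gt0 // ln_gt0 // ltr1n.
Qed.

Lemma scale_const_ge0 : 0 <= scale_const.
Proof. by rewrite !addr_ge0 // invr_ge0 ltW. Qed.

Lemma scale_sum_large d rho X : 0 < rho ->
  scale_sum d rho X <= (1 - 2 `^ (- iq))^-1 * rho `^ (- iq).
Proof.
elim: d rho => [|d ih] rho rho0 /=.
  by rewrite mulr_ge0 ?powR_ge0 // invr_ge0 ltW.
have h : rho `^ al * Num.min X (rho `^ (- ip)) <= rho `^ (- iq).
  have -> : - iq = al + - ip by rewrite ipE; lra.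
  rewrite [leRHS]powRD; last by apply/implyP => _; rewrite gt_eqF.
  by rewrite ler_wpM2l ?powR_ge0 // ge_min lexx orbT.
have rho2 : 0 < 2 * rho by lra.
apply: le_trans (lerD h (ih _ rho2)) _.
rewrite powRM ?(ltW rho0) //.
have := two_iq; move: (2 `^ _) (rho `^ (- iq)) => t z h1.
rewrite le_eqVlt; apply/orP; left; apply/eqP; field.
by rewrite gt_eqF.
Qed.

(* Hedberg: the terms grow geometrically while [X <= rho ^ (- ip)] and decay
   geometrically afterwards, and at the crossover both equal [X ^ (iq / ip)]. *)
Lemma scale_sum_hedberg d rho X : 0 < rho -> 0 <= X ->
  scale_sum d rho X <= scale_const * X `^ (iq / ip).
Proof.
move=> rho0; rewrite le_eqVlt => /predU1P[<-|X0].
  rewrite powR0 ?mulr0; last by rewrite mulf_neq0 ?invr_eq0 ?gt_eqF.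
  elim: d rho rho0 => [|d ih] rho rho0 //=.
  by rewrite (min_idPl _) ?powR_ge0 // mulr0 add0r ih // mulr_gt0.
set Y := X `^ (iq / ip).
have Y0 : 0 <= Y := powR_ge0 _ _.
set D := (2 `^ al - 1)^-1; set E := (1 - 2 `^ (- iq))^-1.
have D0 : 0 <= D by rewrite invr_ge0 ltW.
have E0 : 0 <= E by rewrite invr_ge0 ltW.
have CE : scale_const = 1 + D + E by [].
have VY t : 0 < t -> t `^ (- ip) <= X -> t `^ (- iq) <= Y.
  move=> t0 tX; rewrite /Y.
  have -> : t `^ (- iq) = (t `^ (- ip)) `^ (iq / ip).
    by rewrite -powRrM; congr (_ `^ _); field; rewrite gt_eqF.
  rewrite ge0_ler_powR ?nnegrE ?powR_ge0 ?(ltW X0) //.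
  by rewrite divr_ge0 ?ltW.
have UY t : 0 < t -> X <= t `^ (- ip) -> t `^ al * X <= Y.
  move=> t0 tX.
  have -> : Y = X `^ (- (al / ip)) * X.
    rewrite -{2}(powRr1 (ltW X0)) -powRD; last by apply/implyP => _; rewrite gt_eqF.
    by rewrite /Y; congr (_ `^ _); rewrite ipE; field; rewrite -ipE gt_eqF.
  rewrite ler_wpM2r ?(ltW X0) // powRN -[leLHS]invrK -powRN.
  rewrite lef_pV2 ?posrE ?powR_gt0 //.
  have -> : t `^ (- al) = (t `^ (- ip)) `^ (al / ip).
    by rewrite -powRrM; congr (_ `^ _); field; rewrite gt_eqF.
  rewrite ge0_ler_powR ?nnegrE ?powR_ge0 ?(ltW X0) //.
  by rewrite divr_ge0 ?ltW.
(* The subtracted term is the geometric series continued below scale [t]. It closes the induction: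
   since [D * (2 ^ al - 1) = 1], adding the term at [t] turns the bound at [2 * t] into the bound at
   [t]. *)
have small : forall e t, 0 < t -> X <= t `^ (- ip) ->
    scale_sum e t X <= scale_const * Y - D * (t `^ al * X).
  elim=> [|e ih] t t0 tX /=.
    rewrite subr_ge0 CE -[leLHS]addr0 mulrDl lerD ?mulr_ge0 //.
    rewrite mulrDl mul1r -[leLHS]add0r lerD // ler_wpM2l //; exact: UY.
  have t20 : 0 < 2 * t by lra.
  rewrite (min_idPl tX).
  have [h|h] := leP X ((2 * t) `^ (- ip)).
    apply: le_trans (lerD (lexx _) (ih _ t20 h)) _.
    rewrite powRM ?(ltW t0) // /D.
    have := two_al; move: (2 `^ _) (t `^ _) => a z a0.
    rewrite le_eqVlt; apply/orP; left; apply/eqP; field.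
    by rewrite gt_eqF.
  apply: le_trans (lerD (lexx _) (scale_sum_large _ _ t20)) _.
  rewrite -/E CE.
  have h1 := ler_wpM2l E0 (VY _ t20 (ltW h)).
  have h2 := UY _ t0 tX.
  have h3 := ler_wpM2l D0 h2.
  move: h1 h2 h3; move: (t `^ al * X) ((2 * t) `^ _) => z1 z2.
  rewrite !mulrDl mul1r; lra.
have [h|h] := leP X (rho `^ (- ip)).
  apply: le_trans (small _ _ rho0 h) _.
  by rewrite gerBl mulr_ge0 // mulr_ge0 ?powR_ge0 // ltW.
apply: le_trans (scale_sum_large _ _ rho0) _.
rewrite -/E CE mulrDl -[leLHS]add0r lerD ?mulr_ge0 ?addr_ge0 //.
by rewrite ler_wpM2l // VY // ltW.
Qed.

(* [S] accumulates the terms of the ancestors of the current node; bounding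
   them by the running maximum of [vb] leaves a sum over scales of [va]. *)
Lemma node_sum_leaf_max (p q' s : R) (va vb : R -> R -> R) :
  0 < p -> 0 < q' -> 0 < s -> p^-1 = ip -> q'^-1 + iq = 1 ->
  (forall u w, u < w -> 0 <= va u w) -> (forall u w, u < w -> 0 <= vb u w) ->
  (forall u w, u < w -> va u w `^ s^-1 <= (w - u) `^ (- ip)) ->
  forall n a c d (X Y S : R), a < c -> 0 <= X -> 0 <= Y ->
  S <= Y `^ s^-1 * scale_sum d (2 * (c - a)) (X `^ s^-1) ->
  node_sum n (fun u w => (w - u) `^ (al + 1) * (va u w `^ s^-1 * vb u w `^ s^-1)) a c
    + S * (c - a) <=
  scale_const * (leaf_max (fun t => t `^ (p / s)) n va a c X
                 + leaf_max (fun t => t `^ (q' / s)) n vb a c Y).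
Proof.
move=> p0 q'0 s0 pE qE va0 vb0 vap.
have s'0 : 0 <= s^-1 by rewrite invr_ge0 ltW.
(* The term of the node itself lengthens the scale sum by one. Passing to the new running maxima
   only increases the inherited part, and [vap] supplies the second argument of the minimum. *)
have step a c d X Y S : a < c -> 0 <= X -> 0 <= Y ->
    S <= Y `^ s^-1 * scale_sum d (2 * (c - a)) (X `^ s^-1) ->
    S + (c - a) `^ al * (va a c `^ s^-1 * vb a c `^ s^-1) <=
    Num.max Y (vb a c) `^ s^-1 *
      scale_sum d.+1 (c - a) (Num.max X (va a c) `^ s^-1).
  move=> ac X0 Y0 hS; rewrite /= mulrDr addrC; apply: lerD.
    rewrite mulrA [leRHS]mulrC; apply: ler_pM; rewrite ?mulr_ge0 ?powR_ge0 //.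
      rewrite ler_wpM2l ?powR_ge0 // le_min vap // andbT.
      by rewrite ge0_ler_powR // ?nnegrE ?va0 // le_max ?va0 ?X0 // lexx orbT.
    by rewrite ge0_ler_powR // ?nnegrE ?vb0 // le_max ?vb0 ?Y0 // lexx orbT.
  apply: le_trans hS _; apply: ler_pM; rewrite ?powR_ge0 ?scale_sum_ge0 ?powR_ge0 //.
    by rewrite ge0_ler_powR // ?nnegrE // le_max ?Y0 // lexx.
  apply: scale_sum_le.
  by rewrite ge0_ler_powR // ?nnegrE // le_max ?X0 // lexx.
elim=> [|n ih] a c d X Y S ac X0 Y0 hS /=; move: (step a c d X Y S ac X0 Y0 hS);
  have ca0 : 0 < c - a by [rewrite subr_gt0]; set M := Num.max X _; set N := Num.max Y _;
  have M0 : 0 <= M by [rewrite le_max X0]; have N0 : 0 <= N by [rewrite le_max Y0];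
  set T := (c - a) `^ al * _ => hST;
  have hT : (c - a) `^ (al + 1) * (va a c `^ s^-1 * vb a c `^ s^-1) = T * (c - a)
    by [rewrite powRD ?[c - a == 0]gt_eqF ?implybT // powRr1 ?(ltW ca0) // /T; ring].
- rewrite addr0 hT -mulrDl -mulrDr mulrCA [leRHS]mulrC [T + S]addrC.
  rewrite ler_wpM2r ?(ltW ca0) //.
  apply: le_trans hST _.
  have h := scale_sum_hedberg d.+1 ca0 (powR_ge0 M s^-1).
  apply: le_trans (ler_wpM2l (powR_ge0 _ _) h) _.
  rewrite mulrCA ler_wpM2l ?scale_const_ge0 //.
  (* Young's inequality with the exponents [q'] and [q = iq^-1]. Since [iq / ip * q = p], the
     product splits into the powers [p / s] and [q' / s] of the two maximal functions. *)
  have y := @conjugate_powR R (N `^ s^-1) ((M `^ s^-1) `^ (iq / ip)) q' iq^-1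
     (powR_ge0 _ _) (powR_ge0 _ _) q'0.
  rewrite invr_gt0 invrK in y; move: (y iq0 qE) => {y} y.
  have q'i : 0 < q'^-1 by rewrite invr_gt0.
  apply: le_trans y _; rewrite addrC -!powRrM lerD //.
    have -> : s^-1 * (iq / ip * iq^-1) = p / s.
      by rewrite -pE; field; rewrite !gt_eqF.
    by rewrite ler_piMr ?powR_ge0 //; move: qE q'i iq0; lra.
  have -> : s^-1 * q' = q' / s by rewrite mulrC.
  by rewrite ler_piMr ?powR_ge0 //; move: qE q'i iq0; lra.
- have [am mc] := mid_lt ac.
  have ma : 2 * ((a + c) / 2 - a) = c - a by lra.
  have cm : 2 * (c - (a + c) / 2) = c - a by lra.
  have h1 := ih a _ d.+1 M N (S + T) am M0 N0; rewrite ma in h1.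
  have h2 := ih _ c d.+1 M N (S + T) mc M0 N0; rewrite cm in h2.
  have := lerD (h1 hST) (h2 hST).
  rewrite hT -mulrDr [X in _ <= _ * X -> _]addrACA; apply: le_trans.
  move: (node_sum _ _ _ _) (node_sum _ _ _ _) => z1 z2.
  rewrite le_eqVlt; apply/orP; left; apply/eqP; by field.
Qed.

End ScaleSum.

(** * The John-Nirenberg inequality *)

Section TreeJohnNirenberg.
Context {R : realType}.
Variables (v : R -> R -> R).
Hypothesis v_avg : forall u w, u < w ->
  v u ((u + w) / 2) + v ((u + w) / 2) w = 2 * v u w.
Hypothesis v_osc : forall n u w, u < w ->
  leaf_sum n (fun u' w' => (w' - u') * `|v u' w' - v u w|) u w <= w - u.

(** At depth 1, [v_osc] weights each half by one half; hence the 2. *)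
Let child_jump u w : u < w ->
  `|v u ((u + w) / 2) - v u w| <= 2 /\ `|v ((u + w) / 2) w - v u w| <= 2.
Proof.
move=> uw; have := v_osc 1 uw => /=.
have -> : (u + w) / 2 - u = (w - u) / 2 by lra.
have -> : w - (u + w) / 2 = (w - u) / 2 by lra.
move: (normr_ge0 (v u ((u + w) / 2) - v u w)) (normr_ge0 (v ((u + w) / 2) w - v u w)).
move: (`| _ |) (`| _ |) => x y x0 y0; rewrite -mulrDr => h.
have wu : 0 < w - u by rewrite subr_gt0.
have : (w - u) * ((x + y) / 2) <= (w - u) * 1 by move: h; lra.
rewrite ler_pM2l // => h1; split; lra.
Qed.

Let avg_le_leaves n z u w : u < w ->
  (w - u) * `|v u w - z| <= leaf_sum n (fun u' w' => (w' - u') * `|v u' w' - z|) u w.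
Proof.
move: n u w; apply: leaf_sum_subadd => u w uw.
have -> : (u + w) / 2 - u = (w - u) / 2 by lra.
have -> : w - (u + w) / 2 = (w - u) / 2 by lra.
rewrite -mulrDr -mulrA ler_wpM2l ?subr_ge0 ?(ltW uw) //.
have -> : v u w - z =
  2^-1 * ((v u ((u + w) / 2) - z) + (v ((u + w) / 2) w - z)).
  by have := v_avg uw; move: (v _ _) (v _ _) (v _ _) => a b c e; lra.
by rewrite normrM ger0_norm ?invr_ge0 // ler_wpM2l ?invr_ge0 // ler_normD.
Qed.

(** With [la] for the level, the choice makes [2 ^ m / la] equal to one half. The recursion for the
    constant reads [C = la ^ m + (C + (la + 2) ^ m) / 2], and [jn_const m] is its solution. *)
Definition jn_level (m : nat) : R := 2 ^+ m.+1.
Definition jn_const (m : nat) : R :=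
  2 * jn_level m ^+ m + (jn_level m + 2) ^+ m.

Lemma exprD_le (m : nat) (x y : R) : 0 <= x -> 0 <= y ->
  (x + y) ^+ m <= 2 ^+ m * (x ^+ m + y ^+ m).
Proof.
move=> x0 y0.
have h t : 0 <= t -> x <= t -> y <= t -> (x + y) ^+ m <= 2 ^+ m * t ^+ m.
  by move=> t0 xt yt; rewrite -exprMn lerXn2r ?nnegrE ?addr_ge0 ?mulr_ge0 //; lra.
have [xy|/ltW yx] := leP x y.
  by apply: le_trans (h y y0 xy (lexx _)) _; rewrite ler_wpM2l ?exprn_ge0 // lerDr exprn_ge0.
by apply: le_trans (h x x0 (lexx _) yx) _; rewrite ler_wpM2l ?exprn_ge0 // lerDl exprn_ge0.
Qed.

(* Stop at the maximal nodes whose average differs from that of the root by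
   more than [jn_level m]: they cover at most the fraction [(jn_level m)^-1] of the root
   and carry trees of smaller depth. *)
Lemma tree_john_nirenberg (m n : nat) u w : u < w ->
  leaf_sum n (fun u' w' => (w' - u') * `|v u' w' - v u w| ^+ m) u w
    <= jn_const m * (w - u).
Proof.
set la := jn_level m; set C := jn_const m.
have la0 : 0 < la by rewrite exprn_gt0.
have C0 : 0 <= C.
  rewrite /C /jn_const -/la; apply: addr_ge0; last by apply: exprn_ge0; lra.
  by apply: mulr_ge0 => //; apply: exprn_ge0; lra.
elim/ltn_ind: n u w => n IH u0 w0 uw0.
set z := v u0 w0.
(* The cost per unit length of a stopped node: the deviation is split at the average of that node.
   The first part falls under the induction hypothesis, the second is at most [la + 2], since a
   child moves by at most 2 from a parent within [la]. *)
pose B := 2 ^+ m * (C + (la + 2) ^+ m).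
have B0 : 0 <= B.
  rewrite /B mulr_ge0 ?exprn_ge0 // addr_ge0 //; apply: exprn_ge0; lra.
(* A leaf never stopped costs [la ^ m] per unit length. A stopped node costs [B] times its length,
   and this length is at most [la^-1] times the total deviation of its leaves, because its own
   average deviates by more than [la]. *)
have inner : forall k u w, u < w -> (k < n)%N -> `|v u w - z| <= la + 2 ->
    leaf_sum k (fun u' w' => (w' - u') * `|v u' w' - z| ^+ m) u w <=
    la ^+ m * (w - u) +
      B / la * leaf_sum k (fun u' w' => (w' - u') * `|v u' w' - z|) u w.
  have stop k u w : u < w -> (k < n)%N -> `|v u w - z| <= la + 2 -> la < `|v u w - z| ->
    leaf_sum k (fun u' w' => (w' - u') * `|v u' w' - z| ^+ m) u w <=
    la ^+ m * (w - u) +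
      B / la * leaf_sum k (fun u' w' => (w' - u') * `|v u' w' - z|) u w.
    move=> uw kn vz zv.
    have wu : 0 < w - u by rewrite subr_gt0.
    have h1 : leaf_sum k (fun u' w' => (w' - u') * `|v u' w' - z| ^+ m) u w <=
        B * (w - u).
      have g u' w' : u' < w' -> (w' - u') * `|v u' w' - z| ^+ m <=
          2 ^+ m * ((w' - u') * `|v u' w' - v u w| ^+ m + (la + 2) ^+ m * (w' - u')).
        move=> uw'; rewrite [_ * (w' - u')]mulrC -mulrDr mulrCA.
        rewrite ler_wpM2l ?subr_ge0 ?(ltW uw') //.
        have := exprD_le m (normr_ge0 (v u' w' - v u w)) (normr_ge0 (v u w - z)).
        move=> e; apply: le_trans (le_trans _ e) _.
          by rewrite lerXn2r ?nnegrE ?addr_ge0 // -{1}(subrKA (v u w)) ler_normD.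
        rewrite ler_wpM2l ?exprn_ge0 // lerD2l lerXn2r ?nnegrE //.
        by rewrite addr_ge0 // ltW.
      apply: le_trans (leaf_sum_le g k uw) _.
      have lin (q1 q2 : R) (phi : R -> R -> R) j a c :
          leaf_sum j (fun u' w' => q1 * (phi u' w' + q2 * (w' - u'))) a c =
          q1 * (leaf_sum j phi a c + q2 * (c - a)).
        elim: j a c => [//|j ihj] a c /=.
        by rewrite !ihj; move: (leaf_sum _ _ _ _) (leaf_sum _ _ _ _) => x y; field.
      rewrite lin -mulrA ler_wpM2l ?exprn_ge0 // mulrDl lerD2r.
      exact: IH.
    apply: le_trans h1 _; rewrite -[leLHS]add0r lerD //.
      by rewrite mulr_ge0 ?exprn_ge0 // ltW.
    rewrite -mulrA ler_wpM2l // ler_pdivlMl //.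
    apply: le_trans (avg_le_leaves k z uw).
    by rewrite mulrC ler_pM2l // ltW.
  elim=> [|k ihk] u w uw kn vz.
    have [zv|zv] := ltP la `|v u w - z|; first exact: stop.
    have wu : 0 <= w - u by rewrite subr_ge0 ltW.
    rewrite /= -[leLHS]addr0 lerD //.
      by rewrite mulrC ler_wpM2r // lerXn2r ?nnegrE // ltW.
    by rewrite mulr_ge0 ?divr_ge0 ?(ltW la0) // mulr_ge0.
  have [zv|zv] := ltP la `|v u w - z|; first exact: stop.
  have [um mw] := mid_lt uw.
  have [j1 j2] := child_jump uw.
  have kn' : (k < n)%N by rewrite ltnW.
  have c1 : `|v u ((u + w) / 2) - z| <= la + 2.
    rewrite -(subrKA (v u w)) addrC; apply: le_trans (ler_normD _ _) _.
    by rewrite lerD.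
  have c2 : `|v ((u + w) / 2) w - z| <= la + 2.
    rewrite -(subrKA (v u w)) addrC; apply: le_trans (ler_normD _ _) _.
    by rewrite lerD.
  have h := lerD (ihk _ _ um kn' c1) (ihk _ _ mw kn' c2).
  rewrite /=; apply: le_trans h _.
  move: (leaf_sum _ _ _ _) (leaf_sum _ _ _ _) => x y.
  by rewrite le_eqVlt; apply/orP; left; apply/eqP; field; rewrite gt_eqF.
have wu0 : 0 < w0 - u0 by rewrite subr_gt0.
have key : leaf_sum n (fun u' w' => (w' - u') * `|v u' w' - z| ^+ m) u0 w0 <=
   la ^+ m * (w0 - u0) + B / la * (w0 - u0).
  have Bla : 0 <= B / la by rewrite divr_ge0 // ltW.
  case: n IH inner => [|k] IH inner.
    rewrite /= /z subrr normr0 -[leLHS]addr0; apply: lerD; last first.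
      by apply: mulr_ge0 => //; exact: ltW.
    by rewrite mulrC ler_wpM2r ?(ltW wu0) // lerXn2r ?nnegrE // ltW.
  have [um mw] := mid_lt uw0.
  have [j1 j2] := child_jump uw0.
  have la2 : 2 <= la + 2 by rewrite lerDr ltW.
  have h := lerD (inner k _ _ um (ltnSn _) (le_trans j1 la2))
                 (inner k _ _ mw (ltnSn _) (le_trans j2 la2)).
  rewrite /=; apply: le_trans h _.
  rewrite addrACA -!mulrDr [_ - _ + _]addrC subrKA lerD2l ler_wpM2l //.
  exact: (v_osc k.+1 uw0).
apply: le_trans key _; rewrite -mulrDl ler_wpM2r ?(ltW wu0) //.
have -> : B / la = (C + (la + 2) ^+ m) / 2.
  by rewrite /B /la /jn_level exprS; field; rewrite expf_neq0.
by rewrite /C /jn_const -/la; lra.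
Qed.

End TreeJohnNirenberg.

(** * Hoelder and Fatou as bounds on integrals *)

Section Hoelder.
Context d (T : measurableType d) {R : realType} (mu : {measure set T -> \bar R}).
Implicit Types (f g : T -> R) (D : set T).

Lemma measurable_EFin_powR D f (p : R) : measurable_fun setT f ->
  measurable_fun D (EFin \o (fun x => f x `^ p)).
Proof.
move=> mf; apply/measurable_EFinP; apply: (@measurable_funS _ _ _ _ setT) => //.
exact: measurableT_comp (measurable_powR p) mf.
Qed.

Lemma measurable_EFinT D f : measurable_fun setT f -> measurable_fun D (EFin \o f).
Proof. by move=> mf; apply/measurable_EFinP; apply: (@measurable_funS _ _ _ _ setT). Qed.

Lemma hoelder_bound D f g (p q A B : R) : measurable D ->
  measurable_fun setT f -> measurable_fun setT g ->
  (forall x, D x -> 0 <= f x) -> (forall x, D x -> 0 <= g x) ->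
  0 < p -> 0 < q -> p^-1 + q^-1 = 1 -> 0 <= A -> 0 <= B ->
  (\int[mu]_(x in D) (f x `^ p)%:E <= (A `^ p)%:E)%E ->
  (\int[mu]_(x in D) (g x `^ q)%:E <= (B `^ q)%:E)%E ->
  (\int[mu]_(x in D) (f x * g x)%:E <= (A * B)%:E)%E.
Proof.
move=> mD mf mg f0 g0 p0 q0 pq A0 B0 fA gB.
have restr (h : T -> R) : measurable_fun setT h -> measurable_fun setT (h \_ D).
  by move=> mh; apply: (measurable_restrictT h mD).1; exact: measurable_funS mh.
have norm_le h r C : (forall x, D x -> 0 <= h x) -> 0 < r -> 0 <= C ->
    (\int[mu]_(x in D) (h x `^ r)%:E <= (C `^ r)%:E)%E ->
    ('N[mu]_r%:E[EFin \o (h \_ D)] <= C%:E)%E.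
  move=> h0 r0 C0 hC; rewrite unlock.
  have -> : C%:E = ((C `^ r)%:E `^ r^-1)%E.
    by rewrite poweR_EFin -powRrM divff ?gt_eqF // powRr1.
  apply: gt0_ler_poweR.
  - by rewrite invr_ge0 ltW.
  - by rewrite in_itv /= leey andbT integral_ge0 // => x _; rewrite lee_fin powR_ge0.
  - by rewrite in_itv /= leey andbT lee_fin powR_ge0.
  apply: le_trans hC; rewrite [leRHS]integral_mkcond le_eqVlt; apply/orP; left.
  apply/eqP; apply: eq_integral => x _; rewrite /patch /=.
  case: ifPn => xD; first by rewrite ger0_norm //; apply: h0; rewrite inE in xD.
  by rewrite normr0 powR0 // gt_eqF.
have := @hoelder _ _ _ mu _ _ p q (restr _ mf) (restr _ mg) p0 q0 pq.
rewrite Lnorm1 => h.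
apply: (@le_trans _ _ (\int[mu]_x `|(EFin \o ((f \_ D) \* (g \_ D))%R) x|)%E).
  rewrite [leLHS]integral_mkcond le_eqVlt; apply/orP; left.
  apply/eqP; apply: eq_integral => x _; rewrite /patch /=.
  case: ifPn => xD; last by rewrite mul0r normr0.
  by rewrite ger0_norm // mulr_ge0 ?f0 ?g0 //; rewrite inE in xD.
apply: le_trans h _; rewrite EFinM lee_pmul ?Lnorm_ge0 // norm_le //.
Qed.

End Hoelder.

Section FatouBound.
Context d (T : measurableType d) {R : realType} (mu : {measure set T -> \bar R}).

Lemma ae_imply (P Q : T -> Prop) : (forall x, P x -> Q x) ->
  {ae mu, forall x, P x} -> {ae mu, forall x, Q x}.
Proof. by move=> PQ; apply: filterS. Qed.

Lemma ae_imply2 (P P' Q : T -> Prop) : (forall x, P x -> P' x -> Q x) ->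
  {ae mu, forall x, P x} -> {ae mu, forall x, P' x} -> {ae mu, forall x, Q x}.
Proof. by move=> PQ; apply: filterS2. Qed.

Lemma measurable_limn_einf (D : set T) (h : nat -> T -> \bar R) :
  (forall n, measurable_fun D (h n)) ->
  measurable_fun D (fun x => limn_einf (h^~ x)).
Proof.
move=> mh.
have -> : (fun x => limn_einf (h^~ x)) =
          (fun x => - limn_esup (fun n => - h n x))%E.
  apply/funext => x; rewrite -limn_einfN; congr limn_einf.
  by apply/funext => n /=; rewrite oppeK.
apply: measurableT_comp => //; apply: measurable_fun_limn_esup => n.
exact: measurableT_comp.
Qed.

(** Convergence holds almost everywhere only, so [g] is exchanged under the integral for the lower
    limit of [h], to which Fatou's lemma applies. *)
Lemma fatou_bound (D : set T) (h : nat -> T -> \bar R) (g : T -> \bar R) (K : \bar R) :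
  measurable D ->
  (forall n, measurable_fun D (h n)) -> (forall n x, D x -> (0 <= h n x)%E) ->
  measurable_fun D g -> (forall x, D x -> (0 <= g x)%E) ->
  {ae mu, forall x, D x -> (h n x @[n --> \oo] --> g x)%E} ->
  (forall n, (\int[mu]_(x in D) h n x <= K)%E) ->
  (\int[mu]_(x in D) g x <= K)%E.
Proof.
move=> mD mh h0 mg g0 hg hK.
have -> : (\int[mu]_(x in D) g x = \int[mu]_(x in D) limn_einf (h^~ x))%E.
  apply: ae_eq_integral => //; first exact: measurable_limn_einf.
  by apply: filterS hg => x hx Dx; rewrite (cvg_limn_einf_sup (hx Dx)).1.
apply: le_trans (fatou _ mD mh h0) _.
rewrite limn_einf_lim; apply: lime_le.
  exact: is_cvg_einfs.
near=> n; apply: le_trans (hK n).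
apply: ereal_inf_lbound; exists n => //=.
Unshelve. all: by end_near. Qed.

End FatouBound.

(** * The cells of the halving tree as step functions *)

Section Cells.
Context {R : realType}.
Local Notation mu := (@lebesgue_measure R).
Implicit Types (a c u w x : R).

(** Cells are read as half-open intervals, so that those of one depth partition [[a, c[]. Outside
    this interval the value is the first or the last cell. *)
Fixpoint cell (n : nat) a c x : R * R :=
  if n is k.+1
  then if x < (a + c) / 2 then cell k a ((a + c) / 2) x else cell k ((a + c) / 2) c x
  else (a, c).

Lemma cell_in n a c x : a <= x -> x < c -> (cell n a c x).1 <= x < (cell n a c x).2.
Proof.
elim: n a c => [|n ih] a c ax xc /=; first by rewrite ax xc.
by case: ltP => h; apply: ih.
Qed.

Lemma cell_size n a c x : (cell n a c x).2 - (cell n a c x).1 = (c - a) / 2 ^+ n.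
Proof.
elim: n a c => [|n ih] a c /=; first by rewrite expr0 divr1.
by case: ltP => h; rewrite ih exprS; field; rewrite expf_neq0.
Qed.

Lemma cell_lt n a c x : a < c -> (cell n a c x).1 < (cell n a c x).2.
Proof. by move=> ac; rewrite -subr_gt0 cell_size divr_gt0 ?exprn_gt0 // subr_gt0. Qed.

(** Puts the cells of one depth on a lattice, so that the cells of two shifted roots can be compared
    arithmetically. *)
Lemma cell_grid n a c x : exists j : nat,
  (cell n a c x).1 = a + j%:R * ((c - a) / 2 ^+ n).
Proof.
elim: n a c => [|n ih] a c /=; first by exists 0; rewrite mul0r addr0.
case: ltP => h.
  have [j ->] := ih a ((a + c) / 2); exists j.
  by rewrite exprS; field; rewrite expf_neq0.
have [j ->] := ih ((a + c) / 2) c; exists (j + 2 ^ n)%N.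
by rewrite natrD natrX exprS; field; rewrite expf_neq0.
Qed.

Lemma node_sum_ge0 (phi : R -> R -> R) : (forall u w, u < w -> 0 <= phi u w) ->
  forall n a c, a < c -> 0 <= node_sum n phi a c.
Proof.
move=> p0; elim=> [|n ih] a c ac /=; first by rewrite addr0 p0.
by have [am mc] := mid_lt ac; rewrite !addr_ge0 ?p0 ?ih.
Qed.

(** All other nodes contribute nonnegative terms. A pointwise estimate on one suitable interval thus
    becomes an estimate by the whole tree. *)
Lemma node_sum_cell (phi : R -> R -> R) : (forall u w, u < w -> 0 <= phi u w) ->
  forall k n a c x, (k <= n)%N -> a < c ->
  phi (cell k a c x).1 (cell k a c x).2 <= node_sum n phi a c.
Proof.
move=> p0; elim=> [|k ih] n a c x kn ac.
  case: n {kn} => [|n] /=; first by rewrite addr0.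
  by have [am mc] := mid_lt ac; rewrite lerDl addr_ge0 ?node_sum_ge0.
case: n kn => // n kn /=.
have [am mc] := mid_lt ac.
case: ltP => h.
  apply: le_trans (ih n _ _ x kn am) _.
  by rewrite addrCA lerDl addr_ge0 ?p0 ?node_sum_ge0.
apply: le_trans (ih n _ _ x kn mc) _.
by rewrite addrA lerDr addr_ge0 ?p0 ?node_sum_ge0.
Qed.

Lemma itv_co_split u m w : u <= m -> m <= w ->
  `[u, w[%classic = `[u, m[%classic `|` `[m, w[%classic.
Proof. by move=> um mw; rewrite -itv_bndbnd_setU // bnd_simp. Qed.

Lemma itv_co_disj u m w : [disjoint `[u, m[%classic & `[m, w[%classic].
Proof.
apply/disj_setPS => x /=; rewrite !in_itv /= => -[/andP[_ xm] /andP[mx _]].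
by have := lt_le_trans xm mx; rewrite ltxx.
Qed.

Lemma measurable_cell (G : R -> R -> R) n a c :
  measurable_fun setT (fun x => G (cell n a c x).1 (cell n a c x).2).
Proof.
elim: n a c => [|n ih] a c /=; first exact: measurable_cst.
have -> : (fun x => G (if x < (a + c) / 2 then cell n a ((a + c) / 2) x else cell n ((a + c) / 2) c x).1
                     (if x < (a + c) / 2 then cell n a ((a + c) / 2) x else cell n ((a + c) / 2) c x).2) =
  (fun x => if x < (a + c) / 2 then G (cell n a ((a + c) / 2) x).1 (cell n a ((a + c) / 2) x).2
            else G (cell n ((a + c) / 2) c x).1 (cell n ((a + c) / 2) c x).2).
  by apply/funext => x; case: ltP.
by apply: measurable_fun_ifT; [exact: measurable_fun_ltr|exact: ih|exact: ih].
Qed.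

(** The bridge from finite trees to integrals: a step function, constant on the cells of depth [n],
    integrates to a leaf sum. *)
Lemma integral_cell (G : R -> R -> R) n a c : a < c ->
  (forall u w, u < w -> 0 <= G u w) ->
  (\int[mu]_(x in `[a, c[) (G (cell n a c x).1 (cell n a c x).2)%:E =
   (leaf_sum n (fun u w => (w - u) * G u w) a c)%:E)%E.
Proof.
move=> + G0; elim: n a c => [|n ih] a c ac.
  rewrite /= integral_cst //= lebesgue_measure_itv /= lte_fin ac.
  by rewrite -EFinD -EFinM mulrC.
have [am mc] := mid_lt ac.
rewrite (@itv_co_split a ((a + c) / 2) c) ?ltW //.
rewrite ge0_integral_setU //=; last 3 first.
- by apply/measurable_EFinP; apply: measurable_funS (measurable_cell G n.+1 a c).
- by move=> x _; rewrite lee_fin; apply: G0; have := cell_lt n.+1 x ac.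
- exact: itv_co_disj.
rewrite EFinD -!ih //; congr (_ + _)%E; apply: eq_integral => x; rewrite inE /= in_itv /=.
  by move=> /andP[_ ->].
by move=> /andP[mx _]; rewrite ltNge mx.
Qed.

End Cells.

(** * From the tree inequality to functions of bounded mean oscillation *)

Section JohnNirenberg.
Context {R : realType}.
Local Notation mu := (@lebesgue_measure R).
Variable psi : R -> R.
Hypothesis psi_loc : Defs.locally_integrable psi.

Let mpsi : measurable_fun setT psi := psi_loc.1.

Lemma locint_co u w : mu.-integrable `[u, w[ (EFin \o psi).
Proof.
apply: integrableS (psi_loc.2 u w) => //.
by apply: subset_itvl; rewrite bnd_simp.
Qed.

Lemma locint_compact (K : set R) : compact K -> (\int[mu]_(x in K) `|psi x|%:E < +oo)%E.
Proof.
move=> /[dup] cK /compact_bounded[M [Mr bM]].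
have h : K `<=` `[- (M + 1), M + 1]%classic.
  by move=> x Kx /=; rewrite in_itv /= -ler_norml; apply: bM => //; rewrite ltrDl.
have mK : measurable K by apply: closed_measurable; apply: compact_closed.
have [_ +] := integrableP _ _ _ (psi_loc.2 (- (M + 1)) (M + 1)).
apply: le_lt_trans; apply: ge0_subset_integral => //.
by apply/measurable_EFinP; apply: measurableT_comp => //; apply: measurable_funS mpsi.
Qed.

Lemma interval_avgE u w : interval_avg psi u w = (w - u)^-1 * Rintegral mu `[u, w[ psi.
Proof. by rewrite /interval_avg Rintegral_itv_bndo_bndc //; exact: locint_co. Qed.

Lemma Rintegral_co_split (h : R -> R) u m w : u <= m -> m <= w ->
  mu.-integrable `[u, w[ (EFin \o h) ->
  Rintegral mu `[u, w[ h = Rintegral mu `[u, m[ h + Rintegral mu `[m, w[ h.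
Proof.
move=> um mw ih; rewrite (itv_co_split um mw) Rintegral_setU //.
  by rewrite -(itv_co_split um mw).
exact: itv_co_disj.
Qed.

Lemma interval_avg_halves u w : u < w ->
  interval_avg psi u ((u + w) / 2) + interval_avg psi ((u + w) / 2) w =
  2 * interval_avg psi u w.
Proof.
move=> uw; have [um mw] := mid_lt uw.
rewrite !interval_avgE (Rintegral_co_split (ltW um) (ltW mw) (locint_co u w)).
have -> : (u + w) / 2 - u = (w - u) / 2 by lra.
have -> : w - (u + w) / 2 = (w - u) / 2 by lra.
move: (Rintegral _ _ _) (Rintegral _ _ _) => x y; field.
by rewrite subr_eq0 gt_eqF.
Qed.

Lemma integrable_cst_co u w (k : R) : mu.-integrable `[u, w[ (EFin \o (cst k : R -> R)).
Proof.
apply: measurable_bounded_integrable; [exact: measurable_itv| |exact: measurable_cst|].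
  by rewrite /= lebesgue_measure_itv /=; case: ifPn; rewrite ?ltry // -EFinB ltry.
by exists `|k|; split => // x kx y _ /=; exact: ltW.
Qed.

Lemma integrable_osc u w (z : R) : mu.-integrable `[u, w[ (EFin \o (fun x => psi x - z)).
Proof.
have := integrableB _ (locint_co u w) (integrable_cst_co u w z).
exact.
Qed.

Lemma osc_avg_le u w (z : R) : u < w ->
  (w - u) * `|interval_avg psi u w - z| <= Rintegral mu `[u, w[ (fun x => `|psi x - z|).
Proof.
move=> uw; have wu : 0 < w - u by rewrite subr_gt0.
apply: le_trans (le_normr_Rintegral _ (integrable_osc u w z)); last exact: measurable_itv.
rewrite RintegralB //; [|exact: locint_co|exact: integrable_cst_co].
rewrite Rintegral_cst; last exact: measurable_itv.
rewrite /= lebesgue_measure_itv /= lte_fin uw -EFinD /=.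
rewrite -{1}(gtr0_norm wu) -normrM interval_avgE mulrBr mulrA divff ?gt_eqF // mul1r.
by rewrite [_ * z]mulrC.
Qed.

Variable ka : R.
Hypothesis ka0 : 0 < ka.
Hypothesis psi_osc : forall a c, a < c -> mean_osc psi a c <= ka.

Let v u w := interval_avg psi u w / ka.

Let v_avg u w : u < w -> v u ((u + w) / 2) + v ((u + w) / 2) w = 2 * v u w.
Proof. by move=> uw; rewrite /v -mulrDl interval_avg_halves // mulrA. Qed.

(** [Phi] is additive over halves and, by Jensen's inequality for the absolute value, dominates each
    leaf term. At the root it is the length times the mean oscillation over [ka]. *)
Let v_osc n u w : u < w ->
  leaf_sum n (fun u' w' => (w' - u') * `|v u' w' - v u w|) u w <= w - u.
Proof.
move=> uw; set z := interval_avg psi u w.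
pose Phi u' w' := Rintegral mu `[u', w'[ (fun x => `|psi x - z|) / ka.
have iz u' w' : mu.-integrable `[u', w'[ (EFin \o (fun x => `|psi x - z|)).
  exact: integrable_norm (integrable_osc u' w' z).
apply: le_trans (_ : Phi u w <= _).
  apply: le_trans (_ : leaf_sum n Phi u w <= _).
    apply: leaf_sum_le => // u' w' uw'.
    rewrite /v /Phi -mulrBl normrM (@gtr0_norm _ ka^-1) ?invr_gt0 // mulrA.
    by rewrite ler_wpM2r ?invr_ge0 ?(ltW ka0) // osc_avg_le.
  apply: leaf_sum_superadd => // u' w' uw'; have [um mw] := mid_lt uw'.
  by rewrite /Phi -mulrDl -(Rintegral_co_split (ltW um) (ltW mw)).
rewrite /Phi ler_pdivrMr // mulrC.
have wu : 0 < w - u by rewrite subr_gt0.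
rewrite -ler_pdivrMr // mulrC.
apply: le_trans (psi_osc uw); rewrite /mean_osc -/z.
by rewrite -Rintegral_itv_bndo_bndc.
Qed.

Let cell_cvg a c x : a < c -> a <= x < c -> lebesgue_pt psi x ->
  v (cell n a c x).1 (cell n a c x).2 @[n --> \oo] --> psi x / ka.
Proof.
move=> ac /andP[ax xc] lx.
(* Lebesgue differentiation asks for a shrinking family at every point of the line, so balls serve
   outside [[a, c[]. A cell is as long as the radius of the ball around it, hence has half its
   measure: this is the constant 2 below. *)
pose E (y : R) (n : nat) : set R := if a <= y < c
  then `[(cell n a c y).1, (cell n a c y).2[%classic else ball y ((c - a) / 2 ^+ n).
have r0 n : 0 < (c - a) / 2 ^+ n by rewrite divr_gt0 ?exprn_gt0 ?subr_gt0.
have hE y : nicely_shrinking y (E y).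
  split=> [n|]; first by rewrite /E; case: ifP => _ //; exact: measurable_ball.
  exists (2, fun n => PosNum (r0 n)); split => //=.
  - have -> : (fun n => (c - a) / 2 ^+ n) = geometric (c - a) 2^-1.
      by apply/funext => n; rewrite /geometric /= exprVn.
    by apply: cvg_geometric; rewrite gtr0_norm ?invf_lt1 ?ltr1n ?invr_gt0.
  - move=> n z; rewrite /E; case: ifP => // /andP[ay yc] /=; rewrite in_itv /=.
    have /andP[h1 h2] := cell_in n ay yc; have h3 := cell_size n a c y.
    move=> /andP[h4 h5]; rewrite /ball /= -h3 ltr_norml; apply/andP; split; lra.
  - move=> n; rewrite lebesgue_measure_ball ?(ltW (r0 n)) // /E; case: ifP => h.
      rewrite lebesgue_measure_itv /= lte_fin cell_lt // -EFinD -EFinM lee_fin.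
      by rewrite cell_size mulr2n; have := r0 n; lra.
    rewrite lebesgue_measure_ball ?(ltW (r0 n)) // -EFinM lee_fin.
    by have := r0 n; rewrite mulr2n; lra.
have lint : locally_integrable setT psi.
  by split => //; [exact: openT|move=> K _; exact: locint_compact].
have := @nice_lebesgue_differentiation R E hE psi lint x lx.
move=> /fine_cvg h; apply: cvgMl; move: h; apply: cvg_trans.
apply: near_eq_cvg; near=> n => /=.
rewrite /E ax xc /= lebesgue_measure_itv /= lte_fin cell_lt // -EFinD inver.
rewrite subr_eq0 gt_eqF ?cell_lt // interval_avgE.
by rewrite fineM //=; exact: integrable_fin_num (locint_co _ _).
Unshelve. all: by end_near. Qed.

Theorem john_nirenberg (m : nat) a c : a < c ->
  (\int[mu]_(x in `[a, c[) (`|psi x - interval_avg psi a c| ^+ m)%:E <=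
    (jn_const m * ka ^+ m * (c - a))%:E)%E.
Proof.
move=> ac; set z := interval_avg psi a c.
have mm (k : R) : measurable_fun setT (fun x => `|psi x / k - z / k| ^+ m).
  apply: measurable_funX; apply: measurableT_comp => //.
  by apply: measurable_funB => //; apply: measurable_funM.
have key : (\int[mu]_(x in `[a, c[) (`|psi x / ka - z / ka| ^+ m)%:E <=
    (jn_const m * (c - a))%:E)%E.
  apply: (@fatou_bound _ _ _ mu _ (fun n x =>
     (`|v (cell n a c x).1 (cell n a c x).2 - z / ka| ^+ m)%:E)).
  - exact: measurable_itv.
  - move=> n; apply: measurable_EFinT.
    exact: (measurable_cell (fun u w => `|v u w - z / ka| ^+ m)).
  - by move=> n x _; rewrite lee_fin exprn_ge0.
  - exact: measurable_EFinT (mm ka).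
  - by move=> x _; rewrite lee_fin exprn_ge0.
  - have lint : locally_integrable setT psi.
      by split => //; [exact: openT|move=> K _; exact: locint_compact].
    apply: ae_imply (lebesgue_differentiation lint) => x lx /=; rewrite in_itv /= => xac.
    apply: cvg_EFin; first exact: nearW.
    apply: (@continuous_cvg _ _ _ _ _ _ (fun t : R => `|t - z / ka| ^+ m)).
      move=> ?; apply: (@continuous_comp _ _ _ (fun t : R => `|t - z / ka|) (fun t : R => t ^+ m)).
        apply: continuous_comp; last exact: norm_continuous.
        by apply: continuousB => //; exact: cst_continuous.
      exact: exprn_continuous.
    exact: cell_cvg.
  move=> n; rewrite (@integral_cell _ (fun u w => `|v u w - z / ka| ^+ m)) //.
  by rewrite lee_fin; apply: tree_john_nirenberg.
have -> : (\int[mu]_(x in `[a, c[) (`|psi x - z| ^+ m)%:E =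
   (ka ^+ m)%:E * \int[mu]_(x in `[a, c[) (`|psi x / ka - z / ka| ^+ m)%:E)%E.
  rewrite -ge0_integralZl_EFin //; last 2 first.
  - exact: measurable_EFinT (mm ka).
  - by rewrite exprn_ge0 // ltW.
  apply: eq_integral => x _; rewrite -EFinM; congr EFin.
  rewrite -exprMn -{1}(gtr0_norm ka0) -normrM; congr (`| _ | ^+ _).
  by field; rewrite gt_eqF.
have kam : 0 <= ka ^+ m by rewrite exprn_ge0 // ltW.
apply: le_trans (lee_wpmul2l _ key) _; first by rewrite lee_fin.
by rewrite -EFinM lee_fin mulrCA mulrA.
Qed.

End JohnNirenberg.

(** * Dyadic operators *)

Section RintegralBounds.
Context {R : realType}.
Local Notation mu := (@lebesgue_measure R).
Implicit Types (f g h : R -> R) (D : set R) (u w x : R).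

Lemma ge0_integrable_bound D h (c : R) : measurable D -> measurable_fun setT h ->
  (forall x, D x -> 0 <= h x) -> (\int[mu]_(x in D) (h x)%:E <= c%:E)%E ->
  mu.-integrable D (EFin \o h).
Proof.
move=> mD mh h0 hc; apply/integrableP; split; first exact: measurable_EFinT.
apply: le_lt_trans (ltry c); apply: le_trans hc.
rewrite le_eqVlt; apply/orP; left; apply/eqP; apply: eq_integral => x xD /=.
by rewrite ger0_norm //; apply: h0; rewrite inE in xD.
Qed.

Lemma integrable_RintegralE D h : measurable D -> mu.-integrable D (EFin \o h) ->
  (\int[mu]_(x in D) (h x)%:E = (Rintegral mu D h)%:E)%E.
Proof. by move=> mD ih; rewrite /Rintegral fineK //; exact: integrable_fin_num. Qed.

Lemma ge0_Rintegral_bound D h (c : R) : measurable D -> measurable_fun setT h ->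
  (forall x, D x -> 0 <= h x) -> (\int[mu]_(x in D) (h x)%:E <= c%:E)%E ->
  Rintegral mu D h <= c.
Proof.
move=> mD mh h0 hc; have ih := ge0_integrable_bound mD mh h0 hc.
by rewrite integrable_RintegralE // lee_fin in hc.
Qed.

Lemma integral_if_co u w h :
  (\int[mu]_x (if u <= x < w then h x else 0)%:E = \int[mu]_(x in `[u, w[) (h x)%:E)%E.
Proof.
rewrite [RHS]integral_mkcond; apply: eq_integral => x _; rewrite /patch.
by rewrite mem_setE in_itv /=; case: ifP.
Qed.

Lemma measurable_if_co u w h : measurable_fun setT h ->
  measurable_fun setT (fun x => if u <= x < w then h x else 0).
Proof.
move=> mh; apply: measurable_fun_ifT => //.
by apply: measurable_and; [exact: measurable_fun_ler|exact: measurable_fun_ltr].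
Qed.

(** Hoelder for [f ^ s] against the constant 1, with exponents [p / s] and its conjugate. The bound
    [X] is left free: it is used both for the total mass 1 and for the mass of the interval. *)
Lemma power_mean (p s X : R) f u w : u < w -> 0 < s -> s < p ->
  measurable_fun setT f -> (forall x, 0 <= f x) -> 0 <= X ->
  (\int[mu]_(x in `[u, w[) (f x `^ p)%:E <= X%:E)%E ->
  (\int[mu]_(x in `[u, w[) (f x `^ s)%:E <=
    ((w - u) `^ (1 - s / p) * X `^ (s / p))%:E)%E.
Proof.
move=> uw s0 sp mf f0 X0 hX.
have p0 : 0 < p by lra.
have wu : 0 < w - u by rewrite subr_gt0.
have ps0 : 0 < p / s by rewrite divr_gt0.
have sp0 : 0 < 1 - s / p by rewrite subr_gt0 ltr_pdivrMr // mul1r.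
have -> : (\int[mu]_(x in `[u, w[) (f x `^ s)%:E =
  \int[mu]_(x in `[u, w[) (f x `^ s * cst 1 x)%:E)%E.
  by apply: eq_integral => x _; rewrite mulr1.
rewrite [X in (_ <= X%:E)%E]mulrC.
apply: (@hoelder_bound _ _ _ mu _ _ _ (p / s) (1 - s / p)^-1) => //.
- exact: measurableT_comp (measurable_powR s) mf.
- by move=> x _; rewrite powR_ge0.
- by rewrite invr_gt0.
- by rewrite invrK invf_div addrC subrK.
- exact: powR_ge0.
- exact: powR_ge0.
- have -> : (X `^ (s / p)) `^ (p / s) = X.
    by rewrite -powRrM -[RHS]powRr1 //; congr (_ `^ _); field; rewrite !gt_eqF.
  apply: le_trans hX; rewrite le_eqVlt; apply/orP; left; apply/eqP.
  apply: eq_integral => x _; congr EFin; rewrite -powRrM; congr (_ `^ _).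
  by field; rewrite gt_eqF.
- have -> : ((w - u) `^ (1 - s / p)) `^ (1 - s / p)^-1 = w - u.
    by rewrite -powRrM divff ?gt_eqF // powRr1 // ltW.
  rewrite /= powR1 integral_cst; last exact: measurable_itv.
  by rewrite /= lebesgue_measure_itv /= lte_fin uw -EFinD mul1e.
Qed.

End RintegralBounds.

(** * Averages of order [s] on an interval *)

Section NodeBounds.
Context {R : realType}.
Local Notation mu := (@lebesgue_measure R).
Variables (p s : R) (f : R -> R).
Implicit Types (u w x : R).
Hypotheses (s0 : 0 < s) (sp : s < p).
Hypotheses (mf : measurable_fun setT f) (f0 : forall x, 0 <= f x).
Hypothesis fp : (\int[mu]_x (f x `^ p)%:E <= 1)%E.

Let p0 : 0 < p. Proof. exact: lt_trans s0 sp. Qed.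

(** The root of order [s] is not taken here: without it the value on an interval is the mean of the
    values on its halves, as Doob's inequality requires. The average of order [s] is
    [power_avg u w ^ s^-1]. *)
Definition power_avg u w := (w - u)^-1 * Rintegral mu `[u, w[ (fun x => f x `^ s).
Definition power_int u w := Rintegral mu `[u, w[ (fun x => f x `^ p).

Let mfr (r : R) : measurable_fun setT (fun x => f x `^ r).
Proof. exact: measurableT_comp (measurable_powR r) mf. Qed.

Let fp_co u w : (\int[mu]_(x in `[u, w[) (f x `^ p)%:E <= 1%:E)%E.
Proof.
apply: le_trans fp; apply: ge0_subset_integral => //.
  exact: measurable_EFinT (mfr p).
by move=> x _; rewrite lee_fin powR_ge0.
Qed.

Let integrable_fp u w : mu.-integrable `[u, w[ (EFin \o (fun x => f x `^ p)).
Proof. by apply: ge0_integrable_bound (fp_co u w) => // x _; exact: powR_ge0. Qed.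

Lemma power_int_ge0 u w : 0 <= power_int u w.
Proof. by apply: Rintegral_ge0 => x _; exact: powR_ge0. Qed.

Lemma power_int_le1 u w : power_int u w <= 1.
Proof. by apply: ge0_Rintegral_bound (fp_co u w) => // x _; exact: powR_ge0. Qed.

Lemma power_int_split u w : u < w ->
  power_int u ((u + w) / 2) + power_int ((u + w) / 2) w <= power_int u w.
Proof.
move=> uw; have [um mw] := mid_lt uw.
by rewrite /power_int -(Rintegral_co_split (ltW um) (ltW mw)).
Qed.

Let power_bound u w (X : R) : u < w -> 0 <= X ->
  (\int[mu]_(x in `[u, w[) (f x `^ p)%:E <= X%:E)%E ->
  (\int[mu]_(x in `[u, w[) (f x `^ s)%:E <=
    ((w - u) `^ (1 - s / p) * X `^ (s / p))%:E)%E.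
Proof. by move=> uw X0; apply: power_mean. Qed.

Lemma integrable_fs u w : u < w -> mu.-integrable `[u, w[ (EFin \o (fun x => f x `^ s)).
Proof.
move=> uw; apply: ge0_integrable_bound (power_bound uw ler01 (fp_co u w)) => //.
by move=> x _; exact: powR_ge0.
Qed.

Lemma power_avg_ge0 u w : u < w -> 0 <= power_avg u w.
Proof.
move=> uw; rewrite mulr_ge0 ?invr_ge0 ?subr_ge0 ?(ltW uw) //.
by apply: Rintegral_ge0 => x _; exact: powR_ge0.
Qed.

Lemma power_avg_halves u w : u < w ->
  power_avg u ((u + w) / 2) + power_avg ((u + w) / 2) w = 2 * power_avg u w.
Proof.
move=> uw; have [um mw] := mid_lt uw; rewrite /power_avg.
rewrite (Rintegral_co_split (ltW um) (ltW mw) (integrable_fs uw)).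
have -> : (u + w) / 2 - u = (w - u) / 2 by lra.
have -> : w - (u + w) / 2 = (w - u) / 2 by lra.
move: (Rintegral _ _ _) (Rintegral _ _ _) => x y; field.
by rewrite subr_eq0 gt_eqF.
Qed.

Let power_avg_bound u w (X : R) : u < w -> 0 <= X ->
  (\int[mu]_(x in `[u, w[) (f x `^ p)%:E <= X%:E)%E ->
  power_avg u w <= (w - u) `^ (- (s / p)) * X `^ (s / p).
Proof.
move=> uw X0 hX; have wu : 0 < w - u by rewrite subr_gt0.
have := ge0_Rintegral_bound _ (mfr s) (fun x _ => powR_ge0 _ _) (power_bound uw X0 hX).
move=> /(_ (measurable_itv _)) h; rewrite /power_avg ler_pdivrMl // mulrA.
rewrite (_ : (w - u) * (w - u) `^ (- (s / p)) = (w - u) `^ (1 - s / p)) //.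
by rewrite powRD ?powRr1 ?(ltW wu) //; apply/implyP => _; rewrite gt_eqF.
Qed.

(** The power mean inequality with total mass 1; this is the decay in [rho] built into
    [scale_sum]. *)
Lemma power_avg_small u w : u < w -> power_avg u w `^ s^-1 <= (w - u) `^ (- p^-1).
Proof.
move=> uw; have wu : 0 < w - u by rewrite subr_gt0.
have := power_avg_bound uw ler01 (fp_co u w); rewrite powR1 mulr1 => h.
have -> : (w - u) `^ (- p^-1) = ((w - u) `^ (- (s / p))) `^ s^-1.
  by rewrite -powRrM; congr (_ `^ _); field; rewrite !gt_eqF.
by rewrite ge0_ler_powR ?nnegrE ?powR_ge0 ?power_avg_ge0 // invr_ge0 ltW.
Qed.

(** The power mean inequality with the mass of the interval itself. It makes [power_int] the
    superadditive majorant asked for by [leaf_max_le]. *)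
Lemma power_avg_jensen u w : u < w -> (w - u) * power_avg u w `^ (p / s) <= power_int u w.
Proof.
move=> uw; have wu : 0 < w - u by rewrite subr_gt0.
have hX : (\int[mu]_(x in `[u, w[) (f x `^ p)%:E <= (power_int u w)%:E)%E.
  by rewrite integrable_RintegralE.
have h := power_avg_bound uw (power_int_ge0 u w) hX.
have ps0 : 0 <= p / s by rewrite divr_ge0 ?ltW.
rewrite mulrC -ler_pdivlMr //.
apply: le_trans (ge0_ler_powR ps0 _ _ h) _; rewrite ?nnegrE ?power_avg_ge0 //.
  by rewrite mulr_ge0 ?powR_ge0.
rewrite powRM ?powR_ge0 // -!powRrM.
have -> : s / p * (p / s) = 1 by field; rewrite !gt_eqF.
have -> : - (s / p) * (p / s) = -1 by field; rewrite !gt_eqF.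
by rewrite powRr1 ?power_int_ge0 // powR_inv1 ?(ltW wu) // mulrC.
Qed.

(** Hoelder with the conjugate pair [m], [s]. It serves for [be] the oscillation of the symbol, with
    [K] from John-Nirenberg, and for [be = 1] with [K = 1]. *)
Lemma hoelder_node (m : nat) (K : R) (be : R -> R) u w : u < w ->
  measurable_fun setT be -> (forall x, 0 <= be x) -> 0 <= K ->
  (0 < m)%N -> m%:R^-1 + s^-1 = 1 ->
  (\int[mu]_(x in `[u, w[) (be x ^+ m)%:E <= (K ^+ m * (w - u))%:E)%E ->
  (\int[mu]_(x in `[u, w[) (be x * f x)%:E <=
    (K * ((w - u) * power_avg u w `^ s^-1))%:E)%E.
Proof.
move=> uw mbe be0 K0 m0 ms hbe; have wu : 0 < w - u by rewrite subr_gt0.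
have mr0 : 0 < m%:R :> R by rewrite ltr0n.
have e : K * ((w - u) * power_avg u w `^ s^-1) =
   (K * (w - u) `^ m%:R^-1) * ((w - u) * power_avg u w) `^ s^-1.
  rewrite powRM ?power_avg_ge0 ?(ltW wu) // !mulrA; congr (_ * _).
  rewrite -!mulrA; congr (_ * _).
  by rewrite -powRD ?ms ?powRr1 ?(ltW wu) //; apply/implyP => _; rewrite gt_eqF.
rewrite e; apply: (@hoelder_bound _ _ _ mu _ be f m%:R s) => //.
- by rewrite mulr_ge0 // powR_ge0.
- exact: powR_ge0.
- rewrite powRM ?powR_ge0 // -powRrM mulVf ?gt_eqF // powRr1 ?(ltW wu) //.
  rewrite powR_mulrn //; apply: le_trans hbe; rewrite le_eqVlt; apply/orP; left.
  by apply/eqP; apply: eq_integral => x _; rewrite powR_mulrn.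
- rewrite -powRrM mulVf ?gt_eqF // powRr1; last first.
    by apply: mulr_ge0; [exact: ltW|exact: power_avg_ge0].
  rewrite /power_avg mulrA divff ?gt_eqF // mul1r.
  by rewrite integrable_RintegralE //; exact: integrable_fs.
Qed.

End NodeBounds.

Section NodeSumFun.
Context {R : realType}.
Local Notation mu := (@lebesgue_measure R).
Variables (H : R -> R -> R -> R).
Implicit Types (u w x a c : R).
Hypothesis mH : forall u w, measurable_fun setT (H u w).
Hypothesis H0 : forall u w x, u < w -> 0 <= H u w x.

Lemma measurable_node_sum n a c :
  measurable_fun setT (fun x => node_sum n (fun u w => H u w x) a c).
Proof.
elim: n a c => [|n ih] a c /=; apply: measurable_funD => //.
exact: measurable_funD.
Qed.

Lemma integral_node_sum_le (h : R -> R -> R) n a c : a < c ->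
  (forall u w, u < w -> (\int[mu]_x (H u w x)%:E <= (h u w)%:E)%E) ->
  (\int[mu]_x (node_sum n (fun u w => H u w x) a c)%:E <= (node_sum n h a c)%:E)%E.
Proof.
move=> + Hh; elim: n a c => [|n ih] a c ac /=.
  by rewrite addr0; under eq_integral do rewrite addr0; exact: Hh.
have [am mc] := mid_lt ac.
under eq_integral do rewrite !EFinD.
have N0 j u w x : u < w -> 0 <= node_sum j (fun u w => H u w x) u w.
  by move=> uw; apply: node_sum_ge0 => // u' w' uw'; exact: H0.
rewrite ge0_integralD //=; last 4 first.
- by move=> x _; rewrite lee_fin H0.
- exact: measurable_EFinT (mH a c).
- by move=> x _; rewrite -EFinD lee_fin addr_ge0 ?N0.
- apply: (@measurable_EFinT _ _ _ _ (fun x => node_sum n (fun u w => H u w x) a ((a + c) / 2)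
     + node_sum n (fun u w => H u w x) ((a + c) / 2) c)).
  by apply: measurable_funD; exact: measurable_node_sum.
rewrite ge0_integralD //=; last 4 first.
- by move=> x _; rewrite lee_fin N0.
- exact: measurable_EFinT (measurable_node_sum _ _ _).
- by move=> x _; rewrite lee_fin N0.
- exact: measurable_EFinT (measurable_node_sum _ _ _).
by rewrite !EFinD leeD ?Hh // leeD ?ih.
Qed.

Lemma powR_addr_le (r x y : R) : 0 <= r -> 0 <= x -> 0 <= y ->
  (x + y) `^ r <= 2 `^ r * (x `^ r + y `^ r).
Proof.
move=> r0 x0 y0.
have h t : 0 <= t -> x <= t -> y <= t -> (x + y) `^ r <= 2 `^ r * t `^ r.
  move=> t0 xt yt; rewrite -powRM // ge0_ler_powR ?nnegrE ?addr_ge0 ?mulr_ge0 //.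
  lra.
have [xy|/ltW yx] := leP x y.
  by apply: le_trans (h y y0 xy (lexx _)) _; rewrite ler_wpM2l ?powR_ge0 // lerDr powR_ge0.
by apply: le_trans (h x x0 (lexx _) yx) _; rewrite ler_wpM2l ?powR_ge0 // lerDl powR_ge0.
Qed.

Lemma integral_powR_add (r : R) (f g : R -> R) : 0 <= r ->
  measurable_fun setT f -> measurable_fun setT g ->
  (forall x, 0 <= f x) -> (forall x, 0 <= g x) ->
  (\int[mu]_x ((f x + g x) `^ r)%:E <=
    (2 `^ r)%:E * (\int[mu]_x (f x `^ r)%:E + \int[mu]_x (g x `^ r)%:E))%E.
Proof.
move=> r0 mf mg f0 g0.
rewrite -ge0_integralD //=; last 4 first.
- by move=> x _; rewrite lee_fin powR_ge0.
- exact: measurable_EFin_powR.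
- by move=> x _; rewrite lee_fin powR_ge0.
- exact: measurable_EFin_powR.
rewrite -ge0_integralZl_EFin ?powR_ge0 //=; last 2 first.
- by move=> x _; rewrite -EFinD lee_fin addr_ge0 ?powR_ge0.
- apply: (@measurable_EFinT _ _ _ _ (fun x => f x `^ r + g x `^ r)).
  by apply: measurable_funD; apply: measurableT_comp (measurable_powR r) _.
apply: ge0_le_integral => //=.
- by move=> x _; rewrite lee_fin powR_ge0.
- by apply: (@measurable_EFin_powR _ _ _ setT (fun x => f x + g x)); exact: measurable_funD.
- apply: (@measurable_EFinT _ _ _ _ (fun x => 2 `^ r * (f x `^ r + g x `^ r))).
  apply: measurable_funM => //.
  by apply: measurable_funD; apply: measurableT_comp (measurable_powR r) _.
- by move=> x _; rewrite -EFinD -EFinM lee_fin powR_addr_le.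
Qed.

(** Qualitative only: each node of the tree costs a power of 2 through [powR_addr_le]. Finiteness is
    all that the duality argument asks for in advance. *)
Lemma node_sum_powR_lty (r : R) n a c : 0 <= r -> a < c ->
  (forall u w, u < w -> (\int[mu]_x (H u w x `^ r)%:E < +oo)%E) ->
  (\int[mu]_x (node_sum n (fun u w => H u w x) a c `^ r)%:E < +oo)%E.
Proof.
move=> r0 + Hr; elim: n a c => [|n ih] a c ac /=.
  by under eq_integral do rewrite addr0; exact: Hr.
have [am mc] := mid_lt ac.
have N0 j u w x : u < w -> 0 <= node_sum j (fun u w => H u w x) u w.
  by move=> uw; apply: node_sum_ge0 => // u' w' uw'; exact: H0.
apply: le_lt_trans (integral_powR_add _ _ _ _ _) _ => //.
- by apply: measurable_funD; exact: measurable_node_sum.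
- by move=> x; exact: H0.
- by move=> x; rewrite addr_ge0 ?N0.
rewrite lte_mul_pinfty ?lee_fin ?powR_ge0 // lte_add_pinfty ?Hr //.
apply: le_lt_trans (integral_powR_add _ _ _ _ _) _ => //.
- exact: measurable_node_sum.
- exact: measurable_node_sum.
- by move=> x; rewrite N0.
- by move=> x; rewrite N0.
by rewrite lte_mul_pinfty ?lee_fin ?powR_ge0 // lte_add_pinfty ?ih.
Qed.

End NodeSumFun.

(** * The bound from [L^p] to [L^q] on a finite tree *)

Section DyadicOperator.
Context {R : realType}.
Local Notation mu := (@lebesgue_measure R).
Implicit Types (u w x a c : R) (f g : R -> R).
Variables (p q al : R) (m : nat).
Hypotheses (p1 : 1 < p) (pq : p < q) (al0 : 0 < al) (qE : q^-1 = p^-1 - al).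
Hypotheses (mp : p / (p - 1) < m%:R) (mq : q < m%:R).

(** The conjugate exponent of [m]. Passing to conjugates, [mp] becomes [s < p] and [mq] becomes
    [s < q']. *)
Let s := m%:R / (m%:R - 1) : R.
Let q' := q / (q - 1).

Let p0 : 0 < p. Proof. exact: lt_trans ltr01 p1. Qed.
Let q1 : 1 < q. Proof. exact: lt_trans p1 pq. Qed.
Let q0 : 0 < q. Proof. exact: lt_trans ltr01 q1. Qed.
Let m1 : 1 < m%:R :> R. Proof. exact: lt_trans q1 mq. Qed.
Let m0 : 0 < m%:R :> R. Proof. exact: lt_trans q0 mq. Qed.
Let s0 : 0 < s. Proof. by rewrite divr_gt0 // subr_gt0. Qed.
Let q'0 : 0 < q'. Proof. by rewrite divr_gt0 // subr_gt0. Qed.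
Let sE : m%:R^-1 + s^-1 = 1.
Proof. by rewrite /s; field; rewrite !gt_eqF // subr_gt0. Qed.
Let q'E : q'^-1 + q^-1 = 1.
Proof. by rewrite /q'; field; rewrite !gt_eqF // subr_gt0. Qed.

Let sp : s < p.
Proof.
rewrite /s ltr_pdivrMr ?subr_gt0 //.
have : p < m%:R * (p - 1) by rewrite -ltr_pdivrMr // subr_gt0.
rewrite !mulrBr !mulr1 [p * _]mulrC; lra.
Qed.

Let sq' : s < q'.
Proof.
rewrite -[s]invrK -[q']invrK ltf_pV2 ?posrE ?invr_gt0 //.
have -> : s^-1 = 1 - m%:R^-1 by apply: (addrI m%:R^-1); rewrite sE addrCA subrr addr0.
have -> : q'^-1 = 1 - q^-1 by rewrite -q'E addrK.
by rewrite ltrD2l ltrN2 ltf_pV2.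
Qed.

Definition bilinear_const : R :=
  scale_const al q^-1 *
  ((p / s / (p / s - 1)) `^ (p / s) + (q' / s / (q' / s - 1)) `^ (q' / s)).

Lemma bilinear_const_ge0 : 0 <= bilinear_const.
Proof.
apply: mulr_ge0; last by apply: addr_ge0; exact: powR_ge0.
by apply: scale_const_ge0; rewrite ?invr_gt0.
Qed.

Lemma bilinear_node_sum f g n a c : a < c ->
  measurable_fun setT f -> (forall x, 0 <= f x) ->
  measurable_fun setT g -> (forall x, 0 <= g x) ->
  (\int[mu]_x (f x `^ p)%:E <= 1)%E -> (\int[mu]_x (g x `^ q')%:E <= 1)%E ->
  node_sum n (fun u w => (w - u) `^ (al + 1) *
    (power_avg s f u w `^ s^-1 * power_avg s g u w `^ s^-1)) a c <= bilinear_const.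
Proof.
move=> ac mf f0 mg g0 fp gq.
have q'i : 0 < q^-1 by rewrite invr_gt0.
have pE : p^-1 = q^-1 + al by rewrite qE subrK.
(* The root has no ancestors: depth, running maxima and accumulated sum all start at 0. *)
have h := @node_sum_leaf_max R al p^-1 q^-1 al0 q'i pE p q' s
  (power_avg s f) (power_avg s g) p0 q'0 s0 erefl q'E
  (power_avg_ge0 s f) (power_avg_ge0 s g)
  (power_avg_small s0 sp mf f0 fp) n a c 0 0 0 0 ac (lexx _) (lexx _).
rewrite mul0r addr0 mulr0 in h.
apply: le_trans (h (lexx _)) _; rewrite ler_wpM2l ?scale_const_ge0 //.
have bound r v F : 1 < r -> (forall u w, u < w -> 0 <= v u w) ->
    (forall u w, u < w -> v u ((u + w) / 2) + v ((u + w) / 2) w = 2 * v u w) ->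
    (forall u w, u < w -> (w - u) * v u w `^ r <= F u w) ->
    (forall u w, u < w -> F u ((u + w) / 2) + F ((u + w) / 2) w <= F u w) ->
    F a c <= 1 ->
    leaf_max (fun t : R => t `^ r) n v a c 0 <= (r / (r - 1)) `^ r.
  move=> r1 v0 v2 vF Fadd F1; apply: le_trans (leaf_max_le n r1 ac v0 v2 vF Fadd) _.
  by rewrite ler_piMr ?powR_ge0.
apply: lerD.
  apply: (bound _ _ (power_int p f)).
  - by rewrite ltr_pdivlMr // mul1r.
  - exact: power_avg_ge0.
  - exact: (power_avg_halves s0 sp mf f0 fp).
  - exact: (power_avg_jensen s0 sp mf f0 fp).
  - exact: (power_int_split mf fp).
  - exact: (power_int_le1 mf fp).
apply: (bound _ _ (power_int q' g)).
- by rewrite ltr_pdivlMr // mul1r.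
- exact: power_avg_ge0.
- exact: (power_avg_halves s0 sq' mg g0 gq).
- exact: (power_avg_jensen s0 sq' mg g0 gq).
- exact: (power_int_split mg gq).
- exact: (power_int_le1 mg gq).
Qed.

Variables (be : R -> R -> R -> R) (K : R).
Hypotheses (K0 : 0 <= K).
Hypothesis mbe : forall u w, measurable_fun setT (be u w).
Hypothesis be0 : forall u w x, 0 <= be u w x.
Hypothesis hbe : forall u w, u < w ->
  (\int[mu]_(x in `[u, w[) (be u w x ^+ m)%:E <= (K ^+ m * (w - u))%:E)%E.

Variable f : R -> R.
Hypothesis mf : measurable_fun setT f.
Hypothesis f0 : forall x, 0 <= f x.
Hypothesis fp : (\int[mu]_x (f x `^ p)%:E <= 1)%E.

(** For [be u w x = |b x - b_Q|] with [Q = [u, w[], this is the integral over [y] in [Q] of [|Q| ^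
    (al - 1) * (|b x - b_Q| + |b y - b_Q|) * f y]. With [be = 1] the same term serves the fractional
    integral. *)
Definition node_term u w x : R :=
  (w - u) `^ (al - 1) *
  (be u w x * Rintegral mu `[u, w[ f + Rintegral mu `[u, w[ (fun y => be u w y * f y)).

Definition dyadic_op (n : nat) a c x : R :=
  node_sum n (fun u w => if u <= x < w then node_term u w x else 0) a c.

Let Rint_ge0 u w g : (forall x, 0 <= g x) -> 0 <= Rintegral mu `[u, w[ g.
Proof. by move=> g0; apply: Rintegral_ge0. Qed.

Lemma node_term_ge0 u w x : 0 <= node_term u w x.
Proof.
rewrite mulr_ge0 ?powR_ge0 // addr_ge0 ?Rint_ge0 //.
  by rewrite mulr_ge0 ?Rint_ge0.
by move=> y; rewrite mulr_ge0.
Qed.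

Lemma measurable_node_term u w : measurable_fun setT (node_term u w).
Proof.
apply: measurable_funM => //; apply: measurable_funD => //.
exact: measurable_funM.
Qed.

Lemma dyadic_op_ge0 n a c x : a < c -> 0 <= dyadic_op n a c x.
Proof.
by move=> ac; apply: node_sum_ge0 => // u w _; case: ifP => // _; exact: node_term_ge0.
Qed.

Lemma measurable_dyadic_op n a c : measurable_fun setT (dyadic_op n a c).
Proof.
apply: (@measurable_node_sum _ (fun u w x => if u <= x < w then node_term u w x else 0)).
by move=> u w; apply: measurable_if_co; exact: measurable_node_term.
Qed.

Let avg_bound r g u w : s < r -> measurable_fun setT g -> (forall x, 0 <= g x) ->
  (\int[mu]_x (g x `^ r)%:E <= 1)%E -> u < w ->
  (\int[mu]_(x in `[u, w[) (g x)%:E <= ((w - u) * power_avg s g u w `^ s^-1)%:E)%E.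
Proof.
move=> sr mg g0 gr uw.
have m00 : (0 < m)%N by rewrite -(ltr0n R).
have -> : (\int[mu]_(x in `[u, w[) (g x)%:E = \int[mu]_(x in `[u, w[) (cst 1 x * g x)%:E)%E.
  by apply: eq_integral => x _; rewrite /= mul1r.
rewrite -[X in (_ <= X%:E)%E]mul1r.
apply: (@hoelder_node R r s g s0 sr mg g0 gr m 1 (cst 1) u w uw) => //.
under eq_integral do rewrite /= expr1n.
rewrite expr1n mul1r integral_cst; last exact: measurable_itv.
by rewrite /= lebesgue_measure_itv /= lte_fin uw -EFinD mul1e.
Qed.

Let be_bound r g u w : s < r -> measurable_fun setT g -> (forall x, 0 <= g x) ->
  (\int[mu]_x (g x `^ r)%:E <= 1)%E -> u < w ->
  (\int[mu]_(x in `[u, w[) (be u w x * g x)%:E <=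
    (K * ((w - u) * power_avg s g u w `^ s^-1))%:E)%E.
Proof.
move=> sr mg g0 gr uw.
have m00 : (0 < m)%N by rewrite -(ltr0n R).
exact: (@hoelder_node R r s g s0 sr mg g0 gr m K (be u w) u w uw
  (mbe u w) (be0 u w) K0 m00 sE (hbe uw)).
Qed.

Lemma integrable_node u w : u < w -> mu.-integrable `[u, w[ (EFin \o f).
Proof. by move=> uw; apply: ge0_integrable_bound (avg_bound sp mf f0 fp uw). Qed.

Lemma integrable_node_osc u w : u < w ->
  mu.-integrable `[u, w[ (EFin \o (fun y => be u w y * f y)).
Proof.
move=> uw; apply: ge0_integrable_bound (be_bound sp mf f0 fp uw) => //.
  exact: measurable_funM.
by move=> x _; rewrite mulr_ge0.
Qed.

(** Paired with [g], a node yields two products of integrals over it: in one the factor [be] goes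
    with [g], in the other with [f]. Each is at most [K * |Q| ^ 2] times the two averages of order
    [s], whence [2 * K] and the exponent [al + 1]. *)
Lemma dyadic_op_dual g n a c : a < c ->
  measurable_fun setT g -> (forall x, 0 <= g x) ->
  (\int[mu]_x (g x `^ q')%:E <= 1)%E ->
  (\int[mu]_x (dyadic_op n a c x * g x)%:E <= (2 * K * bilinear_const)%:E)%E.
Proof.
move=> ac mg g0 gq.
pose H u w x := if u <= x < w then node_term u w x * g x else 0.
pose h u w := 2 * K * ((w - u) `^ (al + 1) *
    (power_avg s f u w `^ s^-1 * power_avg s g u w `^ s^-1)).
have DE x : dyadic_op n a c x * g x = node_sum n (fun u w => H u w x) a c.
  rewrite /dyadic_op; elim: n a c {ac} => [|n ih] a c /=; rewrite /H.
    by rewrite !addr0; case: ifP => _; rewrite ?mul0r.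
  by rewrite !mulrDl !ih; case: ifP => _; rewrite ?mul0r.
under eq_integral do rewrite DE.
apply: (@le_trans _ _ (node_sum n h a c)%:E); last first.
  rewrite lee_fin node_sumZ ler_wpM2l ?mulr_ge0 //.
  exact: bilinear_node_sum.
apply: integral_node_sum_le => //.
- move=> u w; apply: measurable_if_co; apply: measurable_funM => //.
  exact: measurable_node_term.
- by move=> u w x _; rewrite /H; case: ifP => // _; rewrite mulr_ge0 ?node_term_ge0.
move=> u w uw; rewrite /H integral_if_co.
have wu : 0 < w - u by rewrite subr_gt0.
have mbf : measurable_fun setT (fun x => be u w x * f x) by exact: measurable_funM.
have mbg : measurable_fun setT (fun x => be u w x * g x) by exact: measurable_funM.
set A := Rintegral mu `[u, w[ f.
set B := Rintegral mu `[u, w[ (fun y => be u w y * f y).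
set al1 := (w - u) `^ (al - 1).
set F := power_avg s f u w `^ s^-1; set G := power_avg s g u w `^ s^-1.
have A0 : 0 <= A by exact: Rint_ge0.
have B0 : 0 <= B by apply: Rint_ge0 => y; rewrite mulr_ge0.
have hA : A <= (w - u) * F.
  by apply: ge0_Rintegral_bound (avg_bound sp mf f0 fp uw) => //.
have hB : B <= K * ((w - u) * F).
  apply: ge0_Rintegral_bound (be_bound sp mf f0 fp uw) => // x _.
  by rewrite mulr_ge0.
have e x : (node_term u w x * g x)%:E =
    ((al1 * A)%:E * (be u w x * g x)%:E + (al1 * B)%:E * (g x)%:E)%E.
  by rewrite /node_term -/A -/B -/al1 -!EFinM -EFinD; congr EFin; ring.
under eq_integral do rewrite e.
have al10 : 0 <= al1 by exact: powR_ge0.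
rewrite ge0_integralD //=; last 4 first.
- by move=> x _; rewrite -EFinM lee_fin !mulr_ge0.
- apply: (@measurable_EFinT _ _ _ _ (fun x => al1 * A * (be u w x * g x))).
  exact: measurable_funM.
- by move=> x _; rewrite -EFinM lee_fin !mulr_ge0.
- apply: (@measurable_EFinT _ _ _ _ (fun x => al1 * B * g x)).
  exact: measurable_funM.
rewrite !ge0_integralZl_EFin //=; last 6 first.
- by move=> x _; rewrite lee_fin.
- exact: measurable_EFinT mg.
- by rewrite mulr_ge0.
- by move=> x _; rewrite lee_fin mulr_ge0.
- exact: measurable_EFinT mbg.
- by rewrite mulr_ge0.
have F0 : 0 <= F by exact: powR_ge0.
have G0 : 0 <= G by exact: powR_ge0.
apply: (@le_trans _ _ ((al1 * ((w - u) * F))%:E * (K * ((w - u) * G))%:E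
   + (al1 * (K * ((w - u) * F)))%:E * ((w - u) * G)%:E)%E).
  apply: leeD; apply: lee_pmul; rewrite ?lee_fin ?mulr_ge0 //.
  - by apply: integral_ge0 => x _; rewrite lee_fin mulr_ge0.
  - by rewrite ler_wpM2l.
  - exact: be_bound gq uw.
  - by apply: integral_ge0 => x _; rewrite lee_fin.
  - by rewrite ler_wpM2l.
  - exact: avg_bound gq uw.
rewrite -!EFinM -EFinD lee_fin /h -/F -/G.
have -> : (w - u) `^ (al + 1) = al1 * ((w - u) * (w - u)).
  have -> : al + 1 = (al - 1) + 2%:R by lra.
  rewrite powRD; last by apply/implyP => _; rewrite gt_eqF.
  by rewrite powR_mulrn ?(ltW wu) // expr2.
by rewrite le_eqVlt; apply/orP; left; apply/eqP; ring.
Qed.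

(** Since [q < m], [be ^ q] is at most [1 + be ^ m], which is integrable on each of the finitely
    many nodes. This allows the division by the norm in [dyadic_op_bound]. *)
Lemma dyadic_op_lty n a c : a < c -> (\int[mu]_x (dyadic_op n a c x `^ q)%:E < +oo)%E.
Proof.
move=> ac; apply: (@node_sum_powR_lty _
  (fun u w x => if u <= x < w then node_term u w x else 0)) => //.
- by move=> u w; apply: measurable_if_co; exact: measurable_node_term.
- by move=> u w x _; case: ifP => // _; exact: node_term_ge0.
- exact: ltW.
move=> u w uw.
have -> : (\int[mu]_x ((if u <= x < w then node_term u w x else 0) `^ q)%:E =
   \int[mu]_(x in `[u, w[) (node_term u w x `^ q)%:E)%E.
  rewrite -integral_if_co; apply: eq_integral => x _.
  by case: ifP => // _; rewrite powR0 // gt_eqF.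
rewrite /node_term.
set A := Rintegral mu `[u, w[ f.
set B := Rintegral mu `[u, w[ (fun y => be u w y * f y).
set al1 := (w - u) `^ (al - 1).
have al10 : 0 <= al1 by exact: powR_ge0.
have A0 : 0 <= A by exact: Rint_ge0.
have B0 : 0 <= B by apply: Rint_ge0 => y; rewrite mulr_ge0.
pose k := al1 `^ q * (2 `^ q * (A `^ q + B `^ q)).
have k0 : 0 <= k by rewrite !mulr_ge0 ?addr_ge0 ?powR_ge0.
have key x : (al1 * (be u w x * A + B)) `^ q <= k * (1 + be u w x ^+ m).
  rewrite powRM ?addr_ge0 ?mulr_ge0 // /k -mulrA ler_wpM2l ?powR_ge0 //.
  apply: le_trans (powR_addr_le (ltW q0) _ _) _; rewrite ?mulr_ge0 //.
  rewrite -mulrA ler_wpM2l ?powR_ge0 // powRM //.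
  have hb : be u w x `^ q <= 1 + be u w x ^+ m.
    have [b1|b1] := leP (be u w x) 1.
      apply: (@le_trans _ _ 1); last by rewrite lerDl exprn_ge0.
      by have := ge0_ler_powR (ltW q0) (be0 u w x) ler01 b1; rewrite powR1.
    rewrite -powR_mulrn //; apply: le_trans (_ : be u w x `^ m%:R <= _).
      by rewrite ler_powR // ltW.
    by rewrite lerDr.
  have hb1 : 1 <= 1 + be u w x ^+ m by rewrite lerDl exprn_ge0.
  rewrite mulrDl lerD //.
    by rewrite mulrC ler_wpM2l ?powR_ge0.
  by rewrite -[leLHS]mulr1 ler_wpM2l ?powR_ge0.
apply: (@le_lt_trans _ _ (\int[mu]_(x in `[u, w[) (k%:E * (1%:E + (be u w x ^+ m)%:E)))%E).
  have mb : measurable_fun setT (fun x => al1 * (be u w x * A + B)).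
    by apply: measurable_funM => //; apply: measurable_funD => //; exact: measurable_funM.
  apply: ge0_le_integral => //=.
  - by move=> x _; rewrite lee_fin powR_ge0.
  - exact: measurable_EFin_powR mb.
  - apply: (@measurable_EFinT _ _ _ _ (fun x => k * (1 + be u w x ^+ m))).
    by apply: measurable_funM => //; apply: measurable_funD => //; exact: measurable_funX.
  - by move=> x _; rewrite -EFinD -EFinM lee_fin.
rewrite ge0_integralZl_EFin //=; last 2 first.
- by move=> x _; rewrite -EFinD lee_fin addr_ge0 ?exprn_ge0.
- apply: (@measurable_EFinT _ _ _ _ (fun x => 1 + be u w x ^+ m)).
  by apply: measurable_funD => //; exact: measurable_funX.
rewrite lte_mul_pinfty ?lee_fin // ge0_integralD //=; last 2 first.
- by move=> x _; rewrite lee_fin exprn_ge0.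
- apply: (@measurable_EFinT _ _ _ _ (fun x => be u w x ^+ m)); exact: measurable_funX.
rewrite lte_add_pinfty //.
  by rewrite integral_cst //= lebesgue_measure_itv /= lte_fin uw -EFinD mul1e ltry.
exact: le_lt_trans (hbe uw) (ltry _).
Qed.

Lemma dyadic_op_bound n a c : a < c ->
  (\int[mu]_x (dyadic_op n a c x `^ q)%:E <= ((2 * K * bilinear_const) `^ q)%:E)%E.
Proof.
move=> ac; set D := dyadic_op n a c; set C := 2 * K * bilinear_const.
have C0 : 0 <= C by apply: mulr_ge0; [exact: mulr_ge0|exact: bilinear_const_ge0].
have mD : measurable_fun setT D by exact: measurable_dyadic_op.
have D0 x : 0 <= D x by exact: dyadic_op_ge0.
have I0 : (0 <= \int[mu]_x (D x `^ q)%:E)%E.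
  by apply: integral_ge0 => x _; rewrite lee_fin powR_ge0.
have If : (\int[mu]_x (D x `^ q)%:E)%E \is a fin_num.
  by rewrite ge0_fin_numE //; exact: dyadic_op_lty.
set X := fine (\int[mu]_x (D x `^ q)%:E)%E.
have XE : (\int[mu]_x (D x `^ q)%:E = X%:E)%E by rewrite fineK.
rewrite XE lee_fin.
have : 0 <= X by rewrite fine_ge0.
rewrite le_eqVlt => /predU1P[<-|X0]; first by rewrite powR_ge0.
(* The extremal function for duality: its norm in [L^q'] is 1 because [(q - 1) * q' = q], and its
   pairing with [D] equals [X ^ (1 / q)], the norm of [D]. *)
pose g x := X `^ (- q'^-1) * D x `^ (q - 1).
have mg : measurable_fun setT g.
  by apply: measurable_funM => //; exact: measurableT_comp (measurable_powR _) mD.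
have g0 x : 0 <= g x by rewrite mulr_ge0 ?powR_ge0.
have gq : (\int[mu]_x (g x `^ q')%:E <= 1)%E.
  have e x : (g x `^ q')%:E = ((X^-1)%:E * (D x `^ q)%:E)%E.
    rewrite -EFinM /g powRM ?powR_ge0 // -!powRrM; congr (_ * _)%:E.
      by rewrite mulNr mulVf ?gt_eqF // powR_inv1 // ltW.
    by congr (_ `^ _); rewrite /q'; field; rewrite gt_eqF // subr_gt0.
  under eq_integral do rewrite e.
  rewrite ge0_integralZl_EFin //=.
  - by rewrite XE -EFinM mulVf ?gt_eqF.
  - by move=> x _; rewrite lee_fin powR_ge0.
  - exact: measurable_EFin_powR mD.
  - by rewrite invr_ge0 ltW.
have := dyadic_op_dual n ac mg g0 gq; rewrite -/D -/C.
have e x : (D x * g x)%:E = ((X `^ (- q'^-1))%:E * (D x `^ q)%:E)%E.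
  by rewrite -EFinM /g mulrCA mulr_powRB1.
under eq_integral do rewrite e.
rewrite ge0_integralZl_EFin ?powR_ge0 //=; last 2 first.
- by move=> x _; rewrite lee_fin powR_ge0.
- exact: measurable_EFin_powR mD.
rewrite XE -EFinM lee_fin.
have -> : X `^ (- q'^-1) * X = X `^ q^-1.
  rewrite -{2}(powRr1 (ltW X0)) -powRD; last by apply/implyP => _; rewrite gt_eqF.
  by congr (_ `^ _); rewrite -q'E addrA addNr add0r.
move=> h.
have -> : X = (X `^ q^-1) `^ q by rewrite -powRrM mulVf ?gt_eqF // powRr1 // ltW.
by rewrite ge0_ler_powR ?nnegrE ?powR_ge0 // ltW.
Qed.

End DyadicOperator.

(** * The positive commutator of a BMO function *)

Section PoweRLimits.
Context {R : realType}.

Lemma ge0_le_poweR (q : R) (x y : \bar R) : 0 <= q -> (0 <= x)%E -> (x <= y)%E ->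
  (x `^ q <= y `^ q)%E.
Proof.
move=> q0 x0 xy; apply: gt0_ler_poweR => //.
  by rewrite in_itv /= x0 leey.
by rewrite in_itv /= (le_trans x0 xy) leey.
Qed.

(** Monotone limits are suprema, and the power commutes with suprema because it is increasing with
    the increasing inverse [x ^ (1 / q)]. The value [+oo] is thus covered too. *)
Lemma nondecreasing_cvg_poweR (q : R) (u : nat -> \bar R) (l : \bar R) : 0 < q ->
  (forall n, (0 <= u n)%E) -> {homo u : n k / (n <= k)%N >-> (n <= k)%E} ->
  (u n @[n --> \oo] --> l)%E -> ((u n `^ q)%E @[n --> \oo] --> (l `^ q)%E)%E.
Proof.
move=> q0 u0 und ul.
have -> : l = ereal_sup (range u).
  by apply: (@cvg_unique _ _ (u @ \oo)) => //; exact: ereal_nondecreasing_cvgn.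
have uq : {homo (fun n => u n `^ q)%E : n k / (n <= k)%N >-> (n <= k)%E}.
  by move=> n k nk; apply: ge0_le_poweR (und _ _ nk) => //; exact: ltW.
have -> : (ereal_sup (range u) `^ q)%E = ereal_sup (range (fun n => u n `^ q)%E).
  have s0 : (0 <= ereal_sup (range u))%E.
    by apply: le_trans (u0 0%N) _; apply: ereal_sup_ubound; exists 0%N.
  apply/eqP; rewrite eq_le; apply/andP; split; last first.
    apply: ge_ereal_sup => _ [n _ <-]; apply: ge0_le_poweR (u0 n) _; first exact: ltW.
    by apply: ereal_sup_ubound; exists n.
  set M := ereal_sup (range (fun n => u n `^ q)%E).
  have uM n : (u n `^ q <= M)%E by apply: ereal_sup_ubound; exists n.
  have M0 : (0 <= M)%E by apply: le_trans (uM 0%N); exact: poweR_ge0.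
  have inv (x : \bar R) : (0 <= x)%E -> ((x `^ q) `^ q^-1 = x)%E.
    by move=> x0; rewrite -poweRrM divff ?gt_eqF // poweRe1.
  have inv' (x : \bar R) : (0 <= x)%E -> ((x `^ q^-1) `^ q = x)%E.
    by move=> x0; rewrite -poweRrM mulVf ?gt_eqF // poweRe1.
  rewrite -[leRHS]inv' //; apply: ge0_le_poweR => //; first exact: ltW.
  apply: ge_ereal_sup => _ [n _ <-]; rewrite -[leLHS]inv //.
  by apply: ge0_le_poweR (uM n); rewrite ?invr_ge0 ?poweR_ge0 // ltW.
exact: ereal_nondecreasing_cvgn.
Qed.

Lemma cvg_powR0 (q : R) (u : nat -> R) : 0 < q -> (forall n, 0 <= u n) ->
  u n @[n --> \oo] --> 0 -> u n `^ q @[n --> \oo] --> 0.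
Proof.
move=> q0 u0 /cvgrPdist_lt ul; apply/cvgrPdist_lt => e e0.
have e1 : 0 < e `^ q^-1 by exact: powR_gt0.
apply: filterS (ul _ e1) => n /=; rewrite !sub0r !normrN.
rewrite !ger0_norm ?powR_ge0 // => h.
have -> : e = (e `^ q^-1) `^ q by rewrite -powRrM mulVf ?gt_eqF // powRr1 // ltW.
by rewrite gt0_ltr_powR ?nnegrE ?powR_ge0.
Qed.

End PoweRLimits.

(** * The one-third trick *)

Section OneThird.
Context {R : realType}.
Implicit Types x y N h : R.

Lemma dyadic_scale N (t : R) d : N / 2 ^+ d <= t -> t < 2 * N ->
  exists k, [/\ (k <= d)%N, N / 2 ^+ k <= t & t < 2 * N / 2 ^+ k].
Proof.
move=> + tN; elim: d => [|d ih] h; first by exists 0%N; rewrite expr0 !divr1 in h *.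
have [/ih[k [kd h1 h2]]|h1] := leP (N / 2 ^+ d) t.
  by exists k; split => //; exact: leqW.
exists d.+1; split => //; rewrite exprS invfM mulrA (_ : 2 * N / 2 = N) //.
by field.
Qed.

(** The integer in parentheses is not 0, since 3 does not divide [2 ^ k]; its absolute value is
    therefore at least 1. *)
Lemma grids_apart (j1 j2 k : nat) h : 0 < h ->
  h <= `|h * (3 * j1%:R - 3 * j2%:R - 2 ^+ k)|.
Proof.
move=> h0; rewrite normrM gtr0_norm // ler_peMr ?(ltW h0) //.
have ne : (3 * j1 != 3 * j2 + 2 ^ k)%N.
  apply/eqP => e; have : (3 %| 3 * j2 + 2 ^ k)%N by rewrite -e dvdn_mulr.
  by rewrite dvdn_addr ?dvdn_mulr // Euclid_dvdX.
have -> : 3 * j1%:R - 3 * j2%:R - 2 ^+ k = (3 * j1)%:R - (3 * j2 + 2 ^ k)%:R :> R.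
  by rewrite natrD !natrM natrX opprD addrA.
move: ne; move: (3 * j1)%N (3 * j2 + 2 ^ k)%N => A B.
rewrite neq_ltn => /orP[AB|BA].
  by rewrite distrC; apply: le_trans _ (ler_norm _); rewrite lerBrDr nat1r ler_nat.
by apply: le_trans _ (ler_norm _); rewrite lerBrDr nat1r ler_nat.
Qed.

(* The grids generated by [-4N, 2N[ and [-2N, 4N[ are translates of each other
   by a third of their length, so their endpoints at a given scale [h] stay at distance
   at least [h / 3]: two points closer than that share a cell of one of them. *)
Lemma one_third_trick N x y d : 0 < N -> `|x| < N -> `|y| < N ->
  0 < y - x -> N / 2 ^+ d <= y - x ->
  exists k, (k <= d)%N /\
    ([/\ (cell k (- (4 * N)) (2 * N) x).1 <= x < (cell k (- (4 * N)) (2 * N) x).2,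
         (cell k (- (4 * N)) (2 * N) x).1 <= y < (cell k (- (4 * N)) (2 * N) x).2 &
         (cell k (- (4 * N)) (2 * N) x).2 - (cell k (- (4 * N)) (2 * N) x).1 <= 6 * (y - x)]
    \/ [/\ (cell k (- (2 * N)) (4 * N) x).1 <= x < (cell k (- (2 * N)) (4 * N) x).2,
         (cell k (- (2 * N)) (4 * N) x).1 <= y < (cell k (- (2 * N)) (4 * N) x).2 &
         (cell k (- (2 * N)) (4 * N) x).2 - (cell k (- (2 * N)) (4 * N) x).1 <= 6 * (y - x)]).
Proof.
move=> N0; rewrite !ltr_norml => /andP[x1 x2] /andP[y1 y2] xy hd.
have t2 : y - x < 2 * N by lra.
have [k [kd hk1 hk2]] := dyadic_scale hd t2.
exists k; split => //.
have [l1 r1] : - (4 * N) <= x /\ x < 2 * N by split; lra.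
have [l2 r2] : - (2 * N) <= x /\ x < 4 * N by split; lra.
have c1 := cell_in k l1 r1; have c2 := cell_in k l2 r2.
have [j1 g1] := cell_grid k (- (4 * N)) (2 * N) x.
have [j2 g2] := cell_grid k (- (2 * N)) (4 * N) x.
have s1 := cell_size k (- (4 * N)) (2 * N) x.
have s2 := cell_size k (- (2 * N)) (4 * N) x.
move: c1 c2 g1 g2 s1 s2; move: (cell k (- (4 * N)) (2 * N) x) (cell k (- (2 * N)) (4 * N) x) => [u1 w1] [u2 w2] /=.
have e1 : 2 * N - - (4 * N) = 6 * N by lra.
have e2 : 4 * N - - (2 * N) = 6 * N by lra.
rewrite e1 e2; set h := 6 * N / 2 ^+ k => c1 c2 g1 g2 s1 s2.
have h0 : 0 < h by rewrite divr_gt0 ?exprn_gt0 // mulr_gt0.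
have hh1 : h <= 6 * (y - x) by rewrite /h -mulrA ler_pM2l.
have hh2 : 3 * (y - x) < h.
  by have := hk2; rewrite -(@ltr_pM2l _ 3) // /h !mulrA -natrM.
have [yw1|w1y] := ltP y w1.
  left; split => //; last by rewrite s1.
  by case/andP: c1 => c11 c12; apply/andP; split => //; lra.
have [yw2|w2y] := ltP y w2.
  right; split => //; last by rewrite s2.
  by case/andP: c2 => c21 c22; apply/andP; split => //; lra.
exfalso; case/andP: c1 => c11 c12; case/andP: c2 => c21 c22.
have : `|3 * (w1 - w2)| < h.
  by rewrite ltr_norml; apply/andP; split; lra.
(* The shift [2 * N] between the two roots equals [2 ^ k * h / 3]. *)
have -> : 3 * (w1 - w2) = h * (3 * j1%:R - 3 * j2%:R - 2 ^+ k).
  have -> : w1 = u1 + h by lra.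
  have -> : w2 = u2 + h by lra.
  rewrite g1 g2 /h; field; by rewrite expf_neq0.
by apply/negP; rewrite -leNgt; exact: grids_apart.
Qed.

End OneThird.

(** * Domination of a positive operator by two dyadic ones *)

Section PositiveOperator.
Context {R : realType}.
Local Notation mu := (@lebesgue_measure R).
Implicit Types (u w x y a c : R).
Variables (p q al : R) (m : nat).
Hypotheses (p1 : 1 < p) (pq : p < q) (al0 : 0 < al) (al1 : al < 1).
Hypothesis (qE : q^-1 = p^-1 - al).
Hypotheses (mp : p / (p - 1) < m%:R) (mq : q < m%:R).
Variables (be : R -> R -> R -> R) (K : R).
Hypotheses (K0 : 0 <= K).
Hypothesis mbe : forall u w, measurable_fun setT (be u w).
Hypothesis be0 : forall u w x, 0 <= be u w x.
Hypothesis hbe : forall u w, u < w ->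
  (\int[mu]_(x in `[u, w[) (be u w x ^+ m)%:E <= (K ^+ m * (w - u))%:E)%E.
Variable kap : R -> R -> R.
Hypothesis mkap : measurable_fun setT (fun z : R * R => kap z.1 z.2).
Hypothesis kap0 : forall x y, 0 <= kap x y.
Hypothesis kap_be : forall u w x y, u <= x < w -> u <= y < w ->
  kap x y <= be u w x + be u w y.
Variable f : R -> R.
Hypothesis mf : measurable_fun setT f.
Hypothesis f0 : forall x, 0 <= f x.
Hypothesis fp : (\int[mu]_x (f x `^ p)%:E <= 1)%E.

Let q0 : 0 < q. Proof. exact: lt_trans (lt_trans ltr01 p1) pq. Qed.

Definition pos_kernel x y : R :=
  if x < y then kap x y * (y - x) `^ (al - 1) * f y else 0.

Definition pos_op x : \bar R := (\int[mu]_y (pos_kernel x y)%:E)%E.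

Let trunc (n : nat) x y : bool :=
  [&& `|x| < 2 ^+ n, `|y| < 2 ^+ n & (2 ^+ n)^-1 <= y - x].

Let tkernel n x y : R := if trunc n x y then kap x y * (y - x) `^ (al - 1) * f y else 0.
Let top n x : \bar R := (\int[mu]_y (tkernel n x y)%:E)%E.

Let core_ge0 x y : 0 <= kap x y * (y - x) `^ (al - 1) * f y.
Proof. by rewrite !mulr_ge0 ?powR_ge0. Qed.

Lemma pos_kernel_ge0 x y : 0 <= pos_kernel x y.
Proof. by rewrite /pos_kernel; case: ifP. Qed.

Let tkernel_ge0 n x y : 0 <= tkernel n x y.
Proof. by rewrite /tkernel; case: ifP. Qed.

Let mcore : measurable_fun setT (fun z : R * R => kap z.1 z.2 * (z.2 - z.1) `^ (al - 1) * f z.2).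
Proof.
apply: measurable_funM; last exact: measurableT_comp mf measurable_snd.
apply: measurable_funM => //.
apply: (measurableT_comp (measurable_powR (al - 1))).
exact: measurable_funB.
Qed.

Lemma measurable_pos_kernel : measurable_fun setT (fun z : R * R => pos_kernel z.1 z.2).
Proof. by apply: measurable_fun_ifT => //; exact: measurable_fun_ltr. Qed.

Let measurable_tkernel n : measurable_fun setT (fun z : R * R => tkernel n z.1 z.2).
Proof.
apply: measurable_fun_ifT => //; apply: measurable_and.
  by apply: measurable_fun_ltr => //; apply: measurableT_comp.
apply: measurable_and.
  by apply: measurable_fun_ltr => //; apply: measurableT_comp.
by apply: measurable_fun_ler => //; exact: measurable_funB.
Qed.

Let measurable_slice (k : R -> R -> R) x :
  measurable_fun setT (fun z : R * R => k z.1 z.2) -> measurable_fun setT (k x).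
Proof. by move=> mk; exact: (measurableT_comp mk (measurable_pair1 x)). Qed.

Let measurable_partial_integral (k : R -> R -> R) :
  measurable_fun setT (fun z : R * R => k z.1 z.2) -> (forall x y, 0 <= k x y) ->
  measurable_fun setT (fun x => \int[mu]_y (k x y)%:E)%E.
Proof.
move=> mk k0.
apply: (@measurable_fun_fubini_tonelli_F _ _ _ _ R mu (fun z : R * R => (k z.1 z.2)%:E)).
  exact/measurable_EFinP.
by move=> z; rewrite lee_fin.
Qed.

Lemma measurable_pos_op : measurable_fun setT pos_op.
Proof. exact: measurable_partial_integral measurable_pos_kernel pos_kernel_ge0. Qed.

Let measurable_top n : measurable_fun setT (top n).
Proof. exact: measurable_partial_integral (measurable_tkernel n) (tkernel_ge0 n). Qed.

Lemma pos_op_ge0 x : (0 <= pos_op x)%E.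
Proof. by apply: integral_ge0 => y _; rewrite lee_fin pos_kernel_ge0. Qed.

Let top_ge0 n x : (0 <= top n x)%E.
Proof. by apply: integral_ge0 => y _; rewrite lee_fin. Qed.

Let D (n : nat) a c := @dyadic_op R al be f n a c.
(** The cost of replacing [y - x] by the length of the common interval, which is at most 6 times
    larger, in the power [al - 1]. *)
Let C6 : R := 6 `^ (1 - al).

Let term u w x y : R := if u <= y < w then
  (if u <= x < w then (w - u) `^ (al - 1) * (be u w x + be u w y) * f y else 0) else 0.

Let term_ge0 u w x y : 0 <= term u w x y.
Proof. by rewrite /term; case: ifP => // _; case: ifP => // _; rewrite !mulr_ge0 ?powR_ge0 ?addr_ge0. Qed.

Let measurable_term u w x : measurable_fun setT (term u w x).
Proof.
apply: measurable_if_co; case: (u <= x < w); last exact: measurable_cst.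
apply: measurable_funM => //; apply: measurable_funM => //; exact: measurable_funD.
Qed.

Let integral_terms (n : nat) a c x : a < c ->
  (\int[mu]_y (node_sum n (fun u w => term u w x y) a c)%:E <= (D n a c x)%:E)%E.
Proof.
move=> ac; apply: integral_node_sum_le => // u w uw.
rewrite /term integral_if_co; case: ifP => xuw; last first.
  by rewrite integral0.
have mbf : measurable_fun setT (fun x => be u w x * f x) by exact: measurable_funM.
pose k := (w - u) `^ (al - 1).
have k0 : 0 <= k by exact: powR_ge0.
have e y : ((w - u) `^ (al - 1) * (be u w x + be u w y) * f y)%:E =
   ((k * be u w x)%:E * (f y)%:E + k%:E * (be u w y * f y)%:E)%E.
  by rewrite -!EFinM -EFinD /k; congr EFin; ring.
under eq_integral do rewrite e.
rewrite ge0_integralD //=; last 4 first.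
- by move=> y _; rewrite -EFinM lee_fin !mulr_ge0.
- apply: (@measurable_EFinT _ _ _ _ (fun y => k * be u w x * f y)).
  exact: measurable_funM.
- by move=> y _; rewrite -EFinM lee_fin !mulr_ge0.
- apply: (@measurable_EFinT _ _ _ _ (fun y => k * (be u w y * f y))).
  exact: measurable_funM.
rewrite !ge0_integralZl_EFin //=; last 5 first.
- by move=> y _; rewrite lee_fin mulr_ge0.
- exact: measurable_EFinT mbf.
- by move=> y _; rewrite lee_fin.
- exact: measurable_EFinT mf.
- by rewrite mulr_ge0.
rewrite (integrable_RintegralE (measurable_itv _) (integrable_node p1 pq mp mq mf f0 fp uw)).
rewrite (integrable_RintegralE (measurable_itv _)
  (integrable_node_osc p1 pq mp mq K0 mbe be0 hbe mf f0 fp uw)).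
by rewrite -!EFinM -EFinD lee_fin /node_term -/k mulrDr mulrA.
Qed.

(** The one-third trick gives a node of one of the two trees that contains [x] and [y] and has
    length comparable to [y - x]. The term of this node already dominates the kernel, and all the
    others are nonnegative. *)
Let tkernel_le n x y :
  tkernel n x y <= C6 * (node_sum (2 * n) (fun u w => term u w x y) (- (4 * 2 ^+ n)) (2 * 2 ^+ n)
                        + node_sum (2 * n) (fun u w => term u w x y) (- (2 * 2 ^+ n)) (4 * 2 ^+ n)).
Proof.
have N0 : 0 < 2 ^+ n :> R by rewrite exprn_gt0.
have r1 : - (4 * 2 ^+ n) < 2 * 2 ^+ n :> R by lra.
have r2 : - (2 * 2 ^+ n) < 4 * 2 ^+ n :> R by lra.
have C60 : 0 <= C6 by exact: powR_ge0.
have t0 u w : u < w -> 0 <= term u w x y by move=> _; exact: term_ge0.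
have s1 := node_sum_ge0 t0 (2 * n) r1; have s2 := node_sum_ge0 t0 (2 * n) r2.
rewrite /tkernel; case: ifP => [/and3P[xN yN xy]|_]; last by rewrite mulr_ge0 ?addr_ge0.
have xy0 : 0 < y - x by apply: lt_le_trans xy; rewrite invr_gt0.
have hd : 2 ^+ n / 2 ^+ (2 * n) <= y - x.
  rewrite (_ : 2 ^+ n / 2 ^+ (2 * n) = (2 ^+ n)^-1) // mul2n -addnn exprD.
  by field; rewrite expf_neq0.
have key u w : u <= x < w -> u <= y < w -> w - u <= 6 * (y - x) ->
    kap x y * (y - x) `^ (al - 1) * f y <= C6 * term u w x y.
  move=> xu yu wu6; rewrite /term xu yu !mulrA ler_wpM2r // mulrC.
  have wu : 0 < w - u.
    by case/andP: xu => h1 h2; rewrite subr_gt0; apply: le_lt_trans h1 h2.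
  apply: ler_pM; rewrite ?powR_ge0 //; last exact: kap_be.
  have e : al - 1 = - (1 - al) by lra.
  rewrite e !powRN ler_pdivlMr ?powR_gt0 // mulrC ler_pdivrMr ?powR_gt0 //.
  rewrite /C6 -powRM ?(ltW xy0) //.
  apply: ge0_ler_powR => //; rewrite ?nnegrE ?(ltW wu) // ?mulr_ge0 ?(ltW xy0) //.
  by rewrite subr_ge0 ltW.
have [k [kd [[h1 h2 h3]|[h1 h2 h3]]]] := one_third_trick N0 xN yN xy0 hd.
  apply: le_trans (key _ _ h1 h2 h3) _; rewrite ler_wpM2l //.
  apply: le_trans (node_sum_cell t0 x kd r1) _; exact: ler_wpDr.
apply: le_trans (key _ _ h1 h2 h3) _; rewrite ler_wpM2l //.
apply: le_trans (node_sum_cell t0 x kd r2) _; exact: ler_wpDl.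
Qed.

Let top_le n x :
  (top n x <= (C6 * (D (2 * n) (- (4 * 2 ^+ n)) (2 * 2 ^+ n) x
                     + D (2 * n) (- (2 * 2 ^+ n)) (4 * 2 ^+ n) x))%:E)%E.
Proof.
have N0 : 0 < 2 ^+ n :> R by rewrite exprn_gt0.
have r1 : - (4 * 2 ^+ n) < 2 * 2 ^+ n :> R by lra.
have r2 : - (2 * 2 ^+ n) < 4 * 2 ^+ n :> R by lra.
have t0 y u w : u < w -> 0 <= term u w x y by move=> _; exact: term_ge0.
have mN a c : measurable_fun setT (fun y => node_sum (2 * n) (fun u w => term u w x y) a c).
  by apply: (@measurable_node_sum _ (fun u w y => term u w x y)) => u w; exact: measurable_term.
have s1 y := node_sum_ge0 (t0 y) (2 * n) r1; have s2 y := node_sum_ge0 (t0 y) (2 * n) r2.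
apply: (@le_trans _ _ (\int[mu]_y (C6%:E *
  ((node_sum (2 * n) (fun u w => term u w x y) (- (4 * 2 ^+ n)) (2 * 2 ^+ n))%:E
   + (node_sum (2 * n) (fun u w => term u w x y) (- (2 * 2 ^+ n)) (4 * 2 ^+ n))%:E)))%E).
  apply: ge0_le_integral => //=.
  - by move=> y _; rewrite lee_fin.
  - exact: measurable_EFinT (measurable_slice x (measurable_tkernel n)).
  - apply: (@measurable_EFinT _ _ _ _ (fun y => C6 *
     (node_sum (2 * n) (fun u w => term u w x y) (- (4 * 2 ^+ n)) (2 * 2 ^+ n)
      + node_sum (2 * n) (fun u w => term u w x y) (- (2 * 2 ^+ n)) (4 * 2 ^+ n)))).
    by apply: measurable_funM => //; exact: measurable_funD.
  - by move=> y _; rewrite -EFinD -EFinM lee_fin tkernel_le.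
rewrite ge0_integralZl_EFin ?powR_ge0 //=; last 2 first.
- by move=> y _; rewrite -EFinD lee_fin addr_ge0.
- apply: (@measurable_EFinT _ _ _ _ (fun y =>
     node_sum (2 * n) (fun u w => term u w x y) (- (4 * 2 ^+ n)) (2 * 2 ^+ n)
      + node_sum (2 * n) (fun u w => term u w x y) (- (2 * 2 ^+ n)) (4 * 2 ^+ n))).
  exact: measurable_funD.
rewrite EFinM lee_wpmul2l ?lee_fin ?powR_ge0 //.
rewrite ge0_integralD //=; last 4 first.
- by move=> y _; rewrite lee_fin.
- exact: measurable_EFinT (mN _ _).
- by move=> y _; rewrite lee_fin.
- exact: measurable_EFinT (mN _ _).
by rewrite EFinD leeD // integral_terms.
Qed.

Definition pos_op_const : R :=
  C6 `^ q * (2 `^ q * ((2 * bilinear_const p q al m) `^ q *+ 2)).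

Let measurable_top_pow n : measurable_fun setT (fun x => top n x `^ q)%E.
Proof. by apply: (measurableT_comp (measurable_poweR q)); exact: measurable_top. Qed.

Let top_bound n : (\int[mu]_x (top n x `^ q) <= (pos_op_const * K `^ q)%:E)%E.
Proof.
have N0 : 0 < 2 ^+ n :> R by rewrite exprn_gt0.
have r1 : - (4 * 2 ^+ n) < 2 * 2 ^+ n :> R by lra.
have r2 : - (2 * 2 ^+ n) < 4 * 2 ^+ n :> R by lra.
have mD a c : measurable_fun setT (D (2 * n) a c) by exact: measurable_dyadic_op.
have D0 a c x : a < c -> 0 <= D (2 * n) a c x by exact: dyadic_op_ge0.
have bD a c : a < c ->
    (\int[mu]_x (D (2 * n) a c x `^ q)%:E <= ((2 * K * bilinear_const p q al m) `^ q)%:E)%E.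
  by move=> ac; exact: dyadic_op_bound.
pose D1 := D (2 * n) (- (4 * 2 ^+ n)) (2 * 2 ^+ n).
pose D2 := D (2 * n) (- (2 * 2 ^+ n)) (4 * 2 ^+ n).
have D10 x : 0 <= D1 x by exact: D0.
have D20 x : 0 <= D2 x by exact: D0.
have C60 : 0 <= C6 by exact: powR_ge0.
have mD12 : measurable_fun setT (fun x => D1 x + D2 x) by apply: measurable_funD; exact: mD.
have pw : (\int[mu]_x (top n x `^ q) <=
    \int[mu]_x ((C6 `^ q)%:E * ((D1 x + D2 x) `^ q)%:E))%E.
  apply: ge0_le_integral => //=.
  - by move=> x _; exact: poweR_ge0.
  - exact: measurable_top_pow.
  - apply: (@measurable_EFinT _ _ _ _ (fun x => C6 `^ q * (D1 x + D2 x) `^ q)).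
    apply: measurable_funM => //.
    exact: measurableT_comp (measurable_powR q) mD12.
  - move=> x _; rewrite -EFinM -powRM ?addr_ge0 // -poweR_EFin.
    by apply: ge0_le_poweR (top_le n x) => //; exact: ltW.
apply: (le_trans pw).
rewrite ge0_integralZl_EFin ?powR_ge0 //=; last 2 first.
- by move=> x _; rewrite lee_fin powR_ge0.
- exact: measurable_EFin_powR mD12.
have -> : pos_op_const * K `^ q =
    C6 `^ q * (2 `^ q * ((2 * K * bilinear_const p q al m) `^ q *+ 2)).
  have B0 : 0 <= bilinear_const p q al m by exact: bilinear_const_ge0 p1 pq al0.
  have -> : 2 * K * bilinear_const p q al m = 2 * bilinear_const p q al m * K by ring.
  have B20 : 0 <= 2 * bilinear_const p q al m by exact: mulr_ge0.
  by rewrite /pos_op_const (powRM q B20 K0); ring.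
rewrite EFinM lee_wpmul2l ?lee_fin ?powR_ge0 //.
apply: le_trans (integral_powR_add (ltW q0) (mD _ _) (mD _ _) D10 D20) _.
rewrite EFinM lee_wpmul2l ?lee_fin ?powR_ge0 // mulr2n EFinD.
by rewrite leeD // bD.
Qed.

(** The truncated kernels increase and at each pair of points are eventually equal to the full one.
    Monotone convergence gives the limit at each [x], and Fatou transfers the bound, which does not
    depend on [n]. *)
Lemma pos_op_bound : (\int[mu]_x (pos_op x `^ q) <= (pos_op_const * K `^ q)%:E)%E.
Proof.
apply: (@fatou_bound _ _ _ mu setT (fun n x => top n x `^ q)%E) => //.
- by move=> n x _; exact: poweR_ge0.
- by apply: (measurableT_comp (measurable_poweR q)); exact: measurable_pos_op.
- by move=> x _; exact: poweR_ge0.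
apply: aeW => x _.
have tmono n k : (n <= k)%N -> forall y, trunc n x y -> trunc k x y.
  move=> nk y /and3P[h1 h2 h3].
  have nk2 : 2 ^+ n <= 2 ^+ k :> R by rewrite ler_weXn2l // ler1n.
  apply/and3P; split; [exact: lt_le_trans h1 _|exact: lt_le_trans h2 _|].
  by apply: le_trans h3; rewrite lef_pV2 ?posrE ?exprn_gt0.
have kmono y : {homo (fun n => (tkernel n x y)%:E) : n k / (n <= k)%N >-> (n <= k)%E}.
  move=> n k nk; rewrite lee_fin /tkernel; case: ifP => h; last by case: ifP.
  by rewrite (tmono _ _ nk).
apply: nondecreasing_cvg_poweR => //.
  move=> n k nk; apply: ge0_le_integral => //.
  - by move=> y _; rewrite lee_fin.
  - exact: measurable_EFinT (measurable_slice x (measurable_tkernel n)).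
  - exact: measurable_EFinT (measurable_slice x (measurable_tkernel k)).
  - by move=> y _; exact: kmono.
have mk n : measurable_fun setT (fun y => (tkernel n x y)%:E).
  exact: measurable_EFinT (measurable_slice x (measurable_tkernel n)).
have h := @cvg_monotone_convergence _ _ R mu setT measurableT
  (fun n y => (tkernel n x y)%:E) mk
  (fun n y _ => tkernel_ge0 n x y) (fun y _ => kmono y).
have -> : pos_op x = (\int[mu]_y limn (fun n => (tkernel n x y)%:E))%E; last exact: h.
apply: eq_integral => y _; apply/esym/cvg_lim => //.
apply: cvg_near_cst; rewrite /pos_kernel; case: ltP => xy.
  have xy0 : 0 < y - x by rewrite subr_gt0.
  have g (z : R) : \forall n \near \oo, z < 2 ^+ n.
    apply: filterS (nbhs_infty_gtr z) => n /lt_le_trans; apply.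
    by rewrite -natrX ler_nat ltnW // ltn_expl.
  near=> n; rewrite /tkernel /trunc ifT //; apply/and3P; split; near: n; first exact: g.
    exact: g.
  apply: filterS (g (y - x)^-1) => n hn; rewrite -[leRHS]invrK lef_pV2 ?posrE ?exprn_gt0 ?invr_gt0 //.
  exact: ltW.
apply: nearW => n; rewrite /tkernel /trunc; case: ifP => // /and3P[_ _ h3].
have : 0 < y - x by apply: lt_le_trans h3; rewrite invr_gt0 exprn_gt0.
by rewrite subr_gt0 ltNge xy.
Unshelve. all: by end_near. Qed.

End PositiveOperator.

(** * Integrability of negative powers at infinity *)

Section DecayWeight.
Context {R : realType}.
Local Notation mu := (@lebesgue_measure R).

Lemma powR_continuous_at (a x : R) : 0 < x -> {for x, continuous (fun t : R => t `^ a)}.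
Proof.
move=> x0; apply: differentiable_continuous; apply/derivable1_diffP.
by apply: derivable_powR; rewrite in_itv /= x0.
Qed.

Lemma is_derive1_powR_shift (a x : R) : 0 < 1 + x ->
  is_derive x (1 : R) (fun t : R => (1 + t) `^ a) (a * (1 + x) `^ (a - 1)).
Proof.
move=> x0; have h := is_derive1_powR a x0.
have g : is_derive x (1 : R) (fun t : R => 1 + t) 1.
  apply: is_derive_eq (is_deriveD (is_derive_cst (1 : R) x 1) (is_derive_id x 1)) _.
  by rewrite add0r.
have := @is_derive1_comp R (fun t => t `^ a) (fun t => 1 + t) x _ _ h g.
by rewrite mulr1.
Qed.

(** By symmetry it suffices to integrate over the half-line, where [(1 + x) ^ (1 - r) / (1 - r)] is
    a primitive vanishing at infinity. *)
Lemma integral_weight_lty (r : R) : 1 < r ->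
  (\int[mu]_x ((1 + `|x|) `^ (- r))%:E < +oo)%E.
Proof.
move=> r1.
have cshift : continuous (fun x : R => 1 + `|x|).
  by move=> x; apply: continuousD; [exact: cst_continuous|exact: norm_continuous].
rewrite ge0_symfun_integralT; last 3 first.
- by move=> x; exact: powR_ge0.
- move=> x; apply: (@continuous_comp _ _ _ (fun x : R => 1 + `|x|) (fun t : R => t `^ (- r))).
    exact: cshift.
  by apply: powR_continuous_at; rewrite ltr_pwDl.
- by move=> x /=; rewrite normrN.
rewrite lte_mul_pinfty //.
have -> : [set x : R | (0 <= x)%R] = `[0, +oo[%classic.
  by apply/seteqP; split => x /=; rewrite in_itv /= andbT.
have -> : (\int[mu]_(x in `[0%R, +oo[) ((1 + `|x|) `^ (- r))%:E =
           \int[mu]_(x in `[0%R, +oo[) ((1 + x) `^ (- r))%:E)%E.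
  by apply: eq_integral => x; rewrite inE /= in_itv /= andbT => x0; rewrite ger0_norm.
pose F (x : R) : R := (1 + x) `^ (1 - r) / (1 - r).
have r1n : 1 - r != 0 by rewrite subr_eq0 eq_sym gt_eqF.
have dF (x : R) : 0 < 1 + x -> is_derive x (1 : R) F ((1 + x) `^ (- r)).
  move=> x0; have h := is_derive1_powR_shift (1 - r) x0.
  have := is_deriveM h (is_derive_cst ((1 - r)^-1 : R) x 1).
  rewrite /F => h1; apply: is_derive_eq h1 _.
  rewrite /= scaler0 add0r /GRing.scale /= (_ : 1 - r - 1 = - r); last by lra.
  by field.
have cont (G : R -> R) (x : R) : derivable G x 1 -> {for x, continuous G}.
  by move=> h; apply: differentiable_continuous; apply/derivable1_diffP.
have pos (x : R) : 0 <= x -> 0 < 1 + x by move=> x0; rewrite ltr_pwDl.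
rewrite (@ge0_continuous_FTC2y _ _ F _ 0) ?ltry //.
- by move=> x x0; exact: powR_ge0.
- apply: continuous_in_subspaceT => x; rewrite inE /= in_itv /= andbT => x0.
  by apply: cont; have [] := is_derive1_powR_shift (- r) (pos _ x0).
- rewrite /F -(mul0r (1 - r)^-1); apply: cvgMl.
  apply/cvgrPdist_lt => e e0; near=> x.
  have x0 : 0 < x by near: x; exact: nbhs_pinfty_gt.
  rewrite sub0r normrN ger0_norm ?powR_ge0 //.
  have -> : e = (e `^ (1 - r)^-1) `^ (1 - r).
    by rewrite -powRrM mulVf // powRr1 // ltW.
  have -> : 1 - r = - (r - 1) by lra.
  rewrite powRN [ltRHS]powRN ltf_pV2 ?posrE ?powR_gt0 //; last by rewrite ltr_pwDl // ltW.
  apply: gt0_ltr_powR; rewrite ?subr_gt0 ?nnegrE ?powR_ge0 //.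
    by rewrite addr_ge0 // ltW.
  by rewrite ltr_wpDl //; near: x; exact: nbhs_pinfty_gt.
- by move=> x x0; have [] := dF x (pos _ (ltW x0)).
- apply: cvg_at_right_filter; apply: cont.
  by have [] := dF 0 (pos _ (lexx _)).
- move=> x; rewrite in_itv /= andbT => x0; rewrite derive1E.
  by have [_ ->] := dF x (pos _ (ltW x0)).
Unshelve. all: by end_near. Qed.

End DecayWeight.

(** * Comparison of commutators *)

Section Commutator.
Context {R : realType}.
Local Notation mu := (@lebesgue_measure R).
Implicit Types (x y : R) (f g psi phi b : R -> R).
Variables (p q al : R).
Hypotheses (p1 : 1 < p) (pq : p < q) (al0 : 0 < al) (al1 : al < 1).
Hypothesis (qE : q^-1 = p^-1 - al).

Let q0 : 0 < q. Proof. exact: lt_trans (lt_trans ltr01 p1) pq. Qed.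

Definition in_ball f : Prop :=
  measurable_fun setT f /\ (\int[mu]_x (`|f x| `^ p)%:E <= 1)%E.

Definition osc_op psi f : R -> \bar R :=
  pos_op al (fun x y => `|psi x - psi y|) (fun y => `|f y|).

Definition frac_op f : R -> \bar R := pos_op al (fun _ _ => 1) (fun y => `|f y|).

Let exponent : exists m : nat, p / (p - 1) < m%:R /\ q < m%:R.
Proof.
exists (Num.bound (p / (p - 1)) + Num.bound q)%N; rewrite natrD; split.
  apply: (@lt_le_trans _ _ (Num.bound (p / (p - 1)))%:R); last by rewrite lerDl.
  by apply: archi_boundP; rewrite divr_ge0 ?subr_ge0 // ltW // (lt_trans _ p1).
apply: (@lt_le_trans _ _ (Num.bound q)%:R); last by rewrite lerDr.
by apply: archi_boundP; exact: ltW.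
Qed.

Let measurable_norm f : measurable_fun setT f -> measurable_fun setT (fun x => `|f x|).
Proof. exact: measurableT_comp. Qed.

Let measurable_kap psi : measurable_fun setT psi ->
  measurable_fun setT (fun z : R * R => `|psi z.1 - psi z.2|).
Proof.
move=> mpsi; apply: measurableT_comp => //.
by apply: measurable_funB; apply: measurableT_comp.
Qed.

(** On each interval [|psi x - psi y|] is split at the average of [psi]. By John-Nirenberg the
    hypothesis on [be] holds with [K = J ^ (1 / m) * ka], which makes the bound scale like
    [ka ^ q]. *)
Lemma osc_op_bound : exists C : R, 0 <= C /\ forall psi (ka : R), 0 < ka ->
  Defs.locally_integrable psi -> (forall a c, a < c -> mean_osc psi a c <= ka) ->
  forall f, in_ball f -> (\int[mu]_x (osc_op psi f x `^ q) <= (C * ka `^ q)%:E)%E.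
Proof.
have [m [mp mq]] := exponent.
have m0 : 0 < m%:R :> R by exact: lt_trans q0 mq.
have mn0 : m%:R != 0 :> R by rewrite gt_eqF.
pose J := jn_const m : R.
have J0 : 0 <= J.
  have l0 : 0 <= jn_level m :> R by exact: exprn_ge0.
  by rewrite addr_ge0 ?mulr_ge0 ?exprn_ge0 // addr_ge0.
exists (pos_op_const p q al m * (J `^ m%:R^-1) `^ q); split.
  by rewrite mulr_ge0 ?powR_ge0 // mulr_ge0 ?powR_ge0 // mulr_ge0 ?powR_ge0 // mulrn_wge0 ?powR_ge0.
move=> psi ka ka0 lpsi osc f [mf fp].
have := @pos_op_bound R p q al m p1 pq al0 al1 qE mp mq
  (fun u w x => `|psi x - interval_avg psi u w|) (J `^ m%:R^-1 * ka) _ _ _ _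
  (fun x y => `|psi x - psi y|) _ _ _ (fun y => `|f y|) (measurable_norm mf) (fun x => normr_ge0 _) fp.
rewrite powRM ?powR_ge0 ?(ltW ka0) // mulrA; apply => //.
- by rewrite mulr_ge0 ?powR_ge0 // ltW.
- by move=> u w; apply: measurable_norm; apply: measurable_funB => //; exact: lpsi.1.
- move=> u w uw; rewrite exprMn -(powR_mulrn _ (powR_ge0 J _)) -powRrM mulVf // powRr1 //.
  by have := john_nirenberg lpsi ka0 osc m uw.
- exact: measurable_kap lpsi.1.
- move=> u w x y _ _; rewrite -(subrKA (interval_avg psi u w)).
  by apply: le_trans (ler_normD _ _) _; rewrite lerD2l distrC.
Qed.

(** The Hardy-Littlewood-Sobolev inequality, obtained from the same dyadic bound with [be = 1]. It
    ensures that the fractional integral converges absolutely almost everywhere. *)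
Lemma frac_op_bound : exists C : R, forall f, in_ball f ->
  (\int[mu]_x (frac_op f x `^ q) <= C%:E)%E.
Proof.
have [m [mp mq]] := exponent.
exists (pos_op_const p q al m * 1 `^ q) => f [mf fp].
apply: (@pos_op_bound R p q al m p1 pq al0 al1 qE mp mq (fun _ _ _ => 1) 1) => //.
- move=> u w uw; under eq_integral do rewrite expr1n.
  rewrite expr1n mul1r integral_cst; last exact: measurable_itv.
  by rewrite /= lebesgue_measure_itv /= lte_fin uw -EFinD mul1e.
- by move=> u w x y _ _; rewrite lerDl.
- exact: measurable_norm.
Qed.

Lemma ae_lty (F : R -> \bar R) (c : R) : measurable_fun setT F ->
  (forall x, (0 <= F x)%E) -> (\int[mu]_x (F x `^ q) <= c%:E)%E ->
  {ae mu, forall x, (F x < +oo)%E}.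
Proof.
move=> mF F0 Fc.
have iF : mu.-integrable setT (fun x => F x `^ q)%E.
  apply/integrableP; split; first exact: measurableT_comp (measurable_poweR q) mF.
  apply: le_lt_trans (ltry c); apply: le_trans Fc; rewrite le_eqVlt; apply/orP; left.
  by apply/eqP; apply: eq_integral => x _; rewrite gee0_abs // poweR_ge0.
apply: ae_imply (integrable_ae measurableT iF) => x /(_ I).
by rewrite fin_numE => /andP[_ /eqP h]; rewrite ltey; apply/eqP => /(eqy_poweR q0).
Qed.

Lemma measurable_osc_op psi f : measurable_fun setT psi -> measurable_fun setT f ->
  measurable_fun setT (osc_op psi f).
Proof.
move=> mpsi mf; apply: measurable_pos_op => //; [exact: measurable_kap|exact: measurable_norm].
Qed.

Lemma measurable_frac_op f : measurable_fun setT f -> measurable_fun setT (frac_op f).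
Proof. by move=> mf; apply: measurable_pos_op => //; exact: measurable_norm. Qed.

Definition comm_kernel psi f x y : R :=
  if x < y then (psi x - psi y) * (f y * (y - x) `^ (al - 1)) else 0.

Definition frac_kernel f x y : R := if x < y then f y * (y - x) `^ (al - 1) else 0.

Lemma norm_comm_kernel psi f x y : `|comm_kernel psi f x y| =
  pos_kernel al (fun x y => `|psi x - psi y|) (fun y => `|f y|) x y.
Proof.
rewrite /comm_kernel /pos_kernel; case: ifP; rewrite ?normr0 // => _.
by rewrite !normrM (ger0_norm (powR_ge0 _ _)) [`|f y| * _]mulrC mulrA.
Qed.

Lemma norm_frac_kernel f x y : `|frac_kernel f x y| =
  pos_kernel al (fun _ _ => 1) (fun y => `|f y|) x y.
Proof.
rewrite /frac_kernel /pos_kernel; case: ifP; rewrite ?normr0 // => _.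
by rewrite normrM (ger0_norm (powR_ge0 _ _)) mulrC mul1r.
Qed.

Let measurable_pow : measurable_fun setT (fun z : R * R => (z.2 - z.1) `^ (al - 1)).
Proof.
apply: (measurableT_comp (measurable_powR (al - 1))); exact: measurable_funB.
Qed.

Lemma measurable_frac_kernel f : measurable_fun setT f ->
  measurable_fun setT (fun z : R * R => frac_kernel f z.1 z.2).
Proof.
move=> mf; apply: measurable_fun_ifT => //; first exact: measurable_fun_ltr.
by apply: measurable_funM => //; exact: measurableT_comp mf measurable_snd.
Qed.

Lemma measurable_comm_kernel psi f : measurable_fun setT psi -> measurable_fun setT f ->
  measurable_fun setT (fun z : R * R => comm_kernel psi f z.1 z.2).
Proof.
move=> mpsi mf; apply: measurable_fun_ifT => //; first exact: measurable_fun_ltr.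
apply: measurable_funM.
  by apply: measurable_funB; apply: measurableT_comp.
by apply: measurable_funM => //; exact: measurableT_comp mf measurable_snd.
Qed.

Lemma measurable_section (k : R -> R -> R) x :
  measurable_fun setT (fun z : R * R => k z.1 z.2) -> measurable_fun setT (k x).
Proof. by move=> mk; exact: (measurableT_comp mk (measurable_pair1 x)). Qed.

(** [Rintegral] is [fine] of the difference of the integrals of the positive and negative parts,
    each measurable by Tonelli. Sections may thus fail to be integrable. *)
Lemma measurable_Rintegral_section (k : R -> R -> R) :
  measurable_fun setT (fun z : R * R => k z.1 z.2) ->
  measurable_fun setT (fun x => Rintegral mu setT (k x)).
Proof.
move=> mk.
have mk' : measurable_fun setT (fun z : R * R => (k z.1 z.2)%:E) by exact/measurable_EFinP.
have partial (F : R * R -> \bar R) : measurable_fun setT F -> (forall z, (0 <= F z)%E) ->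
    measurable_fun setT (fun x => \int[mu]_y F (x, y))%E.
  by move=> mF F0; exact: measurable_fun_fubini_tonelli_F.
have mp := partial _ (measurable_funepos mk') (funepos_ge0 _).
have mn := partial _ (measurable_funeneg mk') (funeneg_ge0 _).
have -> : (fun x => Rintegral mu setT (k x)) = fine \o (fun x =>
    \int[mu]_y ((fun z : R * R => (k z.1 z.2)%:E)^\+ (x, y)) -
    \int[mu]_y ((fun z : R * R => (k z.1 z.2)%:E)^\- (x, y)))%E.
  apply/funext => x; rewrite /Rintegral /= integralE; congr fine.
  by congr (_ - _)%E; apply: eq_integral => y _; rewrite ?funeposE ?funenegE.
apply: measurableT_comp; [exact: fine_measurable|exact: emeasurable_funB mp mn].
Qed.

Lemma integrable_kernel (k : R -> R) (S : \bar R) : measurable_fun setT k ->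
  (\int[mu]_y `|k y|%:E = S)%E -> (S < +oo)%E -> mu.-integrable setT (EFin \o k).
Proof.
by move=> mk kS Sy; apply/integrableP; split; [exact/measurable_EFinP|rewrite /= kS].
Qed.

Lemma integrable_comm_kernel psi f x : measurable_fun setT psi -> measurable_fun setT f ->
  (osc_op psi f x < +oo)%E -> mu.-integrable setT (EFin \o comm_kernel psi f x).
Proof.
move=> mpsi mf; apply: integrable_kernel.
  exact: measurable_section (measurable_comm_kernel mpsi mf).
by apply: eq_integral => y _; rewrite norm_comm_kernel.
Qed.

Lemma integrable_frac_kernel f x : measurable_fun setT f ->
  (frac_op f x < +oo)%E -> mu.-integrable setT (EFin \o frac_kernel f x).
Proof.
move=> mf; apply: integrable_kernel.
  exact: measurable_section (measurable_frac_kernel mf).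
by apply: eq_integral => y _; rewrite norm_frac_kernel.
Qed.

Lemma frac_int_plusE f x : frac_int_plus al f x = Rintegral mu setT (frac_kernel f x).
Proof.
rewrite /frac_int_plus Rintegral_mkcond; apply: eq_Rintegral => y _.
by rewrite /patch /frac_kernel mem_setE in_itv /= andbT.
Qed.

Definition comm_op psi f x : R := Rintegral mu setT (comm_kernel psi f x).

(** The kernel of [b * f] is written as [b x * frac_kernel] minus [comm_kernel], both integrable in
    [y] when the two positive operators are finite at [x]; only then does the integral split. *)
Lemma comm_frac_intE b f x : measurable_fun setT b -> measurable_fun setT f ->
  (frac_op f x < +oo)%E -> (osc_op b f x < +oo)%E ->
  comm_frac_int b al f x = comm_op b f x.
Proof.
move=> mb mf hf hb; rewrite /comm_frac_int !frac_int_plusE.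
have i1 := integrable_frac_kernel mf hf.
have i2 := integrable_comm_kernel mb mf hb.
have ib : mu.-integrable setT (EFin \o (fun y => b x * frac_kernel f x y)).
  by have := integrableZl measurableT (b x) i1; apply: eq_integrable => // y _; rewrite -EFinM.
have -> : Rintegral mu setT (frac_kernel (fun y => b y * f y) x) =
    Rintegral mu setT (fun y => b x * frac_kernel f x y - comm_kernel b f x y).
  apply: eq_Rintegral => y _; rewrite /frac_kernel /comm_kernel.
  by case: ifP => _; [ring|rewrite mulr0 subr0].
by rewrite RintegralB // RintegralZl // opprB addrC subrK.
Qed.

(** The commutator is linear in its symbol, and that of [b - phi] is dominated by its positive
    version. The kernel for [phi] is integrable as the difference of those for [b] and [b - phi]. *)
Lemma comm_op_diff b phi f x : measurable_fun setT b -> measurable_fun setT phi ->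
  measurable_fun setT f ->
  (osc_op b f x < +oo)%E -> (osc_op (fun t => b t - phi t)%R f x < +oo)%E ->
  `|comm_op b f x - comm_op phi f x| <= fine (osc_op (fun t => b t - phi t) f x).
Proof.
move=> mb mphi mf hb hpsi; set psi := fun t => b t - phi t.
have mpsi : measurable_fun setT psi by exact: measurable_funB.
have i1 := integrable_comm_kernel mb mf hb.
have i2 := integrable_comm_kernel mpsi mf hpsi.
have -> : comm_op phi f x = comm_op b f x - comm_op psi f x.
  rewrite /comm_op -RintegralB //; apply: eq_Rintegral => y _.
  by rewrite /comm_kernel /psi; case: ifP => _; [ring|rewrite subr0].
rewrite opprB addrC subrK.
apply: le_trans (le_normr_Rintegral measurableT i2) _.
rewrite le_eqVlt; apply/orP; left; apply/eqP; congr fine; apply: eq_integral => y _.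
by rewrite norm_comm_kernel.
Qed.

Lemma integral_fine_poweR (F : R -> \bar R) (c : \bar R) : measurable_fun setT F ->
  (forall x, (0 <= F x)%E) -> (\int[mu]_x (F x `^ q) <= c)%E ->
  (\int[mu]_x (fine (F x) `^ q)%:E <= c)%E.
Proof.
move=> mF F0; apply: le_trans; apply: ge0_le_integral => //.
- by move=> x _; rewrite lee_fin powR_ge0.
- by apply: measurable_EFin_powR; exact: measurableT_comp (fine_measurable measurableT) mF.
- exact: measurableT_comp (measurable_poweR q) mF.
- move=> x _; have := F0 x; case: (F x) => [r _| |//].
    by rewrite poweR_EFin.
  (* Where [F x] is infinite, [fine] returns 0, which can only lower the left side. *)
  by move=> _; rewrite [fine _]/= powR0 ?gt_eqF //; exact: poweR_ge0.
Qed.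

Lemma measurable_comm_frac_int b f : measurable_fun setT b -> measurable_fun setT f ->
  measurable_fun setT (comm_frac_int b al f).
Proof.
move=> mb mf.
have mfr g : measurable_fun setT g -> measurable_fun setT (frac_int_plus al g).
  move=> mg; rewrite (_ : frac_int_plus al g = fun x => Rintegral mu setT (frac_kernel g x)).
    exact: measurable_Rintegral_section (measurable_frac_kernel mg).
  by apply/funext => x; exact: frac_int_plusE.
apply: measurable_funB; last by apply: mfr; exact: measurable_funM.
by apply: measurable_funM => //; exact: mfr.
Qed.

(** The error is measured by [ka], a bound on the oscillation of [b - phi], with [C] the same for
    all symbols. The bound [kb] serves only to make the operators of [b] finite almost everywhere,
    so that its commutator has the kernel form. *)
Lemma comm_diff_bound : exists C : R, 0 <= C /\ forall b phi (kb ka : R),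
  0 < kb -> Defs.locally_integrable b -> (forall a c, a < c -> mean_osc b a c <= kb) ->
  measurable_fun setT phi ->
  0 < ka -> Defs.locally_integrable (fun t => b t - phi t) ->
  (forall a c, a < c -> mean_osc (fun t => b t - phi t) a c <= ka) ->
  forall f g, in_ball f -> in_ball g ->
  (\int[mu]_x (`|comm_frac_int b al f x - comm_frac_int b al g x| `^ q)%:E <=
   (2 `^ q)%:E * (\int[mu]_x (`|comm_op phi f x - comm_op phi g x| `^ q)%:E
                  + (C * ka `^ q)%:E))%E.
Proof.
have [C [C0 hC]] := osc_op_bound.
have [B hB] := frac_op_bound.
exists (2 `^ q * (C *+ 2)); split; first by rewrite mulr_ge0 ?powR_ge0 // mulrn_wge0.
move=> b phi kb ka kb0 lb ob mphi ka0 lpsi opsi f g bf bg.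
set psi := fun t => b t - phi t.
have mb := lb.1; have mpsi := lpsi.1; have mf := bf.1; have mg := bg.1.
have osc0 h k x : (0 <= osc_op h k x)%E by exact: pos_op_ge0.
have fr0 k x : (0 <= frac_op k x)%E by exact: pos_op_ge0.
pose sf x := fine (osc_op psi f x); pose sg x := fine (osc_op psi g x).
have sf0 x : 0 <= sf x by exact: fine_ge0.
have sg0 x : 0 <= sg x by exact: fine_ge0.
have msf : measurable_fun setT sf.
  exact: measurableT_comp (fine_measurable measurableT) (measurable_osc_op mpsi mf).
have msg : measurable_fun setT sg.
  exact: measurableT_comp (fine_measurable measurableT) (measurable_osc_op mpsi mg).
pose d x := `|comm_op phi f x - comm_op phi g x|.
have mcomm h k : measurable_fun setT h -> measurable_fun setT k ->
    measurable_fun setT (comm_op h k).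
  by move=> mh mk; exact: measurable_Rintegral_section (measurable_comm_kernel mh mk).
have md : measurable_fun setT d.
  by apply: measurable_norm; apply: measurable_funB; exact: mcomm.
have msfg : measurable_fun setT (fun x => sf x + sg x) by exact: measurable_funD.
have ae_all k : in_ball k -> {ae mu, forall x, [/\ (frac_op k x < +oo)%E,
    (osc_op b k x < +oo)%E & (osc_op psi k x < +oo)%E]}.
  move=> bk; have mk := bk.1.
  have h1 := ae_lty (measurable_frac_op mk) (fr0 k) (hB _ bk).
  have h2 := ae_lty (measurable_osc_op mb mk) (osc0 b k) (hC _ _ kb0 lb ob _ bk).
  have h3 := ae_lty (measurable_osc_op mpsi mk) (osc0 psi k) (hC _ _ ka0 lpsi opsi _ bk).
  have h12 : {ae mu, forall x, (frac_op k x < +oo)%E /\ (osc_op b k x < +oo)%E}.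
    by apply: ae_imply2 h1 h2.
  by apply: ae_imply2 h12 h3 => x [].
have q0' := ltW q0.
apply: (@le_trans _ _ (\int[mu]_x ((d x + (sf x + sg x)) `^ q)%:E)%E).
  apply: ae_ge0_le_integral.
  - exact: measurableT.
  - by move=> x _; rewrite lee_fin powR_ge0.
  - apply: measurable_EFin_powR; apply: measurable_norm.
    by apply: measurable_funB; exact: measurable_comm_frac_int.
  - by move=> x _; rewrite lee_fin powR_ge0.
  - by apply: measurable_EFin_powR; exact: measurable_funD.
  apply: ae_imply2 (ae_all f bf) (ae_all g bg) => x [f1 f2 f3] [g1 g2 g3] _.
  rewrite lee_fin ge0_ler_powR ?nnegrE ?addr_ge0 ?normr_ge0 //.
  rewrite !comm_frac_intE //.
  have hf := comm_op_diff mb mphi mf f2 f3.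
  have hg := comm_op_diff mb mphi mg g2 g3.
  move: hf hg; rewrite -/psi -/(sf x) -/(sg x) /d !ler_norml => /andP[a1 a2] /andP[a3 a4].
  have := ler_norm (comm_op phi f x - comm_op phi g x).
  have := ler_norm (- (comm_op phi f x - comm_op phi g x)); rewrite normrN.
  by move=> n1 n2; apply/andP; split; lra.
have d0 x : 0 <= d x by exact: normr_ge0.
have sfg0 x : 0 <= sf x + sg x by rewrite addr_ge0.
apply: le_trans (integral_powR_add q0' md msfg d0 sfg0) _.
rewrite lee_wpmul2l ?lee_fin ?powR_ge0 // leeD2l //.
apply: le_trans (integral_powR_add q0' msf msg sf0 sg0) _.
rewrite -mulrA EFinM lee_wpmul2l ?lee_fin ?powR_ge0 // mulr2n mulrDl EFinD leeD //.
  exact: integral_fine_poweR (measurable_osc_op mpsi mf) (osc0 psi f) (hC _ _ ka0 lpsi opsi _ bf).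
exact: integral_fine_poweR (measurable_osc_op mpsi mg) (osc0 psi g) (hC _ _ ka0 lpsi opsi _ bg).
Qed.

End Commutator.

(** * Compactness for smooth symbols *)

Section SmoothBump.
Context {R : realType}.
Implicit Types (x y : R).

Lemma clamp_lip (M x y : R) :
  `|Num.max (- M) (Num.min x M) - Num.max (- M) (Num.min y M)| <= `|x - y|.
Proof.
wlog xy : x y / x <= y.
  move=> h; have [xy|/ltW yx] := leP x y; first exact: h.
  by rewrite distrC (distrC x); exact: h.
rewrite (distrC x) (ger0_norm (_ : 0 <= y - x)) ?subr_ge0 //.
rewrite distrC ger0_norm; last first.
  by rewrite subr_ge0 ge_max !le_max lexx /= le_min !ge_min xy lexx !orbT.
have a1 : Num.min y M <= y by rewrite ge_min lexx.
have a2 : Num.min y M <= M by rewrite ge_min lexx orbT.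
have a3 : - M <= Num.max (- M) (Num.min x M) by rewrite le_max lexx.
have a4 : Num.min x M <= Num.max (- M) (Num.min x M) by rewrite le_max lexx orbT.
have a5 : Num.min y M - (y - x) <= Num.min x M.
  by rewrite le_min; apply/andP; split; lra.
rewrite lerBlDr ge_max; apply/andP; split; lra.
Qed.

(** As [phi] vanishes at and beyond [M] and [- M], it is unchanged by first clamping its argument to
    [[- M, M]]. There the mean value theorem applies, with the maximum of the derivative. *)
Lemma smooth_compact_lip (phi : R -> R) : smooth phi -> compact_support phi ->
  exists A M : R, [/\ 0 <= A, 0 <= M,
    forall x y, `|phi x - phi y| <= A * Num.min 1 `|x - y| &
    forall x, M < `|x| -> phi x = 0].
Proof.
move=> sphi [M0 hM0]; pose M := `|M0| + 1.
have M00 : 0 <= `|M0| := normr_ge0 M0.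
have M0M : M0 < M by rewrite /M; have := ler_norm M0; lra.
have hM x : M <= `|x| -> phi x = 0 by move=> Mx; apply: hM0; exact: lt_le_trans Mx.
have d0 x : derivable phi x 1 by have := sphi 0%N x; rewrite derive1n0.
have d1 x : derivable (derive1 phi) x 1.
  by have := sphi 1%N x; rewrite derive1nS derive1n0.
have c1 : continuous (fun x => `|(derive1 phi) x|).
  move=> x; apply: continuous_comp; last exact: norm_continuous.
  by apply: differentiable_continuous; apply/derivable1_diffP.
have MM : - M <= M by rewrite /M; lra.
have [c _ hc] := EVT_max MM (continuous_subspaceT c1).
pose L := `|(derive1 phi) c|.
have L0 : 0 <= L by exact: normr_ge0.
have lip x y : - M <= x <= M -> - M <= y <= M -> `|phi x - phi y| <= L * `|x - y|.
  wlog xy : x y / x <= y.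
    move=> h; have [xy|/ltW yx] := leP x y; first exact: h.
    by move=> hx hy; rewrite distrC (distrC x); exact: h.
  move=> /andP[x1 x2] /andP[y1 y2].
  have drv t : t \in `]x, y[ -> is_derive t (1 : R) phi (derive1 phi t).
    by move=> _; rewrite derive1E; exact/derivableP.
  have cphi : {within `[x, y], continuous phi}.
    apply: continuous_subspaceT => t.
    by apply: differentiable_continuous; apply/derivable1_diffP.
  have [t + e] := MVT_segment xy drv cphi.
  rewrite in_itv /= => /andP[xt ty].
  rewrite distrC e normrM (distrC x) ler_wpM2r //.
  by apply: hc; rewrite in_itv /= (le_trans x1 xt) (le_trans ty y2).
pose cl x := Num.max (- M) (Num.min x M).
have clM x : - M <= cl x <= M.
  by rewrite /cl le_max lexx /= ge_max MM ge_min lexx orbT.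
have phicl x : phi x = phi (cl x).
  have [xM|Mx] := leP `|x| M.
    by move: xM; rewrite ler_norml => /andP[x1 x2]; rewrite /cl (min_idPl x2) (max_idPr x1).
  rewrite !hM ?(ltW Mx) //; rewrite /cl; move: Mx; rewrite lter_normr => /orP[xM|xM].
    by rewrite (min_idPr (ltW xM)) (max_idPr MM) ger0_norm // /M; lra.
  have xM' : x <= - M by lra.
  have xMM : x <= M by lra.
  by rewrite (min_idPl xMM) (max_idPl xM') normrN ger0_norm // /M; lra.
(* Clamped points are at most [2 * M] apart, which covers distances of at least 1; for smaller
   distances [1 <= 2 * M] suffices. *)
exists (L * (2 * M)), M; split.
- by rewrite mulr_ge0 // /M; lra.
- by rewrite /M; lra.
- move=> x y; rewrite phicl (phicl y).
  apply: le_trans (lip _ _ (clM x) (clM y)) _; rewrite -mulrA ler_wpM2l //.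
  have h1 := clamp_lip M x y.
  have h2 : `|cl x - cl y| <= 2 * M.
    have /andP[a1 a2] := clM x; have /andP[a3 a4] := clM y.
    by rewrite ler_norml; apply/andP; split; lra.
  rewrite -/(cl x) -/(cl y) in h1.
  have [xy|xy] := leP 1 `|x - y|; first by rewrite mulr1.
  apply: le_trans h1 _; rewrite ler_peMl //; rewrite /M; lra.
- by move=> x Mx; exact/hM/ltW.
Qed.

End SmoothBump.

(** * The kernel of a smooth symbol *)

Section BumpKernel.
Context {R : realType}.
Local Notation mu := (@lebesgue_measure R).
Implicit Types (x y t : R).
Variables (al A M : R) (phi : R -> R).
Hypotheses (al0 : 0 < al) (al1 : al < 1) (A0 : 0 <= A) (M0 : 0 <= M).
Hypothesis phi_lip : forall x y, `|phi x - phi y| <= A * Num.min 1 `|x - y|.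
Hypothesis phi_supp : forall x, M < `|x| -> phi x = 0.

Lemma lip_continuous : continuous phi.
Proof.
move=> x; apply/cvgrPdist_lt => e e0.
have A1 : 0 < A + 1 by rewrite ltr_wpDl.
have eA : 0 < e / (A + 1) by rewrite divr_gt0.
near=> t; have h : `|x - t| < e / (A + 1).
  by near: t; exact: (@cvgr_dist_lt _ _ _ _ _ id x).
apply: le_lt_trans (phi_lip x t) _.
have h1 : A * Num.min 1 `|x - t| <= A * `|x - t|.
  by rewrite ler_wpM2l // ge_min lexx orbT.
apply: le_lt_trans h1 _; rewrite ltr_pdivlMr // in h.
apply: le_lt_trans h; rewrite mulrC ler_wpM2l //; lra.
Unshelve. all: by end_near. Qed.

Lemma measurable_lip : measurable_fun setT phi.
Proof. exact: continuous_measurable_fun lip_continuous. Qed.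

Definition bump_kernel x y : R := if x < y then (phi x - phi y) * (y - x) `^ (al - 1) else 0.

Definition weight t : R := (1 + `|t|) `^ (al - 1).
Definition cutoff t : R := if `|t| <= M then 1 else 0.

Lemma weight_ge0 t : 0 <= weight t. Proof. exact: powR_ge0. Qed.
Lemma cutoff_ge0 t : 0 <= cutoff t. Proof. by rewrite /cutoff; case: ifP. Qed.

Let powR_anti (a b : R) : 0 < a -> a <= b -> b `^ (al - 1) <= a `^ (al - 1).
Proof.
move=> a0 ab; have b0 : 0 < b by exact: lt_le_trans ab.
have -> : al - 1 = - (1 - al) by lra.
rewrite !powRN lef_pV2 ?posrE ?powR_gt0 //.
by rewrite ge0_ler_powR ?nnegrE ?(ltW a0) ?(ltW b0) // subr_ge0 ltW.
Qed.

Lemma weight_le1 t : weight t <= 1.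
Proof.
by have := @powR_anti 1 (1 + `|t|) ltr01; rewrite lerDl powR1; apply.
Qed.

Lemma measurable_weight : measurable_fun setT weight.
Proof.
apply: (measurableT_comp (measurable_powR (al - 1))).
by apply: measurable_funD => //; apply: measurableT_comp.
Qed.

Definition bump_const : R := A * (2 `^ (1 - al) * (1 + M) `^ (1 - al)).

Lemma bump_const_ge0 : 0 <= bump_const.
Proof. by rewrite !mulr_ge0 ?powR_ge0. Qed.

(** With [t = y - x], [min 1 t * t ^ (al - 1)] is at most a multiple of [(1 + t) ^ (al - 1)]. One of
    the points lies in [[- M, M]] unless the kernel vanishes, and the other one, [z], then satisfies
    [1 + |z| <= (1 + M) * (1 + t)]. *)
Lemma bump_kernel_le x y : `|bump_kernel x y| <=
  bump_const * (cutoff x * weight y + weight x * cutoff y).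
Proof.
have W0 : 0 <= cutoff x * weight y + weight x * cutoff y.
  by rewrite addr_ge0 ?mulr_ge0 ?cutoff_ge0 ?weight_ge0.
rewrite /bump_kernel; case: ifPn => [xy|_]; last first.
  by rewrite normr0 mulr_ge0 ?bump_const_ge0.
have t0 : 0 < y - x by rewrite subr_gt0.
rewrite normrM (ger0_norm (powR_ge0 _ _)).
have key : `|phi x - phi y| * (y - x) `^ (al - 1) <=
    A * (2 `^ (1 - al) * (1 + (y - x)) `^ (al - 1)).
  apply: (@le_trans _ _ (A * (Num.min 1 (y - x) * (y - x) `^ (al - 1)))).
    rewrite mulrA ler_wpM2r ?powR_ge0 //.
    by have := phi_lip x y; rewrite distrC (distrC x) (ger0_norm (ltW t0)) distrC.
  rewrite ler_wpM2l //.
  have -> : 2 `^ (1 - al) * (1 + (y - x)) `^ (al - 1) = ((1 + (y - x)) / 2) `^ (al - 1).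
    have h1 : 0 <= 1 + (y - x) by rewrite addr_ge0 // ltW.
    have h2 : 0 <= 2^-1 :> R by rewrite invr_ge0.
    rewrite (powRM _ h1 h2) mulrC; congr (_ * _).
    by rewrite -(powR_inv1 (ltW (ltr0Sn R 1))) -powRrM; congr (_ `^ _); lra.
  have [t1|t1] := leP 1 (y - x).
    by rewrite mul1r; apply: powR_anti; lra.
  apply: (@le_trans _ _ 1).
    rewrite mulr_powRB1 ?(ltW t0) //.
    by have := ge0_ler_powR (ltW al0) (ltW t0) ler01 (ltW t1); rewrite powR1.
  by have := @powR_anti ((1 + (y - x)) / 2) 1; rewrite powR1; apply; lra.
have comp (u w : R) : `|u| <= M -> `|w| <= `|u| + (y - x) ->
    (1 + (y - x)) `^ (al - 1) <= (1 + M) `^ (1 - al) * weight w.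
  move=> uM wu.
  have M1 : 0 < 1 + M by rewrite ltr_pwDl.
  rewrite -ler_pdivrMl ?powR_gt0 // -powRN.
  have -> : - (1 - al) = al - 1 by lra.
  have h1 : 0 <= 1 + (y - x) by rewrite addr_ge0 // ltW.
  rewrite -(powRM _ (ltW M1) h1).
  apply: powR_anti; first by rewrite ltr_pwDl.
  have : 0 <= M * (y - x) by rewrite mulr_ge0 // ltW.
  by move=> h; lra.
have n1 := ler_norm x; have n2 := ler_norm (- x); rewrite normrN in n2.
have n3 := ler_norm y; have n4 := ler_norm (- y); rewrite normrN in n4.
have yx : `|y| <= `|x| + (y - x) by rewrite ler_norml; apply/andP; split; lra.
have xy' : `|x| <= `|y| + (y - x) by rewrite ler_norml; apply/andP; split; lra.
have [xM|Mx] := leP `|x| M.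
  apply: le_trans key _; rewrite /bump_const -!mulrA ler_wpM2l // ler_wpM2l ?powR_ge0 //.
  apply: le_trans (comp x y xM yx) _; rewrite ler_wpM2l ?powR_ge0 //.
  by rewrite {1}/cutoff xM mul1r lerDl mulr_ge0 ?cutoff_ge0 ?weight_ge0.
have [yM|My] := leP `|y| M.
  apply: le_trans key _; rewrite /bump_const -!mulrA ler_wpM2l // ler_wpM2l ?powR_ge0 //.
  apply: le_trans (comp y x yM xy') _; rewrite ler_wpM2l ?powR_ge0 //.
  by rewrite {2}/cutoff yM mulr1 lerDr mulr_ge0 ?cutoff_ge0 ?weight_ge0.
by rewrite !phi_supp // subrr normr0 mul0r mulr_ge0 ?bump_const_ge0.
Qed.

Lemma measurable_bump_kernel x : measurable_fun setT (bump_kernel x).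
Proof.
apply: measurable_fun_ifT => //; first exact: measurable_fun_ltr.
apply: measurable_funM.
  by apply: measurable_funB => //; exact: measurable_lip.
by apply: (measurableT_comp (measurable_powR (al - 1))); exact: measurable_funB.
Qed.

(* At [t = y] the singularity [(y - t) ^ (al - 1)] is absorbed by the Lipschitz
   bound on [phi]. *)
Lemma bump_kernel_cvg (s : nat -> R) x y : s n @[n --> \oo] --> x ->
  bump_kernel (s n) y @[n --> \oo] --> bump_kernel x y.
Proof.
move=> sx; rewrite /bump_kernel.
have [xy|yx|xy] := ltgtP x y.
- have e : \forall n \near \oo, (phi (s n) - phi y) * (y - s n) `^ (al - 1) =
      (if s n < y then (phi (s n) - phi y) * (y - s n) `^ (al - 1) else 0).
    by near=> n; rewrite ifT //; near: n; apply: (cvgr_lt _ sx).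
  apply: cvg_trans (near_eq_cvg e) _.
  apply: cvgM.
    by apply: cvgB; [apply: continuous_cvg sx; exact: lip_continuous|exact: cvg_cst].
  apply: (@continuous_cvg _ _ _ _ _ _ (fun t => t `^ (al - 1))).
    by apply: powR_continuous_at; rewrite subr_gt0.
  by apply: cvgB => //; exact: cvg_cst.
- apply: cvg_near_cst; near=> n; rewrite ltNge (ltW _) //.
  by near: n; apply: (cvgr_gt _ sx).
subst y; apply/cvgrPdist_le => e e0.
have h := @cvg_powR0 R al (fun n => `|x - s n|) al0 (fun n => normr_ge0 _).
have /cvgrPdist_lt h1 : `|x - s n| `^ al @[n --> \oo] --> 0.
  apply: h; rewrite -(normr0 R); apply: cvg_norm; rewrite -(subrr x).
  by apply: cvgB => //; exact: cvg_cst.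
have A1 : 0 < A + 1 by rewrite ltr_wpDl.
have eA : 0 < e / (A + 1) by rewrite divr_gt0.
near=> n; rewrite sub0r normrN; case: ifPn => sn; last by rewrite normr0 ltW.
have t0 : 0 < x - s n by rewrite subr_gt0.
rewrite normrM (ger0_norm (powR_ge0 _ _)).
have hl : `|phi (s n) - phi x| <= A * (x - s n).
  apply: le_trans (phi_lip _ _) _; rewrite ler_wpM2l //.
  by rewrite distrC (ger0_norm (ltW t0)) ge_min lexx orbT.
apply: le_trans (ler_wpM2r (powR_ge0 _ _) hl) _.
rewrite -mulrA mulr_powRB1 ?(ltW t0) //.
have h2 : (x - s n) `^ al < e / (A + 1).
  have : `|0 - `|x - s n| `^ al| < e / (A + 1) by near: n; exact: h1.
  by rewrite sub0r normrN (ger0_norm (ltW t0)) ger0_norm // powR_ge0.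
rewrite ltr_pdivlMr // in h2; apply: le_trans (ltW h2).
by rewrite mulrC ler_wpM2l ?powR_ge0 //; lra.
Unshelve. all: by end_near. Qed.

End BumpKernel.

Section BumpOperator.
Context {R : realType}.
Local Notation mu := (@lebesgue_measure R).
Implicit Types (x y t : R).

Lemma cauchy_cvgn (u : nat -> R) :
  (forall e : R, 0 < e -> exists N : nat, forall n k, (N <= n)%N -> (N <= k)%N ->
    `|u n - u k| <= e) -> cvgn u.
Proof.
move=> hu; apply/cauchy_cvgP/cauchy_exP => e e0.
have [N hN] := hu (e / 2) (divr_gt0 e0 (ltr0Sn R 1)).
exists (u N); exists N => // n /= Nn; rewrite /ball /=.
by apply: le_lt_trans (hN N n (leqnn N) Nn) _; lra.
Qed.

Lemma dist_le_four_point (z1 z2 z3 z4 l d : R) :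
  `|z3 - z1| <= d / 3 -> `|z4 - z2| <= d / 3 -> `|l - z3| <= d / 6 -> `|l - z4| <= d / 6 ->
  `|z1 - z2| <= d.
Proof.
rewrite !ler_norml => /andP[? ?] /andP[? ?] /andP[? ?] /andP[? ?].
by apply/andP; split; lra.
Qed.

Variables (p q al A M : R) (phi : R -> R).
Hypotheses (p1 : 1 < p) (pq : p < q) (al0 : 0 < al) (al1 : al < 1).
Hypothesis (qE : q^-1 = p^-1 - al).
Hypotheses (A0 : 0 <= A) (M0 : 0 <= M).
Hypothesis phi_lip : forall x y, `|phi x - phi y| <= A * Num.min 1 `|x - y|.
Hypothesis phi_supp : forall x, M < `|x| -> phi x = 0.

Let p' := p / (p - 1).
Let p0 : 0 < p. Proof. exact: lt_trans ltr01 p1. Qed.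
Let q0 : 0 < q. Proof. exact: lt_trans p0 pq. Qed.
Let p'0 : 0 < p'. Proof. by rewrite divr_gt0 // subr_gt0. Qed.
Let pE : p'^-1 + p^-1 = 1.
Proof. by rewrite /p'; field; rewrite !gt_eqF // subr_gt0. Qed.

Let w : R -> R := weight al.
Let w0 t : 0 <= w t. Proof. exact: weight_ge0. Qed.
Let mw : measurable_fun setT w. Proof. exact: measurable_weight. Qed.

Let bk : R -> R -> R := bump_kernel al phi.
Let mbk x : measurable_fun setT (bk x).
Proof. exact: measurable_bump_kernel A0 phi_lip x. Qed.

Let c2 : R := bump_const al A M * (2 * (1 + M) `^ (1 - al)).

Let c20 : 0 <= c2.
Proof. by rewrite !mulr_ge0 ?powR_ge0 // bump_const_ge0. Qed.

Let bk_le x y : `|bk x y| <= c2 * (w x * w y).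
Proof.
apply: le_trans (bump_kernel_le al0 al1 A0 M0 phi_lip phi_supp x y) _.
rewrite /c2 -mulrA ler_wpM2l ?bump_const_ge0 //.
have cut t : cutoff M t <= (1 + M) `^ (1 - al) * w t.
  rewrite /cutoff; case: ifPn => [tM|_]; last by rewrite mulr_ge0 ?powR_ge0.
  have M1 : 0 < 1 + M by rewrite ltr_pwDl.
  have t1 : 0 < 1 + `|t| by rewrite ltr_pwDl.
  rewrite /w /weight (_ : al - 1 = - (1 - al)); last by rewrite opprB.
  rewrite powRN ler_pdivlMr ?powR_gt0 // mul1r.
  by rewrite ge0_ler_powR ?nnegrE ?(ltW M1) ?(ltW t1) ?subr_ge0 ?(ltW al1) // lerD2l.
have h1 := ler_wpM2r (w0 y) (cut x); have h2 := ler_wpM2l (w0 x) (cut y).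
apply: le_trans (lerD h1 h2) _; rewrite le_eqVlt; apply/orP; left; apply/eqP.
by ring.
Qed.

(** The condition says that [(1 - al) * r] exceeds 1. For [p'] it amounts to [al < 1 / p], that is
    [0 < 1 / q]; for [q] it amounts to [1 / p < 1]. *)
Let weight_power_lty r : 0 < r -> r^-1 < 1 - al -> (\int[mu]_x (w x `^ r)%:E < +oo)%E.
Proof.
move=> r0 r1.
have h : 1 < (1 - al) * r by rewrite -ltr_pdivrMr // div1r.
apply: le_lt_trans (integral_weight_lty h); rewrite le_eqVlt; apply/orP; left.
apply/eqP; apply: eq_integral => x _; congr EFin.
by rewrite /w /weight -powRrM; congr (_ `^ _); lra.
Qed.

Let wp' : (\int[mu]_x (w x `^ p')%:E < +oo)%E.
Proof.
apply: weight_power_lty => //.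
have : 0 < q^-1 by rewrite invr_gt0.
by rewrite qE => h; move: pE; lra.
Qed.

Let wq : (\int[mu]_x (w x `^ q)%:E < +oo)%E.
Proof.
apply: weight_power_lty => //.
have : p^-1 < 1 by rewrite invf_lt1.
by rewrite qE; lra.
Qed.

Let np' : R := fine (\int[mu]_x (w x `^ p')%:E)%E `^ p'^-1.

Let wp'_bound (c : R) : 0 <= c ->
  (\int[mu]_x ((c * w x) `^ p')%:E <= ((c * np') `^ p')%:E)%E.
Proof.
move=> c0.
have I0 : (0 <= \int[mu]_x (w x `^ p')%:E)%E.
  by apply: integral_ge0 => x _; rewrite lee_fin powR_ge0.
have e x : ((c * w x) `^ p')%:E = ((c `^ p')%:E * (w x `^ p')%:E)%E.
  by rewrite -EFinM powRM.
under eq_integral do rewrite e.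
rewrite ge0_integralZl_EFin ?powR_ge0 //=; last 2 first.
- by move=> x _; rewrite lee_fin powR_ge0.
- exact: measurable_EFin_powR mw.
rewrite powRM ?powR_ge0 // EFinM lee_wpmul2l ?lee_fin ?powR_ge0 //.
by rewrite /np' -powRrM mulVf ?gt_eqF // powRr1 ?fine_ge0 // fineK // ge0_fin_numE.
Qed.

Let np'0 : 0 <= np'. Proof. exact: powR_ge0. Qed.

Let c2w x : 0 <= c2 * w x * np'.
Proof. by apply: mulr_ge0 (mulr_ge0 c20 _) _. Qed.

Let D x := c2 * np' * w x.

Let D0 x : 0 <= D x.
Proof. by apply: mulr_ge0 (mulr_ge0 c20 _) _. Qed.

Let hoelder_pair (k f : R -> R) (e : R) : measurable_fun setT k -> in_ball p f -> 0 <= e ->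
  (\int[mu]_y (`|k y| `^ p')%:E <= (e `^ p')%:E)%E ->
  mu.-integrable setT (EFin \o (fun y => k y * f y)) /\
  `|Rintegral mu setT (fun y => k y * f y)| <= e.
Proof.
move=> mk [mf fp] e0 hk.
have mkf : measurable_fun setT (fun y => k y * f y) by exact: measurable_funM.
have h : (\int[mu]_y (`|k y * f y|)%:E <= e%:E)%E.
  under eq_integral do rewrite normrM.
  rewrite -[e]mulr1; apply: (@hoelder_bound _ _ R mu setT _ _ p' p) => //.
  - exact: measurableT_comp.
  - exact: measurableT_comp.
  - by rewrite powR1.
have ikf : mu.-integrable setT (EFin \o (fun y => k y * f y)).
  apply/integrableP; split; first exact/measurable_EFinP.
  exact: le_lt_trans h (ltry _).
split=> //; apply: le_trans (le_normr_Rintegral measurableT ikf) _.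
by apply: ge0_Rintegral_bound h => //; exact: measurableT_comp.
Qed.

Let bk_p' x : (\int[mu]_y (`|bk x y| `^ p')%:E <= ((c2 * w x * np') `^ p')%:E)%E.
Proof.
apply: le_trans (wp'_bound _); last by rewrite mulr_ge0.
apply: ge0_le_integral.
- exact: measurableT.
- by move=> y _; rewrite lee_fin powR_ge0.
- by apply: measurable_EFin_powR; exact: measurableT_comp (mbk x).
- by apply: (@measurable_EFin_powR _ _ _ _ (fun y => c2 * w x * w y)); exact: measurable_funM.
- move=> y _; rewrite lee_fin; apply: ge0_ler_powR.
  + exact: ltW p'0.
  + by rewrite nnegrE.
  + by rewrite nnegrE; apply: mulr_ge0 (mulr_ge0 c20 _) _.
  + by rewrite -mulrA; exact: bk_le.
Qed.

Let T f x := comm_op al phi f x.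

Let TE f x : T f x = Rintegral mu setT (fun y => bk x y * f y).
Proof.
apply: eq_Rintegral => y _; rewrite /comm_kernel /bk /bump_kernel.
by case: ifP => _; [ring|rewrite mul0r].
Qed.

Lemma bump_op_le f x : in_ball p f -> `|comm_op al phi f x| <= c2 * np' * w x.
Proof.
move=> bf; rewrite -/(T f x) TE.
have [_] := hoelder_pair (mbk x) bf (c2w x) (bk_p' x).
by rewrite -!mulrA [np' * _]mulrC.
Qed.

Let T_diff f x x' (e : R) : in_ball p f -> 0 <= e ->
  (\int[mu]_y (`|bk x y - bk x' y| `^ p')%:E <= (e `^ p')%:E)%E ->
  `|T f x - T f x'| <= e.
Proof.
move=> bf e0 he.
have [i1 _] := hoelder_pair (mbk x) bf (c2w x) (bk_p' x).
have [i2 _] := hoelder_pair (mbk x') bf (c2w x') (bk_p' x').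
rewrite !TE -RintegralB //.
have -> : Rintegral mu setT (fun y => bk x y * f y - bk x' y * f y) =
   Rintegral mu setT (fun y => (bk x y - bk x' y) * f y).
  by apply: eq_Rintegral => y _; rewrite mulrBl.
by have [] := hoelder_pair (measurable_funB (mbk x) (mbk x')) bf e0 he.
Qed.

(** Dominated convergence: since the weight is at most 1 in the first variable, [2 * c2 * w y]
    bounds all the differences at once, and it lies in [L^p']. *)
Let bk_continuous (s : nat -> R) x : s n @[n --> \oo] --> x ->
  (\int[mu]_y (`|bk (s n) y - bk x y| `^ p')%:E @[n --> \oo] --> 0)%E.
Proof.
move=> sx.
have mB n : measurable_fun setT (fun y => `|bk (s n) y - bk x y|).
  by apply: measurableT_comp => //; exact: measurable_funB.
pose g y := (2 * c2 * w y) `^ p'.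
have mg : measurable_fun setT g.
  by apply: (measurableT_comp (measurable_powR p')); exact: measurable_funM.
have ig : mu.-integrable setT (EFin \o g).
  apply: (@ge0_integrable_bound _ _ _ ((2 * c2 * np') `^ p')) => //.
    by move=> y _; exact: powR_ge0.
  by apply: wp'_bound; rewrite mulr_ge0.
have := @dominated_cvg _ _ R mu setT measurableT
  (fun n y => (`|bk (s n) y - bk x y| `^ p')%:E) (cst 0%E) (EFin \o g) _ _ _ ig _.
rewrite integral_cst // mul0e; apply.
- by move=> n; exact: measurable_EFin_powR (mB n).
- move=> y _; apply: cvg_EFin; first exact: nearW.
  apply: cvg_powR0 => //; rewrite -(normr0 R); apply: cvg_norm.
  rewrite -(subrr (bk x y)); apply: cvgB; last exact: cvg_cst.
  exact: (bump_kernel_cvg al0 A0 phi_lip).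
- by [].
- move=> n y _; rewrite gee0_abs; last by rewrite lee_fin powR_ge0.
  have h0 : 0 <= 2 * c2 * w y by apply: mulr_ge0 (mulr_ge0 _ c20) _.
  rewrite lee_fin; apply: ge0_ler_powR; rewrite ?nnegrE ?(ltW p'0) //.
  apply: le_trans (ler_normB _ _) _.
  have b u : `|bk u y| <= c2 * w y.
    apply: le_trans (bk_le u y) _; rewrite ler_wpM2l // ler_piMl //.
    exact: weight_le1.
  by rewrite -mulrA mulr_natl mulr2n lerD.
Qed.

(** By Hoelder the variation of [T f] is at most the [L^p'] distance of two sections of the kernel,
    in which [f] no longer occurs; hence one index serves the whole ball. *)
Let T_equicontinuous (s : nat -> R) x (e : R) : s n @[n --> \oo] --> x -> 0 < e ->
  exists n, forall f, in_ball p f -> `|T f (s n) - T f x| <= e.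
Proof.
move=> /bk_continuous /fine_cvgP[hf /cvgrPdist_le h] e0.
have e1 : 0 < e `^ p' by exact: powR_gt0.
have [n [h1 h2]] : exists n, (\int[mu]_y (`|bk (s n) y - bk x y| `^ p')%:E)%E \is a fin_num /\
   `|0 - fine (\int[mu]_y (`|bk (s n) y - bk x y| `^ p')%:E)%E| <= e `^ p'.
  by have [n _ hn] := filterI hf (h _ e1); exists n; apply: hn => /=.
exists n => f bf; apply: T_diff => //; first exact: ltW.
rewrite sub0r normrN in h2; rewrite -(fineK h1) lee_fin.
exact: le_trans (ler_norm _) h2.
Qed.

Let measurable_T f : in_ball p f -> measurable_fun setT (T f).
Proof.
move=> bf; apply: measurable_Rintegral_section; apply: measurable_comm_kernel.
  exact: measurable_lip A0 phi_lip.
exact: bf.1.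
Qed.

Lemma bump_op_compact (f_ : nat -> R -> R) (pts : nat -> R) :
  (forall n, in_ball p (f_ n)) ->
  (forall x, exists s : nat -> nat, pts (s n) @[n --> \oo] --> x) ->
  (forall i, cvgn (fun n => comm_op al phi (f_ n) (pts i))) ->
  forall e : R, 0 < e -> exists N : nat, forall n k, (N <= n)%N -> (N <= k)%N ->
    (\int[mu]_x (`|comm_op al phi (f_ n) x - comm_op al phi (f_ k) x| `^ q)%:E <= e%:E)%E.
Proof.
move=> bf dpts cpts e e0.
have cT x : cvgn (fun n => T (f_ n) x).
  apply: cauchy_cvgn => d d0.
  have d3 : 0 < d / 3 by rewrite divr_gt0.
  have [s sx] := dpts x.
  have [j hj] := T_equicontinuous sx d3.
  have /cvgrPdist_le/(_ (d / 6)) := cpts (s j).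
  rewrite divr_gt0 // => /(_ isT)[N _ hN].
  exists N => n k nN kN.
  have a1 := hj _ (bf n); have a2 := hj _ (bf k).
  have a3 := hN n nN; have a4 := hN k kN.
  exact: dist_le_four_point a1 a2 a3 a4.
pose G x := limn (fun n => T (f_ n) x).
have TG x : T (f_ n) x @[n --> \oo] --> G x by exact: cT.
have mT n := measurable_T (bf n).
have mG : measurable_fun setT G.
  by apply: (measurable_fun_cvg (h := fun n => T (f_ n))) => // x _; exact: TG.
have mD : measurable_fun setT D by exact: measurable_funM.
have TD n x : `|T (f_ n) x| <= D x by exact: bump_op_le (bf n).
have GD x : `|G x| <= D x.
  have h : `|T (f_ n) x| @[n --> \oo] --> `|G x| by apply: cvg_norm.
  rewrite -(cvg_lim (@Rhausdorff R) h); apply: limr_le; first by apply/cvg_ex; exists `|G x|.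
  exact: nearW.
have iD : mu.-integrable setT (EFin \o (fun x => (2 * D x) `^ q)).
  apply/integrableP; split.
    by apply: measurable_EFin_powR; exact: measurable_funM.
  have e1 x : `|(EFin \o (fun x => (2 * D x) `^ q)%R) x|%E =
      (((2 * (c2 * np')) `^ q)%:E * (w x `^ q)%:E)%E.
    rewrite /= ger0_norm ?powR_ge0 // -EFinM -powRM //; first by rewrite /D !mulrA.
    by apply: mulr_ge0 => //; exact: mulr_ge0.
  under eq_integral do rewrite e1.
  rewrite ge0_integralZl_EFin ?powR_ge0 //=; last 2 first.
  - by move=> x _; rewrite lee_fin powR_ge0.
  - exact: measurable_EFin_powR mw.
  by rewrite lte_mul_pinfty ?lee_fin ?powR_ge0.
have mTG n : measurable_fun setT (fun x => `|T (f_ n) x - G x|).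
  by apply: measurableT_comp => //; exact: measurable_funB.
have dct : (\int[mu]_x (`|T (f_ n) x - G x| `^ q)%:E @[n --> \oo] --> 0)%E.
  have := @dominated_cvg _ _ R mu setT measurableT
    (fun n x => (`|T (f_ n) x - G x| `^ q)%:E) (cst 0%E) _ _ _ _ iD _.
  rewrite integral_cst // mul0e; apply.
  - by move=> n; exact: measurable_EFin_powR (mTG n).
  - move=> x _; apply: cvg_EFin; first exact: nearW.
    apply: cvg_powR0 => //; rewrite -(normr0 R); apply: cvg_norm.
    by rewrite -(subrr (G x)); apply: cvgB; [exact: TG|exact: cvg_cst].
  - by [].
  - move=> n x _; rewrite gee0_abs; last by rewrite lee_fin powR_ge0.
    have h0 : 0 <= 2 * D x by apply: mulr_ge0.
    rewrite lee_fin; apply: ge0_ler_powR; rewrite ?nnegrE ?(ltW q0) //.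
    apply: le_trans (ler_normB _ _) _.
    by rewrite mulr_natl mulr2n lerD.
(* Going through the limit [G] costs the factor [2 ^ q] and two such errors. *)
have c0 : 0 < e / (2 `^ q * 2) by rewrite divr_gt0 // mulr_gt0 ?powR_gt0.
move: dct => /fine_cvgP[hf /cvgrPdist_le/(_ _ c0) h].
have [N _ hN] := filterI hf h.
have key n : (N <= n)%N ->
    (\int[mu]_x (`|T (f_ n) x - G x| `^ q)%:E <= (e / (2 `^ q * 2))%:E)%E.
  move=> /hN[/= h1]; rewrite sub0r normrN => h2.
  by rewrite -(fineK h1) lee_fin; exact: le_trans (ler_norm _) h2.
exists N => n k nN kN.
apply: (@le_trans _ _ (\int[mu]_x ((`|T (f_ n) x - G x| + `|T (f_ k) x - G x|) `^ q)%:E)%E).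
  apply: ge0_le_integral.
  - exact: measurableT.
  - by move=> x _; rewrite lee_fin powR_ge0.
  - apply: measurable_EFin_powR; apply: measurableT_comp => //.
    by apply: measurable_funB; [exact: mT|exact: mT].
  - apply: (@measurable_EFin_powR _ _ _ _ (fun x => `|T (f_ n) x - G x| + `|T (f_ k) x - G x|)).
    exact: measurable_funD.
  - move=> x _; rewrite lee_fin ge0_ler_powR ?nnegrE ?(ltW q0) ?addr_ge0 //.
    by rewrite -/(T _ _) -/(T _ _) -(subrKA (G x)) (distrC (T (f_ k) x)); exact: ler_normD.
apply: le_trans (integral_powR_add (ltW q0) (mTG n) (mTG k) _ _) _ => //.
apply: (@le_trans _ _ ((2 `^ q)%:E * ((e / (2 `^ q * 2))%:E + (e / (2 `^ q * 2))%:E))%E).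
  by rewrite lee_wpmul2l ?lee_fin ?powR_ge0 // leeD ?key.
rewrite -EFinD -EFinM lee_fin le_eqVlt; apply/orP; left; apply/eqP.
by field; rewrite gt_eqF // powR_gt0.
Qed.

End BumpOperator.

(** * Diagonal extraction and completeness *)

Section Diagonal.
Context {R : realType}.

Lemma increasing_seq_ge (h : nat -> nat) : {homo h : m n / (m < n)%N} ->
  forall n, (n <= h n)%N.
Proof. by move=> hh; elim=> // n ih; exact: leq_ltn_trans ih (hh _ _ (ltnSn n)). Qed.

Lemma bounded_subsequence (u : nat -> R) : (exists B : R, forall n, `|u n| <= B) ->
  exists h : nat -> nat, {homo h : m n / (m < n)%N} /\ cvgn (u \o h).
Proof.
move=> [B uB].
have bu : bounded_fun u.
  by exists B; split; rewrite ?num_real // => x Bx n _ /=; exact: le_trans (uB n) (ltW Bx).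
have [h hi ch] := bolzano_weierstrass bu.
by exists h; split => // m n mn; rewrite (leqW_mono hi).
Qed.

Lemma diagonal_extraction (u : nat -> nat -> R) :
  (forall i, exists B : R, forall n, `|u i n| <= B) ->
  exists h : nat -> nat, {homo h : m n / (m < n)%N} /\ forall i, cvgn (u i \o h).
Proof.
move=> uB.
pose incr (h : nat -> nat) := {homo h : m n / (m < n)%N}.
have /choice[tau tauP] : forall ih : nat * (nat -> nat),
    exists t, incr t /\ cvgn ((u ih.1 \o ih.2) \o t).
  move=> [i h]; apply: bounded_subsequence; have [B hB] := uB i.
  by exists B => n /=; exact: hB.
(* Nested extractions: [tau (i, h)] makes [u i] converge along a subsequence of [h], and each stage
   refines the previous one. *)
pose s := fix s i : nat -> nat :=
  if i is k.+1 then s k \o tau (k.+1, s k) else tau (0%N, id).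
have incr_comp f g : incr f -> incr g -> incr (f \o g).
  by move=> hf hg m n mn; apply: hf; exact: hg.
have s_incr i : incr (s i).
  elim: i => [|k ih]; first exact: (tauP (0%N, id)).1.
  exact: incr_comp ih (tauP (k.+1, s k)).1.
have s_cvg i : cvgn (u i \o s i).
  by case: i => [|k]; [exact: (tauP (0%N, id)).2|exact: (tauP (k.+1, s k)).2].
(* From index [i] on, the diagonal runs through values of [s i] at positions at least as large as
   its own, so it inherits the limit of [u i] along [s i]. *)
have s_sub i n : (i <= n)%N -> forall j, exists k, (j <= k)%N /\ s n j = s i k.
  elim: n => [|n ih]; first by rewrite leqn0 => /eqP -> j; exists j.
  rewrite leq_eqVlt => /predU1P[->|]; first by move=> j; exists j.
  rewrite ltnS => /ih h j.
  have [k [jk e]] := h (tau (n.+1, s n) j); exists k; split; last exact: e.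
  exact: leq_trans (increasing_seq_ge (tauP (n.+1, s n)).1 j) jk.
exists (fun n => s n n); split.
  have step n : (s n n < s n.+1 n.+1)%N.
    apply: s_incr => /=.
    exact: (increasing_seq_ge (tauP (n.+1, s n)).1 n.+1).
  by apply: homo_ltn step; exact: ltn_trans.
move=> i; apply/cvg_ex; exists (limn (u i \o s i)).
have /cvgrPdist_lt h := s_cvg i.
apply/cvgrPdist_lt => e e0; have [N _ hN] := h e e0.
exists (maxn N i) => // n /= ; rewrite geq_max => /andP[Nn inn].
have [k [nk ->]] := s_sub i n inn n.
by apply: hN => /=; exact: leq_trans Nn nk.
Qed.

End Diagonal.

(** * Completeness of [L^q] *)

Section Complete.
Context d (T : measurableType d) {R : realType} (mu : {measure set T -> \bar R}).
Variable q : R.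
Hypothesis q0 : 0 < q.

Lemma cvg_powR (u : nat -> R) (l : R) : (forall n, 0 <= u n) ->
  u n @[n --> \oo] --> l -> u n `^ q @[n --> \oo] --> l `^ q.
Proof.
move=> u0 ul.
have : 0 <= l.
  rewrite -(cvg_lim (@Rhausdorff R) ul); apply: limr_ge; first by apply/cvg_ex; exists l.
  exact: nearW.
rewrite le_eqVlt => /predU1P[e|l0].
  by rewrite -e powR0 ?gt_eqF //; apply: cvg_powR0 => //; rewrite e.
apply: (@continuous_cvg _ _ _ _ _ _ (fun t => t `^ q)) => //.
exact: powR_continuous_at.
Qed.

Lemma Lp_complete (h : nat -> T -> R) :
  (forall n, measurable_fun setT (h n)) ->
  (forall e : R, 0 < e -> exists N : nat, forall n k, (N <= n)%N -> (N <= k)%N ->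
    (\int[mu]_x (`|h n x - h k x| `^ q)%:E <= e%:E)%E) ->
  exists g : T -> R, measurable_fun setT g /\
    forall e : R, 0 < e -> exists N : nat, forall n, (N <= n)%N ->
      (\int[mu]_x (`|h n x - g x| `^ q)%:E <= e%:E)%E.
Proof.
move=> mh hC.
(* With this rate the integrals of [(2 ^ k * dd k) ^ q] are summable. Their sum is then finite
   almost everywhere, which forces [dd k x <= b / 2 ^ k] with [b] depending on [x]. *)
pose ep k : R := (2 ^+ k) `^ (- q) * 2^-1 ^+ k.
have ep0 k : 0 < ep k by rewrite mulr_gt0 ?powR_gt0 ?exprn_gt0 ?invr_gt0.
have /choice[N0 hN0] : forall k, exists N : nat, forall n j, (N <= n)%N -> (N <= j)%N ->
    (\int[mu]_x (`|h n x - h j x| `^ q)%:E <= (ep k)%:E)%E.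
  by move=> k; exact: hC.
pose s := fix s k : nat := if k is j.+1 then maxn (N0 k) (s j).+1 else N0 0%N.
have sN k : (N0 k <= s k)%N by case: k => [|k] /=; rewrite ?leq_maxl.
have sS k : (s k < s k.+1)%N by rewrite /= leq_maxr.
have s_ge : forall k, (k <= s k)%N.
  by apply: increasing_seq_ge; apply: homo_ltn sS; exact: ltn_trans.
pose dd k x := `|h (s k.+1) x - h (s k) x|.
have dd0 k x : 0 <= dd k x by exact: normr_ge0.
have mdd k : measurable_fun setT (dd k).
  by apply: measurableT_comp => //; exact: measurable_funB.
pose F k x := ((2 ^+ k * dd k x) `^ q)%:E.
have F0 k x : (0 <= F k x)%E by rewrite lee_fin powR_ge0.
have mF k : measurable_fun setT (F k).
  by apply: (@measurable_EFin_powR _ _ _ _ (fun x => 2 ^+ k * dd k x)); exact: measurable_funM.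
have intF k : (\int[mu]_x F k x <= (2^-1 ^+ k)%:E)%E.
  have e x : F k x = (((2 ^+ k) `^ q)%:E * (dd k x `^ q)%:E)%E.
    by rewrite /F powRM // exprn_ge0.
  under eq_integral do rewrite e.
  rewrite ge0_integralZl_EFin ?powR_ge0 //=; last 2 first.
  - by move=> x _; rewrite lee_fin powR_ge0.
  - exact: measurable_EFin_powR.
  have -> : (2^-1 ^+ k)%:E = (((2 ^+ k) `^ q)%:E * (ep k)%:E)%E :> \bar R.
    have ne : (2 ^+ k) `^ q != 0 :> R by rewrite gt_eqF // powR_gt0 // exprn_gt0.
    by rewrite -EFinM /ep powRN mulrA divff // mul1r.
  rewrite lee_wpmul2l ?lee_fin ?powR_ge0 //; apply: hN0; last exact: sN.
  exact: leq_trans (sN k) (ltnW (sS k)).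
pose S x := (\sum_(0 <= k <oo) F k x)%E.
have mS : measurable_fun setT S.
  by apply: ge0_emeasurable_sum => // k x _; exact: F0.
have S0 x : (0 <= S x)%E by apply: nneseries_ge0 => k _ _; exact: F0.
have intS : (\int[mu]_x S x < +oo)%E.
  rewrite integral_nneseries //.
  apply: (@le_lt_trans _ _ (\sum_(0 <= k <oo) (2 / (2 ^ (k + 1))%:R)%:E)%E).
    apply: lee_nneseries => [k *|k *]; first by apply: integral_ge0 => x _; exact: F0.
    apply: le_trans (intF k) _; rewrite lee_fin le_eqVlt; apply/orP; left; apply/eqP.
    by rewrite addn1 natrX exprS exprVn; field; rewrite expf_neq0.
  have hh := @cvg_geometric_eseries_half R 2 0.
  by rewrite (cvg_lim _ hh) ?ltry.
have aeS : {ae mu, forall x, (S x < +oo)%E}.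
  have iS : mu.-integrable setT S.
    apply/integrableP; split => //; apply: le_lt_trans intS.
    by rewrite le_eqVlt; apply/orP; left; apply/eqP; apply: eq_integral => x _; rewrite gee0_abs.
  apply: ae_imply (integrable_ae measurableT iS) => x /(_ I).
  by rewrite ge0_fin_numE.
(* An upper limit is measurable wherever the sequence may diverge, and it is the limit almost
   everywhere. *)
pose g x := fine (limn_esup (fun k => (h (s k) x)%:E)).
have mg : measurable_fun setT g.
  apply: measurableT_comp; first exact: fine_measurable.
  by apply: measurable_fun_limn_esup => k; exact: measurable_EFinT (mh _).
have aeg : {ae mu, forall x, h (s k) x @[k --> \oo] --> g x}.
  apply: ae_imply aeS => x Sx.
  pose B := fine (S x).
  have FB k : (2 ^+ k * dd k x) `^ q <= B.
    rewrite -lee_fin /B fineK ?ge0_fin_numE //.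
    have : (F k x <= \sum_(0 <= j < k.+1) F j x)%E.
      by rewrite big_nat_recr //= leeDr // sume_ge0.
    move/le_trans; apply.
    by apply: nneseries_lim_ge => j _ _; exact: F0.
  have B0 : 0 <= B by exact: fine_ge0.
  pose b := B `^ q^-1.
  have b0 : 0 <= b by exact: powR_ge0.
  have ddb k : dd k x <= b / 2 ^+ k.
    rewrite ler_pdivlMr ?exprn_gt0 // mulrC.
    have p0 : 0 <= 2 ^+ k * dd k x by rewrite mulr_ge0 ?exprn_ge0.
    have -> : 2 ^+ k * dd k x = ((2 ^+ k * dd k x) `^ q) `^ q^-1.
      by rewrite -powRrM divff ?gt_eqF // powRr1.
    by apply: ge0_ler_powR; rewrite ?nnegrE ?powR_ge0 ?invr_ge0 ?(ltW q0).
  have tele k j : `|h (s (k + j)%N) x - h (s k) x| <= 2 * b / 2 ^+ k - 2 * b / 2 ^+ (k + j).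
    elim: j => [|j ih]; first by rewrite addn0 !subrr normr0.
    rewrite addnS -(subrKA (h (s (k + j)%N) x)).
    apply: le_trans (ler_normD _ _) _.
    apply: le_trans (lerD (ddb (k + j)%N) ih) _.
    rewrite exprS; move: (2 ^+ (k + j)) (exprn_gt0 (k + j) (ltr0Sn R 1)) => z z0.
    rewrite le_eqVlt; apply/orP; left; apply/eqP; field.
    by rewrite ?expf_neq0 // ?gt_eqF.
  have c : cvgn (fun k => h (s k) x).
    apply: cauchy_cvgn => e e0.
    have [N _ hN] : \forall k \near \oo, 4 * b / e < 2 ^+ k.
      apply: filterS (nbhs_infty_gtr (4 * b / e)) => n /lt_le_trans; apply.
      by rewrite -natrX ler_nat ltnW // ltn_expl.
    have close n : (N <= n)%N -> `|h (s n) x - h (s N) x| <= e / 2.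
      move=> Nn; rewrite -(subnKC Nn); apply: le_trans (tele _ _) _.
      apply: (@le_trans _ _ (2 * b / 2 ^+ N)).
        by rewrite gerBl divr_ge0 ?mulr_ge0 ?exprn_ge0.
      have := hN N (leqnn N); rewrite /= ltr_pdivrMr // => h1.
      rewrite ler_pdivrMr ?exprn_gt0 //; move: h1; rewrite [e / 2 * _]mulrAC; lra.
    exists N => n k Nn Nk.
    have a1 := close n Nn; have a2 := close k Nk.
    rewrite -(subrKA (h (s N) x)); apply: le_trans (ler_normD _ _) _.
    by rewrite (distrC (h (s N) x)); lra.
  have cE : (h (s k) x)%:E @[k --> \oo] --> (limn (fun k => h (s k) x))%:E.
    by apply: cvg_EFin => //; exact: nearW.
  by rewrite /g (cvg_limn_einf_sup cE).2.
exists g; split => // e e0.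
have [N hN] := hC e e0.
exists N => n Nn.
have mq j : measurable_fun setT (fun x => `|h n x - h (s (j + N)%N) x|).
  by apply: measurableT_comp => //; exact: measurable_funB.
(* With [n] fixed, Fatou runs along the subsequence. The shift by [N] brings all its indices into
   the range of the Cauchy condition. *)
apply: (@fatou_bound _ _ _ mu setT (fun j x => (`|h n x - h (s (j + N)%N) x| `^ q)%:E)).
- exact: measurableT.
- by move=> j; exact: measurable_EFin_powR (mq j).
- by move=> j x _; rewrite lee_fin powR_ge0.
- apply: measurable_EFin_powR; apply: measurableT_comp => //.
  exact: measurable_funB.
- by move=> x _; rewrite lee_fin powR_ge0.
- apply: ae_imply aeg => x hx _; apply: cvg_EFin; first exact: nearW.
  apply: cvg_powR => //; apply: cvg_norm; apply: cvgB; first exact: cvg_cst.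
  by rewrite (cvg_shiftn N (fun k => h (s k) x)).
- move=> j; apply: hN => //.
  exact: leq_trans (leq_addl _ _) (s_ge _).
Qed.

End Complete.

(** * Compactness of the commutator *)

Section Assembly.
Context {R : realType}.
Local Notation mu := (@lebesgue_measure R).
Implicit Types (f g b phi : R -> R).

Lemma Lpnorm_powR (r : R) f : 0 < r ->
  (Lpnorm r f `^ r = \int[mu]_x (`|f x| `^ r)%:E)%E.
Proof. by move=> r0; rewrite /Lpnorm powR_Lnorm ?gt_eqF. Qed.

Lemma inLp_measurable (r : R) f : inLp r f -> measurable_fun setT f.
Proof. by move=> /sub_Lfun_mfun; rewrite inE. Qed.

Lemma inLp_ball (r : R) f : 0 < r -> inLp r f -> (Lpnorm r f <= 1%:E)%E -> in_ball r f.
Proof.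
move=> r0 fr f1; split; first exact: inLp_measurable fr.
rewrite -Lpnorm_powR // -(poweR1r r).
by apply: ge0_le_poweR f1; [exact: ltW|exact: Lnorm_ge0].
Qed.

Lemma Lpnorm_le (r e : R) f : 0 < r -> 0 <= e ->
  (\int[mu]_x (`|f x| `^ r)%:E <= (e `^ r)%:E)%E -> (Lpnorm r f <= e%:E)%E.
Proof.
move=> r0 e0; rewrite -Lpnorm_powR // => h.
have inv (x : \bar R) : (0 <= x)%E -> ((x `^ r) `^ r^-1 = x)%E.
  by move=> x0; rewrite -poweRrM divff ?gt_eqF // poweRe1.
rewrite -(inv (Lpnorm r f)) ?Lnorm_ge0 // -(inv e%:E) ?lee_fin //.
apply: ge0_le_poweR; first by rewrite invr_ge0 ltW.
  exact: poweR_ge0.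
by rewrite poweR_EFin.
Qed.

Lemma inLpI (r : R) f : 0 < r -> measurable_fun setT f ->
  (\int[mu]_x (`|f x| `^ r)%:E < +oo)%E -> inLp r f.
Proof.
move=> r0 mf; rewrite -Lpnorm_powR // => h.
rewrite /inLp /Lfun inE /=; apply/andP; split; first by rewrite inE.
by rewrite inE /= /finite_norm; apply: lty_poweRy h; rewrite gt_eqF.
Qed.

Lemma mean_osc_le_bmo f (k : R) : (bmo_norm f < k%:E)%E ->
  forall a c, a < c -> mean_osc f a c <= k.
Proof.
move=> fk a c ac; rewrite -lee_fin; apply: le_trans (ltW fk).
by apply: ereal_sup_ubound; exists a, c.
Qed.

Lemma continuous_locally_integrable f : continuous f -> Defs.locally_integrable f.
Proof.
move=> cf; split; first exact: continuous_measurable_fun.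
move=> a c; apply: continuous_compact_integrable; first exact: segment_compact.
exact: continuous_subspaceT.
Qed.

Lemma locally_integrable_sub f g : Defs.locally_integrable f -> Defs.locally_integrable g ->
  Defs.locally_integrable (fun x => f x - g x).
Proof.
move=> [mf lf] [mg lg]; split; first exact: measurable_funB.
move=> a c; have := integrableB _ (lf a c) (lg a c).
exact.
Qed.

(** An enumeration of the rationals as reals; integers that code no rational give 0. *)
Definition rat_pt (i : nat) : R := if unpickle i is Some r then ratr (r : rat) else 0.

Lemma rat_pt_dense (x : R) : exists s : nat -> nat, rat_pt (s n) @[n --> \oo] --> x.
Proof.
have /choice[r hr] : forall n : nat, exists r : rat, (ratr r : R) \in `]x, (x + n.+1%:R^-1)[.
  by move=> n; apply: rat_in_itvoo; rewrite ltrDl invr_gt0.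
exists (fun n => pickle (r n)); apply/cvgrPdist_lt => e e0.
have := near_infty_natSinv_lt (PosNum e0); apply: filterS => n /= ne.
rewrite /rat_pt pickleK; have := hr n; rewrite in_itv /= => /andP[h1 h2].
by rewrite distrC gtr0_norm ?subr_gt0 // ltrBlDl; apply: lt_trans h2 _; rewrite ltrD2l.
Qed.

Lemma frac_int_plus0 (al : R) f x : (forall y, f y = 0) -> frac_int_plus al f x = 0.
Proof.
move=> f0; rewrite /frac_int_plus /Rintegral.
have -> : (\int[mu]_(y in `]x, +oo[) (f y * (y - x) `^ (al - 1))%:E = 0)%E; last by [].
by apply: integral0_eq => y _; rewrite f0 mul0r.
Qed.

Variables (p q al : R) (b : R -> R).
Hypotheses (p1 : 1 < p) (pq : p < q) (al0 : 0 < al) (al1 : al < 1).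
Hypothesis (qE : q^-1 = p^-1 - al).
Hypothesis bCMO : inCMO b.

Let q0 : 0 < q. Proof. exact: lt_trans (lt_trans ltr01 p1) pq. Qed.

Let lb : Defs.locally_integrable b := bCMO.1.1.

Let bmo_b : exists kb : R, 0 < kb /\ forall a c, a < c -> mean_osc b a c <= kb.
Proof.
have h := bCMO.1.2; exists (Num.max 1 (fine (bmo_norm b) + 1)); split.
  by rewrite lt_max ltr01.
apply: mean_osc_le_bmo; move: h; case: (bmo_norm b) => [r _| |_] //=.
  by rewrite lte_fin lt_max; apply/orP; right; rewrite ltrDl.
exact: ltNyr.
Qed.

Let approx : exists phi : nat -> R -> R, forall k, [/\ smooth (phi k),
  compact_support (phi k) &
  forall a c, a < c -> mean_osc (fun x => b x - phi k x) a c <= k.+1%:R^-1].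
Proof.
suff /choice[phi hphi] : forall k : nat, exists phi : R -> R, [/\ smooth phi,
    compact_support phi &
    forall a c, a < c -> mean_osc (fun x => b x - phi x) a c <= k.+1%:R^-1].
  by exists phi.
move=> k; have [|phi [sphi [cphi bphi]]] := bCMO.2 k.+1%:R^-1; first by rewrite invr_gt0.
by exists phi; split => //; exact: mean_osc_le_bmo.
Qed.

Let in_ball0 : in_ball p (fun _ : R => 0).
Proof.
split; first exact: measurable_cst.
rewrite (_ : (\int[mu]_x (`|0| `^ p)%:E)%E = 0%E) ?lee01 //.
apply: integral0_eq => x _; rewrite normr0 powR0 // gt_eqF //.
exact: lt_trans ltr01 p1.
Qed.

(** The comparison of commutators with [phi = 0] and [g = 0]: only the error term is left, with [b]
    itself in the place of [b - phi]. *)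
Lemma comm_frac_int_lty f : in_ball p f ->
  (\int[mu]_x (`|comm_frac_int b al f x| `^ q)%:E < +oo)%E.
Proof.
move=> bf; have [C [_ hC]] := comm_diff_bound p1 pq al0 al1 qE.
have [kb [kb0 hkb]] := bmo_b.
have e0 : (fun t => b t - cst 0 t) = b by apply/funext => t; rewrite subr0.
have := hC b (cst 0) kb kb kb0 lb hkb (measurable_cst _) kb0.
rewrite e0 => /(_ lb hkb f (fun _ => 0) bf in_ball0) h.
have z x : comm_frac_int b al (fun _ => 0) x = 0.
  by rewrite /comm_frac_int !frac_int_plus0 ?mulr0 ?subr0 // => y; rewrite mulr0.
have z2 g x : comm_op al (cst 0) g x = 0.
  rewrite /comm_op /Rintegral (_ : (\int[mu]_y (comm_kernel al (cst 0) g x y)%:E)%E = 0%E) //.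
  by apply: integral0_eq => y _; rewrite /comm_kernel subrr mul0r; case: ifP.
have -> : (\int[mu]_x (`|comm_frac_int b al f x| `^ q)%:E =
    \int[mu]_x (`|comm_frac_int b al f x - comm_frac_int b al (fun _ => 0%R) x| `^ q)%:E)%E.
  by apply: eq_integral => x _; rewrite z subr0.
apply: le_lt_trans h _.
rewrite (_ : (\int[mu]_x (`|comm_op al (cst 0) f x -
    comm_op al (cst 0) (fun _ => 0%R) x| `^ q)%:E)%E = 0%E).
  by rewrite add0e -EFinM ltry.
by apply: integral0_eq => x _; rewrite !z2 subrr normr0 powR0 // gt_eqF.
Qed.

Lemma comm_frac_int_cauchy (fs : nat -> R -> R) : (forall n, in_ball p (fs n)) ->
  exists h : nat -> nat, {homo h : m n / (m < n)%N} /\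
    forall e : R, 0 < e -> exists N : nat, forall n k, (N <= n)%N -> (N <= k)%N ->
    (\int[mu]_x (`|comm_frac_int b al (fs (h n)) x - comm_frac_int b al (fs (h k)) x| `^ q)%:E
      <= e%:E)%E.
Proof.
move=> bfs; have [phi hphi] := approx.
have [C [C0 hC]] := comm_diff_bound p1 pq al0 al1 qE.
have [kb [kb0 hkb]] := bmo_b.
(* One index encodes the pair of an approximant [k] and a rational point [j], so a single diagonal
   extraction treats all pairs. The bound is the pointwise one of [bump_op_le]. *)
have /diagonal_extraction[h [hincr hcvg]] : forall i : nat, exists B : R, forall n : nat,
    `|(fun i n => if unpickle i is Some (k, j)
       then comm_op al (phi k) (fs n) (rat_pt j) else 0) i n| <= B.
  move=> i; case: (unpickle i) => [[k j]|]; last by exists 0 => n; rewrite normr0.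
  have [sp cp _] := hphi k.
  have [A [M [A0 M0 lip supp]]] := smooth_compact_lip sp cp.
  eexists => n.
  exact: (bump_op_le p1 pq al0 al1 qE A0 M0 lip supp (rat_pt j) (bfs n)).
exists h; split => // e e0.
have bfh n : in_ball p (fs (h n)) by exact: bfs.
have Q0 : 0 < 2 `^ q :> R by rewrite powR_gt0.
(* Chosen so that [C * d ^ q] is at most half of [e / 2 ^ q]; [C + 1] replaces [C], which may be
   0. *)
pose d := (e / (2 * 2 `^ q * (C + 1))) `^ q^-1.
have C1 : 0 < C + 1 by rewrite ltr_wpDl.
have d0 : 0 < d by rewrite powR_gt0 // divr_gt0 // !mulr_gt0.
have [k hk] : exists k : nat, k.+1%:R^-1 < d.
  by have [k _ hk] := near_infty_natSinv_lt (PosNum d0); exists k; exact: (hk k (leqnn k)).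
have [sp cp osc] := hphi k.
have [A [M [A0 M0 lip supp]]] := smooth_compact_lip sp cp.
have cphi := lip_continuous A0 lip.
have lpsi := locally_integrable_sub lb (continuous_locally_integrable cphi).
have cpts j : cvgn (fun n => comm_op al (phi k) (fs (h n)) (rat_pt j)).
  by have := hcvg (pickle (k, j)); rewrite /comp /= pickleK.
have e2 : 0 < e / (2 * 2 `^ q) by rewrite divr_gt0 // mulr_gt0.
have [N hN] := bump_op_compact p1 pq al0 al1 qE A0 M0 lip supp bfh rat_pt_dense cpts e2.
exists N => n j nN jN.
have kk0 : 0 < k.+1%:R^-1 :> R by rewrite invr_gt0.
apply: le_trans (hC b (phi k) kb _ kb0 lb hkb (measurable_lip A0 lip) kk0 lpsi osc
  _ _ (bfh n) (bfh j)) _.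
apply: (@le_trans _ _ ((2 `^ q)%:E * ((e / (2 * 2 `^ q))%:E + (e / (2 * 2 `^ q))%:E))%E).
  rewrite lee_wpmul2l ?lee_fin ?(ltW Q0) // leeD ?hN // lee_fin.
  apply: (@le_trans _ _ (C * d `^ q)).
    by rewrite ler_wpM2l //; apply: ge0_ler_powR; rewrite ?nnegrE ?(ltW q0) ?(ltW kk0) ?(ltW d0) ?(ltW hk).
  rewrite /d -powRrM mulVf ?gt_eqF // powRr1; last first.
    by rewrite divr_ge0 ?(ltW e0) // mulr_ge0 ?(ltW C1) // mulr_ge0 ?(ltW Q0).
  apply: (@le_trans _ _ ((C + 1) * (e / (2 * 2 `^ q * (C + 1))))).
    rewrite ler_wpM2r ?lerDl // divr_ge0 ?(ltW e0) //.
    by rewrite mulr_ge0 ?(ltW C1) // mulr_ge0 ?(ltW Q0).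
  rewrite le_eqVlt; apply/orP; left; apply/eqP; field.
  by rewrite !gt_eqF.
rewrite -EFinD -EFinM lee_fin le_eqVlt; apply/orP; left; apply/eqP; field.
by rewrite gt_eqF.
Qed.

End Assembly.

Theorem theorem3p7 (R : realType) (p q alpha : R) (b : R -> R) :
  1 < p -> p < q -> 0 < alpha < 1 -> q^-1 = p^-1 - alpha ->
  inCMO b ->
  compact_op p q (comm_frac_int b alpha).
Proof.
move=> p1 pq /andP[al0 al1] qE bCMO fs hfs.
have p0 : 0 < p by exact: lt_trans ltr01 p1.
have q0 : 0 < q by exact: lt_trans p0 pq.
have bfs n : in_ball p (fs n) by have [h1 h2] := hfs n; exact: inLp_ball.
have [h [hincr hc]] := comm_frac_int_cauchy p1 pq al0 al1 qE bCMO bfs.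
have mh n : measurable_fun setT (comm_frac_int b alpha (fs (h n))).
  by apply: measurable_comm_frac_int; [exact: bCMO.1.1.1|exact: (bfs (h n)).1].
have [g [mg hg]] := @Lp_complete _ _ R lebesgue_measure q q0 _ mh hc.
exists h, g; split => //; split.
  (* The limit lies in [L^q] because it is at finite distance from one image, itself in [L^q]. *)
  have [N hN] := hg 1 ltr01.
  apply: inLpI => //.
  have md : measurable_fun setT (fun x => `|comm_frac_int b alpha (fs (h N)) x - g x|).
    by apply: measurableT_comp => //; exact: measurable_funB.
  have mn : measurable_fun setT (fun x => `|comm_frac_int b alpha (fs (h N)) x|).
    exact: measurableT_comp.
  apply: (@le_lt_trans _ _ (\int[@lebesgue_measure R]_x
    ((`|comm_frac_int b alpha (fs (h N)) x| + `|comm_frac_int b alpha (fs (h N)) x - g x|) `^ q)%:E)%E).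
    apply: ge0_le_integral.
    - exact: measurableT.
    - by move=> x _; rewrite lee_fin powR_ge0.
    - by apply: measurable_EFin_powR; exact: measurableT_comp.
    - by apply: measurable_EFin_powR; exact: measurable_funD.
    - move=> x _; rewrite lee_fin; apply: ge0_ler_powR; rewrite ?nnegrE ?addr_ge0 ?(ltW q0) //.
      rewrite -[X in `|X| <= _](subKr (comm_frac_int b alpha (fs (h N)) x)).
      exact: ler_normB.
  apply: le_lt_trans (integral_powR_add (ltW q0) mn md _ _) _ => //.
  rewrite lte_mul_pinfty ?lee_fin ?powR_ge0 // lte_add_pinfty //.
    exact: comm_frac_int_lty p1 pq al0 al1 qE bCMO _ (bfs (h N)).
  exact: le_lt_trans (hN N (leqnn N)) (ltry _).
move=> eps eps0.
(* Half of [eps] turns the large inequality from completeness into a strict one. *)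
have e2 : 0 < eps / 2 by rewrite divr_gt0.
have [N hN] := hg ((eps / 2) `^ q) (powR_gt0 q e2).
exists N => n nN; apply: (@le_lt_trans _ _ (eps / 2)%:E).
  by apply: Lpnorm_le (hN n nN) => //; exact: ltW.
by rewrite lte_fin; lra.
Qed.
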